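(* Let $V=V_\bullet=(V_n)_{n\in\mathbb{N}}$ be a sequence where each $V_n$ is a finite-dimensional $\mathbb{C}[S_n]$-module. (a) $V$ is URMS if and only if $\mathrm{wt}(V)<\infty$ and the sequence of Frobenius images $(\mathcal{F}(V_n))_n$ is $m$-stable. In this case, for each partition $\lambda$, the multiplicity of $\mathbb{S}^{\lambda[n]}$ in $V_n$ stabilizes (is constant in $n$) once $$n\ge \max\Bigl(2|\lambda|,\ \max_{|\mu|\le|\lambda|}\mathrm{rg}^m_\mu(\mathcal{F}(V_\bullet))\Bigr),$$ and a URMS stable range of $V_\bullet$ is given by $$n\ge \max\Bigl(2\,\mathrm{wt}(V),\ \max_{|\mu|\le \mathrm{wt}(V)}\mathrm{rg}^m_\mu(\mathcal{F}(V_\bullet))\Bigr).$$ (b) $V$ is URMS if and only if $\mathrm{wt}(V)<\infty$ and for every $k\le \mathrm{wt}(V)$ and every $\sigma\in S_k$ the character value $$\chi^{V_n}\bigl(\sigma\cdot(k+1\ \ k+2\ \cdots\ n)\bigr)$$ stabilizes for sufficiently large $n$. In this case, a URMS stable range of $V_\bullet$ is given by $$n\ge \max\Bigl(2\,\mathrm{wt}(V)+1,\ \max_{|\mu|\le \mathrm{wt}(V)}\mathrm{rg}^{p/z}_\mu(\mathcal{F}(V_\bullet))\Bigr),$$ where $\mathrm{rg}^{p/z}_\mu(\mathcal{F}(V_\bullet))$ is the minimum $n$ from which on the character value $\chi^{V_n}\bigl(\sigma\cdot(|\mu|+1\ \ |\mu|+2\ \cdots\ n)\bigr)$ has stabilized,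 $\sigma$ being any element of $S_{|\mu|}$ of cycle type $\mu$.
   Context: For a partition $\lambda=(\lambda_1,\dots,\lambda_l)$ and $n$ with $n-|\lambda|\ge\lambda_1$ (with $\lambda_1=0$ if $\lambda=\emptyset$), $\lambda[n]:=(n-|\lambda|,\lambda_1,\dots,\lambda_l)\vdash n$; otherwise $\lambda[n]$ is undefined. $\mathbb{S}^\nu$ is the irreducible $\mathbb{C}[S_n]$-module (Specht module) indexed by $\nu\vdash n$. Write $V_n\cong\bigoplus_\lambda(\mathbb{S}^{\lambda[n]})^{\oplus c_{\lambda,n}}$, with $c_{\lambda,n}=0$ when $\lambda[n]$ is undefined. $V_\bullet$ is URMS (uniformly representation multiplicity stable) if there is $N$ such that $c_{\lambda,n}=c_{\lambda,n+1}$ for all $n\ge N$ and all partitions $\lambda$; such an $N$ is a URMS stable range, and ''a URMS stable range is given by $n\ge N$'' means that this $N$ is one. The weight is $\mathrm{wt}(V)=\sup\{|\lambda| : c_{\lambda,n}\ne0 \text{ for some } n\ge|\lambda|+\lambda_1\}$ (supremum of the empty set being $0$). The Frobenius characteristic $\mathcal{F}$ is the linear map with $\mathcal{F}(\mathbb{S}^\nu)=s_\nu$ (Schur function). For a sequence of homogeneous symmetric functions $F_n$ of degree $n$ over $\mathbb{C}$, write $F_n=\sum_\mu d_{\mu,n}m_{\mu[n]}$ in the monomial basis, with $d_{\mu,n}=0$ if $\mu[n]$ is undefined. $\mathrm{rg}^m_\mu(F_\bullet)$ is the smallest $n$ such that $d_{\mu,n}=d_{\mu,n+k}$ for all $k\ge0$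 ($\infty$ if none exists); $F_\bullet$ is $m$-stable if $\mathrm{rg}^m_\mu(F_\bullet)<\infty$ for all $\mu$. $\chi^{V_n}$ is the character of $V_n$; for $\sigma\in S_k\subseteq S_n$, $\sigma\cdot(k+1\ \cdots\ n)$ is the product of $\sigma$ with the cycle of length $n-k$ on $\{k+1,\dots,n\}$. *)

(* Defs.v *)
From HB Require Import structures.
From mathcomp Require Import all_boot all_order all_algebra all_fingroup.
From mathcomp Require Import all_solvable all_field all_character.
From mathcomp Require Import finmap complex.
From mathcomp Require Import boolp classical_sets reals.

Set Implicit Arguments.
Unset Strict Implicit.
Unset Printing Implicit Defensive.

Import Order.TTheory GRing.Theory Num.Theory.
Local Open Scope ring_scope.
Local Open Scope complex_scope.

(** ** The extended naturals; [None] stands for infinity *)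

Definition xnat := option nat.

Definition xmax (x y : xnat) : xnat :=
  if x is Some m then if y is Some n then Some (maxn m n) else None else None.

(* The minimum of [P], infinite when [P] is empty. *)
Definition least (P : nat -> Prop) : xnat :=
  if pselect (exists n, `[< P n >]) is left exP then Some (ex_minn exP)
  else None.

(** ** Partitions *)

Definition is_part (s : seq nat) : bool := sorted geq s && (0%N \notin s).

(* A partition of n has at most n parts, all of them at most n. *)
Definition partitions (n : nat) : seq (seq nat) :=
  [seq s <- [seq map val (tval t) | m <- iota 0 n.+1, t <- enum {: m.-tuple 'I_n.+1}]
  | is_part s && (sumn s == n)].

Lemma mem_partitions n s :
  (s \in partitions n) = is_part s && (sumn s == n).
Proof.
rewrite mem_filter; apply: andb_idr => /andP[/andP[_ s_pos] /eqP sum_s].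
have size_s : (size s < n.+1)%N.
  rewrite ltnS -sum_s; elim: s s_pos {sum_s} => //= a s IHs.
  rewrite inE negb_or eq_sym -lt0n => /andP[a_gt0 /IHs le_s].
  by rewrite -add1n leq_add.
have lt_s i : i \in s -> (i < n.+1)%N.
  rewrite ltnS -sum_s; elim: s {s_pos sum_s size_s} => //= a s IHs.
  rewrite inE => /predU1P[-> | /IHs le_i]; first exact: leq_addr.
  exact: leq_trans le_i (leq_addl _ _).
apply/allpairsPdep; exists (size s), (map_tuple inord (in_tuple s)).
rewrite mem_iota mem_enum -map_comp /=; split=> //.
by rewrite map_id_in // => i /lt_s lt_i /=; rewrite inordK.
Qed.

Lemma partitions_uniq n : uniq (partitions n).
Proof.
apply/filter_uniq/allpairs_uniq_dep => [|m _|]; rewrite ?iota_uniq ?enum_uniq //.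
move=> _ _ /allpairsPdep[m1 [t1 [_ _ ->]]] /allpairsPdep[m2 [t2 [_ _ ->]]] /=.
move=> eq_t; have eq_m : m1 = m2.
  by rewrite -(size_tuple t1) -(size_tuple t2) -(size_map val) eq_t size_map.
case: m2 / eq_m in t2 eq_t *; congr (Tagged _ _).
exact/val_inj/(inj_map val_inj).
Qed.

(* [pad lam n] is lambda[n], meaningful when [padded lam n].  The filter only
   matters for n = 0, where lambda[n] is the empty partition. *)
Definition padded (lam : seq nat) (n : nat) : bool :=
  (sumn lam + head 0 lam <= n)%N.

Definition pad (lam : seq nat) (n : nat) : seq nat :=
  [seq i <- n - sumn lam :: lam | 0 < i]%N.

(* The maximum of [f] over the partitions of size at most k. *)
Definition xmax_parts (k : nat) (f : seq nat -> xnat) : xnat :=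
  \big[xmax/Some 0%N]_(i < k.+1) \big[xmax/Some 0%N]_(mu <- partitions i) f mu.

(** ** Young diagrams

   The cells of a diagram nu of size n are numbered 0, ..., n - 1 along its
   rows, from the top row down. *)

Definition cell_row (nu : seq nat) (c : nat) : nat := reshape_index nu c.
Definition cell_col (nu : seq nat) (c : nat) : nat := reshape_offset nu c.

(** ** Symmetric functions *)

(* Exponents of the monomials in countably many variables. *)
Definition monom := {fsfun nat -> nat with 0%N}.

Section SymmetricFunctions.
Variable R : realType.

(* Formal power series over the complex numbers, as families of
   coefficients. *)
Definition series := monom -> R[i].

Definition monomial_symf (mu : seq nat) : series :=
  fun a => (perm_eq [seq a i | i <- finsupp a] mu)%:R.

(* Semistandard fillings of nu with entries in a finite set of naturals. *)
Definition semistandard (nu : seq nat) (A : {fset nat})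
    (T : {ffun 'I_(sumn nu) -> A}) : bool :=
  [forall c : 'I_(sumn nu), forall c' : 'I_(sumn nu),
    ((cell_row nu c == cell_row nu c') && (cell_col nu c < cell_col nu c')%N
       ==> (val (T c) <= val (T c'))%N) &&
    ((cell_col nu c == cell_col nu c') && (cell_row nu c < cell_row nu c')%N
       ==> (val (T c) < val (T c'))%N)].

(* The coefficient of x^a is the number of semistandard tableaux of shape nu
   and content a; the entries of such a tableau lie in the support of a. *)
Definition schur (nu : seq nat) : series := fun a =>
  #|[set T : {ffun 'I_(sumn nu) -> finsupp a} |
      semistandard T &&
      [forall i : finsupp a, #|[set c | T c == i]| == a (val i)]]|%:R.

(* Coordinates, in the basis of monomial symmetric functions, of a symmetric
   function F homogeneous of degree n. *)
Definition monomial_coord (n : nat) (F : series) : seq nat -> R[i] :=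
  xget (fun=> 0) [set d : seq nat -> R[i] | forall a,
    F a = \sum_(nu <- partitions n) d nu * monomial_symf nu a]%classic.

(* d_{mu,n}, for a sequence of F_n homogeneous of degree n. *)
Definition mcoef (F : nat -> series) (mu : seq nat) (n : nat) : R[i] :=
  if padded mu n then monomial_coord n (F n) (pad mu n) else 0.

Definition rg_m (F : nat -> series) (mu : seq nat) : xnat :=
  least (fun n => forall k, mcoef F mu n = mcoef F mu (n + k)).

Definition m_stable (F : nat -> series) : Prop :=
  forall mu, is_part mu -> rg_m F mu <> None.

End SymmetricFunctions.

(** ** Representations of the symmetric groups

   Permutations of ['I_n] are multiplied from left to right and modules consist
   of row vectors acted upon from the right, which amounts to left modules for
   the usual composition of permutations. *)

Section Specht.
Variables (R : realType) (n : nat) (nu : seq nat).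

Definition row_stab : {set 'S_n} :=
  [set p : 'S_n | [forall c : 'I_n, cell_row nu (p c) == cell_row nu c]].
Definition col_stab : {set 'S_n} :=
  [set q : 'S_n | [forall c : 'I_n, cell_col nu (q c) == cell_col nu c]].

(* The Young symmetrizer of the tableau with entry c in cell c, as an element
   of the regular module.  As (sum of row_stab) * C[S_n] is the module spanned
   by the tabloids, this is the polytabloid of that tableau. *)
Definition polytabloid : 'rV[R[i]]_#|[set: 'S_n]| :=
  \sum_(p in row_stab) \sum_(q in col_stab)
    (-1) ^+ odd_perm q *: delta_mx 0 (gring_index [set: 'S_n]%G (p * q)%g).

Definition specht : representation R[i] [set: 'S_n]%G :=
  Representation (submod_repr
    (cyclic_mx_module (regular_repr R[i] [set: 'S_n]%G) polytabloid)).

End Specht.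

Section Sequences.
Variables (R : realType).

(* Multiplicities of the Specht modules in a module over C[S_n]. *)
Definition specht_mult (n : nat) (V : representation R[i] [set: 'S_n]%G) :
    seq nat -> nat :=
  xget (fun=> 0%N) [set c : seq nat -> nat |
    mx_rsim V (\big[@dadd_grepr _ _ _/@grepr0 _ _ _]_(nu <- partitions n)
                 muln_grepr (specht R n nu) (c nu))]%classic.

Definition frobenius (n : nat) (V : representation R[i] [set: 'S_n]%G) :
    series R :=
  fun a => \sum_(nu <- partitions n) (specht_mult V nu)%:R * schur R nu a.

Variable V : forall n, representation R[i] [set: 'S_n]%G.

(* c_{lambda,n} *)
Definition mult (lam : seq nat) (n : nat) : nat :=
  if padded lam n then specht_mult (V n) (pad lam n) else 0%N.

Definition urms_range (N : nat) : Prop :=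
  forall n, (N <= n)%N ->
  forall lam, is_part lam -> mult lam n = mult lam n.+1.

Definition urms : Prop := exists N, urms_range N.

(* The supremum in the extended naturals, as the least upper bound. *)
Definition weight : xnat :=
  least (fun w => forall lam n, is_part lam ->
    (sumn lam + head 0 lam <= n)%N -> mult lam n <> 0%N -> (sumn lam <= w)%N).

End Sequences.

(** ** Character values *)

(* s and t acting on the first m and on the last n points *)
Definition perm_sum_fun m n (s : 'S_m) (t : 'S_n) (i : 'I_(m + n)) :
    'I_(m + n) :=
  match split i with inl j => lshift n (s j) | inr j => rshift m (t j) end.

Lemma perm_sum_inj m n (s : 'S_m) (t : 'S_n) : injective (perm_sum_fun s t).
Proof.
apply: (can_inj (g := perm_sum_fun s^-1%g t^-1%g)) => i.
rewrite /perm_sum_fun; case: (split_ordP i) => j ->.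
  by rewrite (unsplitK (inl (s j))) permK.
by rewrite (unsplitK (inr (t j))) permK.
Qed.

Definition perm_sum m n (s : 'S_m) (t : 'S_n) : 'S_(m + n) :=
  perm (@perm_sum_inj m n s t).

Definition full_cycle n : 'S_n := perm (@ordS_inj n).

Definition cycle_type n (s : 'S_n) (mu : seq nat) : bool :=
  is_part mu && perm_eq mu [seq #|A| | A : {set 'I_n} <- enum (porbits s)].

Section CharacterValues.
Variables (R : realType) (V : forall n, representation R[i] [set: 'S_n]%G).

(* The character of V_n, n = k + m, at sigma (k+1 k+2 ... n). *)
Definition char_val (k : nat) (s : 'S_k) (m : nat) : R[i] :=
  \tr (V (k + m) (perm_sum s (full_cycle m))).

Definition char_stabilizes (k : nat) (s : 'S_k) : Prop :=
  exists M, forall m, (M <= m)%N -> char_val s m = char_val s M.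

(* The values at the permutations s of cycle type mu coincide, so that it does
   not matter that all of them are considered. *)
Definition rg_pz (mu : seq nat) : xnat :=
  least (fun n => (sumn mu <= n)%N /\
    forall s : 'S_(sumn mu), cycle_type s mu ->
    forall m, (n <= sumn mu + m)%N -> char_val s m = char_val s (n - sumn mu)).

End CharacterValues.

(* Main.v *)
(* (a) The coordinate d_{mu,n} is the sum over lambda of c_{lambda,n} times the
   Kostka number K(lambda[n],mu[n]).  For fixed w and n >= 2w, the matrix of
   these numbers for |lambda|, |mu| <= w is unitriangular and does not depend on
   n, so that the c_{lambda,n} with |lambda| <= w are constant on a range of n
   if and only if the d_{mu,n} with |mu| <= w are.

   (b) For n >= 2w + 1 consider the permutation modules M^{mu[n]}, |mu| <= w.
   If m > |mu|, a tabloid fixed by sigma (k+1 ... k+m) has the long cycle in its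
   first row, so that the value of the character of M^{mu[n]} there does not
   depend on n = k + m.  Let A(lambda,mu) be the multiplicity of S^{lambda[n]}
   in M^{mu[n]}, and B(lambda,mu) the dimension of the invariants of the Young
   subgroup of mu[n] in S^{lambda[n]}.  Both are triangular for the dominance
   order, with nonzero diagonal, and the diagonal entries of B are 1.  Their
   product B^T A counts the orbits of Young subgroups on tabloids, that is,
   matrices with given row and column sums, and does not depend on n.  By
   uniqueness of the LU decomposition A does not depend on n either, hence
   neither do the values of the characters of the S^{lambda[n]} at
   sigma (k+1 ... n).  These values separate the virtual characters
   involved: in terms of the M^{mu[n]}, they are block triangular in |mu| and k,
   and in the diagonal blocks |mu| = k one finds the characters of the M^mu,
   which are linearly independent. *)

Require Import Defs.
From mathcomp Require Import all_boot all_order all_algebra all_fingroup all_solvable.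
From mathcomp Require Import all_character finmap complex boolp reals.
From mathcomp Require classical_sets.
From mathcomp Require Import zify.

Set Implicit Arguments.
Unset Strict Implicit.
Unset Printing Implicit Defensive.

Import Order.TTheory GRing.Theory Num.Theory.
Local Open Scope nat_scope.

(** * Cells of a Young diagram *)

(** The bound [2 * w] makes lambda[n] defined for all [|lambda| <= w] and keeps the lower rows of
    lambda[n] within the columns whose top entry is 0 in any tableau of content mu[n]. The extra 1
    in (b) leaves more than [w] points for the long cycle when [k <= w], hence more than any colour
    class prescribed by mu. Dominance enters through two of its consequences, a comparison of first
    parts and a comparison of sums of row indices; the latter serves as the height for
    triangularity, since it does not change when the first row grows. Schur functions are given by
    tableaux, so their symmetry has to be established before their monomial coordinates can be read
    as Kostka numbers. Specht modules are given as right ideals, so multiplicities acquire content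
    only once these are known to be all the irreducibles. Row sums and Young symmetrizers square to
    multiples of themselves, by a scalar that is the same in every representation. Their trace is
    thus this scalar times their rank, which turns identities between characters into additivity of
    ranks; the matrices A and B are controlled in this way. *)

Lemma part_nth_le nu i j : is_part nu -> i <= j -> nth 0 nu j <= nth 0 nu i.
Proof.
move=> /andP[sorted_nu _] le_ij.
have [lt_j|le_j] := ltnP j (size nu); last by rewrite nth_default.
apply: (sorted_leq_nth (leT := geq)) => //.
- by move=> a b c /= ba cb; apply: leq_trans cb ba.
- exact: leqnn.
- by rewrite inE; apply: leq_ltn_trans lt_j.
Qed.

Lemma part_nth_gt0 nu i : is_part nu -> i < size nu -> 0 < nth 0 nu i.
Proof.
by case/andP=> _ nu0 lt_i; rewrite lt0n; apply: contra nu0 => /eqP <-; rewrite mem_nth.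
Qed.

Lemma cell_row_lt nu c : c < sumn nu -> cell_row nu c < size nu.
Proof. exact: reshape_indexP. Qed.

Lemma cell_col_lt nu c : c < sumn nu -> cell_col nu c < nth 0 nu (cell_row nu c).
Proof. exact: reshape_offsetP. Qed.

Lemma cell_inj nu c c' :
  cell_row nu c = cell_row nu c' -> cell_col nu c = cell_col nu c' -> c = c'.
Proof.
rewrite /cell_row /cell_col => er ec.
by rewrite -[c](reshape_indexK nu) -[c'](reshape_indexK nu) er ec.
Qed.

Lemma cell_exists nu r j : j < nth 0 nu r ->
  exists2 c, c < sumn nu & cell_row nu c = r /\ cell_col nu c = j.
Proof.
move=> lt_j; exists (flatten_index nu r j); first exact: flatten_indexP.
by rewrite /cell_row /cell_col flatten_indexKl ?flatten_indexKr.
Qed.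

Lemma card_row nu n r : sumn nu = n ->
  #|[pred c : 'I_n | cell_row nu c == r]| = nth 0 nu r.
Proof.
move=> nu_n; have lt_fl (j : 'I_(nth 0 nu r)) : flatten_index nu r j < n.
  by rewrite -nu_n flatten_indexP.
pose f j := Ordinal (lt_fl j).
have f_inj : injective f.
  move=> j j' /(congr1 val) /= /(congr1 (reshape_offset nu)).
  by rewrite !flatten_indexKr // => /val_inj.
rewrite -[RHS]card_ord -(card_codom f_inj); apply: eq_card => c /=.
rewrite inE; apply/eqP/codomP => [er | [j ->]]; last first.
  by rewrite /cell_row flatten_indexKl.
have lt_c : cell_col nu c < nth 0 nu r by rewrite -er cell_col_lt ?nu_n.
exists (Ordinal lt_c); apply: val_inj => /=.
by rewrite -er /cell_row /cell_col reshape_indexK.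
Qed.

(* The witness sends [c] to the row of its column given by the rank of [f c]
   among the values of [f] on that column; a rank is at most the value. *)
Lemma column_injective_dominates nu n (f : 'I_n -> nat) :
    is_part nu -> sumn nu = n ->
    (forall c c' : 'I_n, cell_col nu c = cell_col nu c' -> f c = f c' -> c = c') ->
  exists2 q : 'S_n, q \in col_stab n nu & forall c : 'I_n, cell_row nu (q c) <= f c.
Proof.
move=> part_nu nu_n inj_f.
pose K (c : 'I_n) := [set c' : 'I_n | cell_col nu c' == cell_col nu c].
pose rho (c : 'I_n) := #|[set c' in K c | f c' < f c]|.
have rho_le c : rho c <= f c.
  rewrite -[leqRHS](size_iota 0) /rho.
  rewrite cardE -(size_map f) uniq_leq_size //.
    rewrite map_inj_in_uniq ?enum_uniq // => x y.
    rewrite !mem_enum !inE => /andP[/eqP ex _] /andP[/eqP ey _].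
    by apply: inj_f; rewrite ex ey.
  move=> _ /mapP[x + ->]; rewrite mem_enum !inE => /andP[_ lt_x].
  by rewrite mem_iota.
(* If row [rho c] did not reach the column of [c], all cells of this column would lie in rows of
   index less than [rho c], so there would be at most [rho c] of them. But [rho c] counts cells of
   the column and omits [c] itself. *)
have rho_lt (c : 'I_n) : cell_col nu c < nth 0 nu (rho c).
  rewrite ltnNge; apply/negP => le_nu.
  have: #|K c| <= rho c.
    rewrite -[leqRHS](size_iota 0) cardE -(size_map (cell_row nu \o val)).
    rewrite uniq_leq_size // ?map_inj_in_uniq ?enum_uniq // => [x y|_ /mapP[x + ->]].
      rewrite !mem_enum !inE => /eqP ex /eqP ey /= er.
      by apply: val_inj; apply: (cell_inj er); rewrite ex ey.
    rewrite mem_enum inE mem_iota /= add0n => /eqP ex.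
    rewrite ltnNge; apply/negP => /(part_nth_le part_nu).
    have := @cell_col_lt nu x; rewrite nu_n => /(_ (ltn_ord x)); rewrite ex.
    by move: le_nu; lia.
  rewrite leqNgt => /negP; apply; apply: proper_card; apply/properP; split.
    by apply/subsetP=> x; rewrite inE => /andP[].
  by exists c; rewrite !inE ?ltnn ?andbF ?eqxx.
have /fin_all_exists[q qP] c : exists d : 'I_n, cell_row nu d = rho c /\
    cell_col nu d = cell_col nu c.
  have [d + dP] := cell_exists (rho_lt c); rewrite nu_n => lt_d.
  by exists (Ordinal lt_d).
have q_inj : injective q.
  move=> c c' eq_q; have [[r1 c1] [r2 c2]] := (qP c, qP c').
  have ec : cell_col nu c = cell_col nu c' by rewrite -c1 -c2 eq_q.
  have er : rho c = rho c' by rewrite -r1 -r2 eq_q.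
  have rho_mono (x y : 'I_n) : cell_col nu x = cell_col nu y -> f x < f y -> rho x < rho y.
    move=> exy lt_xy; apply: proper_card; apply/properP; split.
      apply/subsetP=> z; rewrite !inE exy => /andP[-> /=] lt_z.
      exact: ltn_trans lt_z lt_xy.
    by exists x; rewrite !inE ?ltnn ?andbF // exy eqxx.
  apply: inj_f => //; case: (ltngtP (f c) (f c')) => // lt_f.
    by have := rho_mono _ _ ec lt_f; rewrite er ltnn.
  by have := rho_mono _ _ (esym ec) lt_f; rewrite er ltnn.
exists (perm q_inj) => [|c]; last by rewrite permE (qP c).1.
by rewrite inE; apply/forallP => c; rewrite permE (qP c).2.
Qed.

Section RowSum.
Variables (nu : seq nat) (n : nat) (f : 'I_n -> nat) (q : 'S_n).
Hypothesis le_qf : forall c : 'I_n, cell_row nu (q c) <= f c.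

Lemma sum_row_le : \sum_(c < n) cell_row nu c <= \sum_(c < n) f c.
Proof.
by rewrite (reindex_inj (@perm_inj _ q)) /=; apply: leq_sum => c _.
Qed.

Lemma sum_row_eq : \sum_(c < n) f c <= \sum_(c < n) cell_row nu c ->
  forall c : 'I_n, f c = cell_row nu (q c).
Proof.
rewrite [leqRHS](reindex_inj (@perm_inj _ q)) /= => le_f c.
have [_ eq_sum] := leqif_sum (fun c (_ : true) => leqif_eq (le_qf c)).
have: \sum_i cell_row nu (q i) == \sum_i f i.
  rewrite eqn_leq le_f andbT; exact: leq_sum.
by rewrite eq_sum => /forallP/(_ c) /= /eqP.
Qed.

Lemma row0_le : sumn nu = n -> #|[pred c | f c == 0]| <= nth 0 nu 0.
Proof.
move=> nu_n; rewrite -(card_row 0 nu_n).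
rewrite -(card_image (@perm_inj _ q)) subset_leq_card //.
apply/subsetP => _ /imageP[c + ->]; rewrite !inE => /eqP fc.
by rewrite -leqn0 -fc.
Qed.
End RowSum.

(** * Kostka numbers and their symmetry *)

(** Entries are plain naturals, so that the Bender-Knuth map can alter them with no bound to
    maintain; the bound comes back in [kostka_fun]. *)
Definition tableau nu (T : 'I_(sumn nu) -> nat) : bool :=
  [forall c : 'I_(sumn nu), forall c' : 'I_(sumn nu),
    ((cell_row nu c == cell_row nu c') && (cell_col nu c < cell_col nu c')
       ==> (T c <= T c')) &&
    ((cell_col nu c == cell_col nu c') && (cell_row nu c < cell_row nu c')
       ==> (T c < T c'))].

Lemma tableauP nu (T : 'I_(sumn nu) -> nat) :
  reflect ((forall c c' : 'I_(sumn nu), cell_row nu c = cell_row nu c' ->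
              cell_col nu c < cell_col nu c' -> T c <= T c') /\
           (forall c c' : 'I_(sumn nu), cell_col nu c = cell_col nu c' ->
              cell_row nu c < cell_row nu c' -> T c < T c'))
          (tableau T).
Proof.
apply: (iffP forallP) => [T_ss | [row_le col_lt] c].
  by split=> c c' e lt; have /forallP/(_ c')/andP[/implyP h /implyP h'] := T_ss c;
     [apply: h | apply: h']; rewrite e eqxx.
apply/forallP => c'; apply/andP; split; apply/implyP => /andP[/eqP e].
  exact: row_le.
exact: col_lt.
Qed.

Definition has_content n m (T : 'I_n -> nat) (alpha : nat -> nat) : bool :=
  [forall i : 'I_m, #|[pred c | T c == i]| == alpha i].

(** The content is a function, so that exchanging two of its values is a composition with
    [swap_at]. *)
Definition kostka_fun nu m (alpha : nat -> nat) : nat :=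
  #|[pred T : {ffun 'I_(sumn nu) -> 'I_m} |
      tableau (fun c => val (T c)) && has_content m (fun c => val (T c)) alpha]|.

Definition kostka nu (alpha : seq nat) : nat :=
  kostka_fun nu (size alpha) (nth 0 alpha).

Section BenderKnuth.
Variables (nu : seq nat) (i : nat).
Hypothesis part_nu : is_part nu.
Local Notation row := (cell_row nu).
Local Notation col := (cell_col nu).
Implicit Types T : 'I_(sumn nu) -> nat.

Definition row_below T x r : nat :=
  #|[pred c : 'I_(sumn nu) | (row c == r) && (T c < x)]|.

(* Let nu0, nu1, nu2 be the subdiagrams filled with entries < i, <= i, <= i.+1.
   Row r of nu1 may take any length between [bk_lo] and [bk_hi], independently
   of the other rows, and the involution reflects it in this interval.  As
   [bk_lo] and [bk_hi] add up to |nu0| + |nu2| over all rows, the numbers of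
   i and i.+1 are exchanged. *)
Definition bk_lo T r := maxn (row_below T i r) (row_below T i.+2 r.+1).
Definition bk_hi T r :=
  if r is r'.+1 then minn (row_below T i.+2 r) (row_below T i r')
  else row_below T i.+2 r.
Definition bk_cut T r := bk_lo T r + bk_hi T r - row_below T i.+1 r.

Definition bender_knuth T (c : 'I_(sumn nu)) : nat :=
  if i <= T c < i.+2 then if col c < bk_cut T (row c) then i else i.+1 else T c.

Lemma card_row_initial r x (P : pred 'I_(sumn nu)) : x <= nth 0 nu r ->
  (forall c : 'I_(sumn nu), row c = r -> P c = (col c < x)) ->
  #|[pred c : 'I_(sumn nu) | (row c == r) && P c]| = x.
Proof.
move=> le_x PE.
have cellP (j : 'I_x) : exists c : 'I_(sumn nu), row c = r /\ col c = j.
  have [|c lt_c cP] := @cell_exists nu r j; first exact: leq_trans le_x.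
  by exists (Ordinal lt_c).
have [f fP] := fin_all_exists cellP.
have f_inj : injective f.
  by move=> j j' e; apply: val_inj; rewrite /= -(fP j).2 -(fP j').2 e.
rewrite -[RHS]card_ord -(card_codom f_inj); apply: eq_card => c.
rewrite inE; apply/andP/codomP => [[/eqP er] | [j ->]]; last first.
  by have [er ec] := fP j; rewrite PE er // ec ltn_ord.
rewrite PE // => lt_c; exists (Ordinal lt_c).
by apply/val_inj/(@cell_inj nu); rewrite ?(fP _).1 ?(fP _).2.
Qed.

Section Tableau.
Variable T : 'I_(sumn nu) -> nat.
Hypothesis T_ss : tableau T.

(** Rows increase weakly, so the entries below [x] fill an initial segment of each row: a tableau is
    encoded by the row lengths [row_below] of an increasing chain of diagrams. *)
Lemma row_belowP x (c : 'I_(sumn nu)) :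
  (T c < x) = (col c < row_below T x (row c)).
Proof.
have [row_le _] := tableauP _ T_ss.
have row_leW (a b : 'I_(sumn nu)) : row a = row b -> col a <= col b -> T a <= T b.
  rewrite leq_eqVlt => er /orP[/eqP ec|]; last exact: row_le.
  by have /val_inj -> : val a = val b by apply: cell_inj er ec.
apply/idP/idP => [lt_x|].
  have := @card_row_initial (row c) (col c).+1 [pred d : 'I_(sumn nu) | col d <= col c].
  rewrite cell_col_lt // => /(_ isT) <- //; apply: subset_leq_card.
  apply/subsetP => d; rewrite !inE => /andP[/eqP er le_c]; rewrite er eqxx /=.
  exact: leq_ltn_trans (row_leW _ _ er le_c) lt_x.
apply: contraTT; rewrite -!leqNgt => le_x.
have := @card_row_initial (row c) (col c) [pred d : 'I_(sumn nu) | col d < col c].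
rewrite ltnW ?cell_col_lt // => /(_ isT) <- //; apply: subset_leq_card.
apply/subsetP => d; rewrite !inE => /andP[/eqP er lt_d]; rewrite er eqxx /=.
rewrite ltnNge; apply: contraL lt_d => le_c; rewrite -leqNgt.
by apply: leq_trans le_x _; apply: row_leW.
Qed.

Lemma row_below_mono x y r : x <= y -> row_below T x r <= row_below T y r.
Proof.
move=> le_xy; apply: subset_leq_card; apply/subsetP => c; rewrite !inE.
by case/andP=> -> /= lt_x; apply: leq_trans lt_x le_xy.
Qed.

Lemma row_below_size x r : row_below T x r <= nth 0 nu r.
Proof.
rewrite -(@card_row nu (sumn nu) r) //; apply: subset_leq_card.
by apply/subsetP => c; rewrite !inE => /andP[].
Qed.

(** Consecutive diagrams of the chain differ by a horizontal strip. Otherwise, in column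
    [row_below T x r], row [r] would hold an entry at least [x] and row [r.+1] below it an entry at
    most [x], against the strict increase of columns. *)
Lemma row_below_interlace x r : row_below T x.+1 r.+1 <= row_below T x r.
Proof.
rewrite leqNgt; apply/negP => lt_x.
have lt_nu := leq_trans lt_x (row_below_size _ _).
have [d lt_d [rd cd]] := cell_exists lt_nu.
have [|c lt_c [rc cc]] := @cell_exists nu r (row_below T x r).
  exact: leq_trans lt_nu (part_nth_le part_nu (leqnSn r)).
have [_ /(_ (Ordinal lt_c) (Ordinal lt_d))] := tableauP _ T_ss.
rewrite /= cc cd rc rd ltnSn => /(_ erefl isT).
have := row_belowP x.+1 (Ordinal lt_d); rewrite /= rd cd lt_x.
have := row_belowP x (Ordinal lt_c); rewrite /= rc cc ltnn.
by move=> /negbT; rewrite -leqNgt => h1 h2 h3; have := leq_ltn_trans h1 h3; lia.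
Qed.

Lemma bk_bounds r :
  [/\ bk_lo T r <= bk_cut T r, bk_cut T r <= bk_hi T r
    & bk_lo T r + bk_hi T r = bk_cut T r + row_below T i.+1 r].
Proof.
suff [lo hi] : bk_lo T r <= row_below T i.+1 r /\ row_below T i.+1 r <= bk_hi T r.
  by rewrite /bk_cut; split; lia.
split.
  by rewrite geq_max row_below_mono //= row_below_interlace.
case: r => [|r] /=; first exact: row_below_mono.
by rewrite leq_min row_below_mono //= row_below_interlace.
Qed.

Lemma bk_cut_range r :
  row_below T i r <= bk_cut T r <= row_below T i.+2 r /\
  row_below T i.+2 r.+1 <= bk_cut T r /\ bk_cut T r.+1 <= row_below T i r.
Proof.
have [lo hi _] := bk_bounds r; have [_ hi' _] := bk_bounds r.+1.
move: lo hi hi'; rewrite /bk_lo geq_max /= leq_min => /andP[-> ->] hi /andP[_ ->].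
by split=> //; case: r hi => [|r]; rewrite ?leq_min => // /andP[].
Qed.

Local Notation T' := (bender_knuth T).

Lemma bk_ltn x c : x != i.+1 -> (T' c < x) = (T c < x).
Proof.
rewrite /bender_knuth => ne_x; case: ifP => // lt_i.
by case: ifP => _; apply/idP/idP; lia.
Qed.

Lemma bk_ltnS c : (T' c < i.+1) = (col c < bk_cut T (row c)).
Proof.
have [/andP[lo hi] _] := bk_cut_range (row c).
have := row_belowP i c; have := row_belowP i.+2 c; rewrite /bender_knuth.
case: ifP => [_ _ _|ne Ehi Elo]; first by case: ifP => _; lia.
have [lt_i|le_i] := ltnP (T c) i.
  by rewrite lt_i in Elo; apply/idP/idP; lia.
have [lt_i|{}le_i] := ltnP (T c) i.+2; first by move: ne; rewrite le_i lt_i.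
by apply/idP/idP; lia.
Qed.

Lemma tableau_bk : tableau T'.
Proof.
have [row_le col_lt] := tableauP _ T_ss.
apply/tableauP; split=> c c' e lt.
  rewrite -ltnS; have := row_le _ _ e lt; set x := (T' c').+1 => le_T.
  have : T' c' < x by [].
  (* Only the threshold [i.+1] is affected by the map, and the entries below it still form an
     initial segment of each row. *)
  have [->|ne] := eqVneq x i.+1; first by rewrite !bk_ltnS e; apply: ltn_trans lt.
  by rewrite !bk_ltn //; apply: leq_ltn_trans.
have lt_T := col_lt _ _ e lt; rewrite {1 2}/bender_knuth.
case: (boolP (i <= T c < i.+2)) => [/andP[c1 c2]|nc];
  case: (boolP (i <= T c' < i.+2)) => [/andP[c1' c2']|nc'].
(* Two alterable entries of one column are an [i] right above an [i.+1]. The cut of the upper row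
   lies beyond this column, being at least the number of entries below [i.+2] in the next row; the
   cut of the lower row lies at or before it, being at most the number of entries below [i] in the
   row above. Hence neither entry changes. *)
- have [Tc Tc'] : T c = i /\ T c' = i.+1 by lia.
  have er : row c' = (row c).+1.
    have [|d lt_d [rd cd]] := @cell_exists nu (row c).+1 (col c).
      rewrite e; apply: leq_trans (cell_col_lt (ltn_ord c')) _.
      exact: part_nth_le.
    have lt_cd : row c < row (Ordinal lt_d) by rewrite /= rd.
    have := col_lt _ (Ordinal lt_d) (esym cd) lt_cd.
    move: lt; rewrite leq_eqVlt => /predU1P[-> //|lt].
    have := col_lt (Ordinal lt_d) c'; rewrite /= cd rd => /(_ e lt); lia.
  have [_ [lo hi]] := bk_cut_range (row c).
  have := row_belowP i.+2 c'; have := row_belowP i c.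
  rewrite Tc Tc' er ltnn ltnSn => /esym/negbT; rewrite -leqNgt => h1 /esym h2.
  rewrite ifT; last by rewrite e; apply: leq_trans h2 lo.
  by rewrite ifF // -e; apply/negbTE; rewrite -leqNgt; apply: leq_trans hi h1.
- by case: ifP; lia.
- by case: ifP; lia.
- by [].
Qed.

Lemma row_below_bk x r : x != i.+1 -> row_below T' x r = row_below T x r.
Proof. by move=> ne; apply: eq_card => c; rewrite !inE bk_ltn. Qed.

Lemma row_below_bkS r : row_below T' i.+1 r = bk_cut T r.
Proof.
apply: card_row_initial => [|c <-]; last exact: bk_ltnS.
have [/andP[_ hi] _] := bk_cut_range r.
exact: leq_trans hi (row_below_size _ _).
Qed.

(** The interval in which each row is reflected has ends that depend only on the thresholds [i] and
    [i.+2], which the map leaves alone; reflecting twice restores the cut. *)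
Lemma bkK : bender_knuth T' =1 T.
Proof.
move=> c; have cutE : bk_cut T' (row c) = row_below T i.+1 (row c).
  have [lo hi E] := bk_bounds (row c).
  suff [loE hiE] : bk_lo T' (row c) = bk_lo T (row c) /\
      bk_hi T' (row c) = bk_hi T (row c).
    by rewrite {1}/bk_cut loE hiE row_below_bkS E; lia.
  have [n1 n2] : i != i.+1 /\ i.+2 != i.+1 by lia.
  by rewrite /bk_lo /bk_hi !row_below_bk //; case: (row c) => // r; rewrite !row_below_bk.
rewrite {1}/bender_knuth cutE -row_belowP.
have -> : (i <= T' c < i.+2) = (i <= T c < i.+2).
  by rewrite [i <= T' c]leqNgt [i <= T c]leqNgt !bk_ltn //; lia.
case: ifP => [/andP[h1 h2]|ne]; first by case: ifP; lia.
by rewrite /bender_knuth ne.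
Qed.

Lemma sum_row_below U x :
  #|[pred c : 'I_(sumn nu) | U c < x]| = \sum_(r < size nu) row_below U x r.
Proof.
pose p (c : 'I_(sumn nu)) := Ordinal (cell_row_lt (ltn_ord c)).
rewrite -sum1_card (partition_big p xpredT) //=.
apply: eq_bigr => r _; rewrite /row_below -sum1_card; apply: eq_bigl => c.
by rewrite !inE andbC.
Qed.

Lemma card_below_bk :
  #|[pred c | T' c < i.+1]| + #|[pred c | T c < i.+1]| =
  #|[pred c | T c < i]| + #|[pred c | T c < i.+2]|.
Proof.
rewrite !sum_row_below -!big_split /=.
under eq_bigr => r _ do rewrite row_below_bkS.
under eq_bigr => r _.
  have [_ _ <-] := bk_bounds r; over.
have B0 : row_below T i.+2 (size nu) = 0.
  by apply/eqP; rewrite -leqn0 -[leqRHS](nth_default 0 (leqnn (size nu))) row_below_size.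
case E : (size nu) B0 => [|l] B0; first by rewrite !big_ord0.
pose A k := \sum_(r < k) row_below T i r.
pose B k := \sum_(r < k) row_below T i.+2 r.
have AS k : A k.+1 = A k + row_below T i k by apply: big_ord_recr.
have BS k : B k.+1 = B k + row_below T i.+2 k by apply: big_ord_recr.
(* [bk_lo] of row k is the maximum, and [bk_hi] of row k+1 the minimum, of the same two numbers.
   Maximum plus minimum is their sum, so only the [bk_lo] of the last row stays unpaired, and [B0]
   settles it at the bottom of the diagram. *)
have key k : \sum_(r < k.+1) (bk_lo T r + bk_hi T r) = A k + B k.+1 + bk_lo T k.
  elim: k => [|k IHk]; first by rewrite big_ord1 /A /B big_ord1 big_ord0 /=; lia.
  by rewrite big_ord_recr IHk /= AS (BS k.+1) /bk_lo; lia.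
by rewrite key big_split /= -/(A l.+1) -/(B l.+1) AS /bk_lo B0; lia.
Qed.

End Tableau.

Lemma card_eq_below n (U : 'I_n -> nat) x :
  #|[pred c | U c < x.+1]| = #|[pred c | U c < x]| + #|[pred c | U c == x]|.
Proof.
rewrite -cardUI [X in _ + X]eq_card0 => [|c]; last by rewrite !inE; lia.
by rewrite addn0; apply: eq_card => c; rewrite !inE; lia.
Qed.

Lemma bk_content T : tableau T ->
  [/\ #|[pred c | bender_knuth T c == i]| = #|[pred c | T c == i.+1]|,
      #|[pred c | bender_knuth T c == i.+1]| = #|[pred c | T c == i]|
    & forall x, x != i -> x != i.+1 ->
      #|[pred c | bender_knuth T c == x]| = #|[pred c | T c == x]|].
Proof.
move=> T_ss.
have below x : x != i.+1 ->
    #|[pred c | bender_knuth T c < x]| = #|[pred c | T c < x]|.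
  by move=> ne; apply: eq_card => c; rewrite !inE bk_ltn.
have := card_below_bk T_ss.
have := card_eq_below T i; have := card_eq_below T i.+1.
have := card_eq_below (bender_knuth T) i.
have := card_eq_below (bender_knuth T) i.+1.
have [n1 n2] : i != i.+1 /\ i.+2 != i.+1 by lia.
rewrite (below i) // (below i.+2) //; split; [lia | lia | move=> x nx nx'].
have := card_eq_below T x; have := card_eq_below (bender_knuth T) x.
by rewrite (below x) // (below x.+1) ?eqSS //; lia.
Qed.

Definition swap_at x := if x == i then i.+1 else if x == i.+1 then i else x.

Lemma swap_atK : involutive swap_at.
Proof. by move=> x; rewrite /swap_at; do !case: ifP; lia. Qed.

(** The Bender-Knuth map is an injection between the two sets of tableaux. The reverse inequality is
    this one for the swapped content, as [swap_at] is an involution. *)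
Lemma kostka_fun_swap_le m alpha : i.+1 < m ->
  kostka_fun nu m alpha <= kostka_fun nu m (alpha \o swap_at).
Proof.
case: m => // m lt_i.
pose Phi (T : {ffun 'I_(sumn nu) -> 'I_m.+1}) : {ffun 'I_(sumn nu) -> 'I_m.+1} :=
  [ffun c => inord (bender_knuth (fun c => val (T c)) c)].
have PhiE (T : {ffun 'I_(sumn nu) -> 'I_m.+1}) :
    (fun c => val (Phi T c)) =1 bender_knuth (fun c => val (T c)).
  move=> c; rewrite ffunE /= inordK // /bender_knuth.
  have := ltn_ord (T c).
  by case: ifP => //; case: ifP => // _ _ _; apply: leq_trans lt_i => //; lia.
rewrite /kostka_fun.
set P := [pred T | _]; rewrite -(@card_in_image _ _ Phi P).
  apply: subset_leq_card; apply/subsetP => _ /imageP[T /andP[T_ss T_al] ->].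
  have [c1 c2 c3] := bk_content T_ss.
  rewrite inE; have /funext -> := PhiE T; rewrite tableau_bk //=.
  apply/forallP => x; apply/eqP; have lt_x := ltn_ord x.
  move/forallP: T_al => T_al; rewrite /= /swap_at.
  case: ifP => [/eqP ->|/negbT ne].
    by have /eqP := T_al (Ordinal lt_i); rewrite /= c1.
  case: ifP => [/eqP ->|/negbT ne']; last by rewrite c3 //; apply/eqP/T_al.
  by have /eqP := T_al (Ordinal (ltnW lt_i)); rewrite /= c2.
move=> T U /andP[T_ss _] /andP[U_ss _] eqTU; apply/ffunP => c; apply: val_inj.
have /funext eqTU' : bender_knuth (fun c => val (T c)) =1
    bender_knuth (fun c => val (U c)).
  by move=> d; rewrite -!PhiE eqTU.
by have := bkK T_ss c; rewrite eqTU' bkK.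
Qed.

Lemma kostka_fun_swap m alpha : i.+1 < m ->
  kostka_fun nu m (alpha \o swap_at) = kostka_fun nu m alpha.
Proof.
move=> lt_i; apply/eqP; rewrite eqn_leq kostka_fun_swap_le // andbT.
apply: leq_trans (kostka_fun_swap_le _ lt_i) _.
suff -> : (alpha \o swap_at) \o swap_at = alpha by [].
by apply/funext => x /=; rewrite swap_atK.
Qed.
End BenderKnuth.

Lemma adjacent_swaps_perm_eq (A : eqType) (B : Type) (f : seq A -> B) :
    (forall s1 x y s2, f (s1 ++ x :: y :: s2) = f (s1 ++ y :: x :: s2)) ->
  forall s t, perm_eq s t -> f s = f t.
Proof.
move=> swap.
have move_in s1 x s2 s3 : f (s1 ++ x :: s2 ++ s3) = f (s1 ++ s2 ++ x :: s3).
  elim: s2 s1 => //= y s2 IHs s1.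
  by rewrite swap -cat_rcons IHs cat_rcons.
suff gen s t s1 : perm_eq s t -> f (s1 ++ s) = f (s1 ++ t).
  by move=> s t; apply: (gen _ _ [::]).
elim: s t s1 => [|x s IHs] t s1; first by rewrite perm_sym => /perm_nilP ->.
move=> /[dup] /perm_mem/(_ x); rewrite mem_head => /esym x_t.
case/splitPr: x_t => t1 t2 eq_st; rewrite -move_in -!cat_rcons; apply: IHs.
rewrite -(perm_cons x); apply: perm_trans eq_st _.
by rewrite -cat1s perm_catCA.
Qed.

Lemma kostka_perm nu alpha beta : is_part nu ->
  perm_eq alpha beta -> kostka nu alpha = kostka nu beta.
Proof.
move=> part_nu; apply: adjacent_swaps_perm_eq => s1 x y s2.
rewrite /kostka !size_cat /= -(@kostka_fun_swap nu (size s1)) //; last first.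
  by rewrite !addnS !ltnS leq_addr.
congr (kostka_fun _ _ _); apply/funext => j; rewrite /= /swap_at.
case: ifP => [/eqP ->|/eqP n1].
  by rewrite !nth_cat ltnn subnn ltnNge leqnSn subSnn.
case: ifP => [/eqP ->|/eqP n2].
  by rewrite !nth_cat ltnn subnn ltnNge leqnSn subSnn.
rewrite !nth_cat; case: ltnP => // le_j.
have -> // : j - size s1 = (j - size s1).-2.+2.
have m1 : j <> size s1 :> nat := n1; have m2 : j <> (size s1).+1 :> nat := n2.
by set k := size s1 in le_j m1 m2 *; clearbody k; lia.
Qed.

(** * Triangularity and stability of Kostka numbers *)

Lemma part_eq_nth nu mu : is_part nu -> is_part mu ->
  (forall r, nth 0 nu r = nth 0 mu r) -> nu = mu.
Proof.
move=> part_nu part_mu eq_nth; apply: (eq_from_nth (x0 := 0)) => [|r _]; last exact: eq_nth.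
case: (ltngtP (size nu) (size mu)) => // lt_size.
  have := part_nth_gt0 part_mu lt_size.
  by rewrite -eq_nth nth_default // leqnn.
have := part_nth_gt0 part_nu lt_size.
by rewrite eq_nth nth_default // leqnn.
Qed.

Lemma perm_eq_fibers n n' (f : 'I_n -> nat) (g : 'I_n' -> nat) :
    (forall x, #|[pred c | f c == x]| = #|[pred c | g c == x]|) ->
  perm_eq [seq f c | c : 'I_n] [seq g c | c : 'I_n'].
Proof.
have countE m (h : 'I_m -> nat) x :
    count_mem x [seq h c | c : 'I_m] = #|[pred c | h c == x]|.
  rewrite -sum1_count big_map big_enum_cond -sum1_card; exact: eq_bigl.
by move=> eq_fg; apply/allP => x _; rewrite /= !countE eq_fg.
Qed.

Lemma sum_eq_fibers n n' (f : 'I_n -> nat) (g : 'I_n' -> nat) :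
    (forall x, #|[pred c | f c == x]| = #|[pred c | g c == x]|) ->
  \sum_(c < n) f c = \sum_(c < n') g c.
Proof.
move=> /perm_eq_fibers eq_fg.
have sumE m (h : 'I_m -> nat) : \sum_(c < m) h c = sumn [seq h c | c : 'I_m].
  by rewrite sumnE big_map big_enum.
by rewrite !sumE; apply: perm_sumn.
Qed.

Section Content.
Variables (nu alpha : seq nat) (T : 'I_(sumn nu) -> nat).
Hypotheses (lt_T : forall c, T c < size alpha)
           (T_al : has_content (size alpha) T (nth 0 alpha)).

Lemma content_fiber x : #|[pred c | T c == x]| = nth 0 alpha x.
Proof.
have [lt_x|le_x] := ltnP x (size alpha).
  by have /forallP/(_ (Ordinal lt_x))/eqP := T_al.
rewrite nth_default // eq_card0 // => c; rewrite inE.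
by apply/negbTE; rewrite neq_ltn (leq_trans (lt_T c)).
Qed.

Lemma content_sum : \sum_c T c = \sum_(c < sumn alpha) cell_row alpha c.
Proof. by apply: sum_eq_fibers => x; rewrite content_fiber card_row. Qed.

Lemma content_size : sumn nu = sumn alpha.
Proof.
transitivity (size [seq T c | c : 'I_(sumn nu)]); first by rewrite size_map size_enum_ord.
transitivity (size [seq cell_row alpha c | c : 'I_(sumn alpha)]); last first.
  by rewrite size_map size_enum_ord.
by apply/perm_size/perm_eq_fibers => x; rewrite content_fiber card_row.
Qed.
End Content.

Lemma tableau_ge_row nu (T : 'I_(sumn nu) -> nat) : is_part nu -> tableau T ->
  forall c : 'I_(sumn nu), cell_row nu c <= T c.
Proof.
move=> part_nu /tableauP[_ col_lt] c; move: {2}(cell_row nu c) (leqnn (cell_row nu c)) => k.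
elim: k c => [|k IHk] c; first by rewrite leqn0 => /eqP ->.
rewrite leq_eqVlt => /predU1P[er|]; last exact: IHk.
have [|d lt_d [rd cd]] := @cell_exists nu k (cell_col nu c).
  apply: leq_trans (cell_col_lt (ltn_ord c)) _.
  by rewrite er; apply: part_nth_le.
have := IHk (Ordinal lt_d); rewrite /= rd => /(_ (leqnn k)) le_k.
rewrite er; apply: leq_ltn_trans le_k _; apply: col_lt => //=.
by rewrite rd er.
Qed.

(** The statistic n(nu), the sum of i * nu_i with rows counted from 0. It decreases strictly as nu
    goes up in dominance order and ignores the length of the first row, so one height serves for the
    partitions lambda[n] at all n. *)
Definition row_sum nu := \sum_(c < sumn nu) cell_row nu c.

(** Columns being strict, each entry is at least its row index. The comparison of row sums therefore
    applies with the identity as permutation, and its equality case forces the entry of every cell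
    to be its row. *)
Lemma kostka_neq0 nu mu : is_part nu -> is_part mu -> kostka nu mu <> 0 ->
  [/\ sumn nu = sumn mu, nth 0 mu 0 <= nth 0 nu 0
    & row_sum nu < row_sum mu \/ nu = mu].
Proof.
move=> part_nu part_mu /eqP; rewrite -lt0n => /card_gt0P[T].
rewrite inE => /andP[T_ss T_mu].
have lt_T c : val (T c) < size mu by apply: ltn_ord.
pose f c := val (T c).
have le_T (c : 'I_(sumn nu)) : cell_row nu ((1 : 'S__)%g c) <= f c.
  by rewrite perm1; apply: tableau_ge_row T_ss c.
split; first exact: content_size T_mu.
  rewrite -(content_fiber lt_T T_mu 0); exact: row0_le le_T _.
rewrite /row_sum -(content_sum lt_T T_mu).
have := sum_row_le le_T; rewrite leq_eqVlt => /predU1P[eq_T|]; [right | by left].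
have fE := sum_row_eq le_T (eq_leq (esym eq_T)).
apply: part_eq_nth => // r; rewrite -(content_fiber lt_T T_mu) -(card_row r erefl).
by apply: eq_card => c; rewrite !inE -/(f c) fE perm1.
Qed.

(** With equal row sums no entry can exceed its row index, which leaves the filling of every row by
    its own index. *)
Lemma kostka_diag nu : is_part nu -> kostka nu nu = 1.
Proof.
move=> part_nu.
pose T0 : {ffun 'I_(sumn nu) -> 'I_(size nu)} :=
  [ffun c => Ordinal (cell_row_lt (ltn_ord c))].
have T0E : (fun c => val (T0 c)) = (fun c : 'I_(sumn nu) => cell_row nu c).
  by apply/funext => c; rewrite ffunE.
rewrite /kostka /kostka_fun -[RHS](card1 T0); apply: eq_card => T; rewrite !inE.
apply/andP/eqP => [[T_ss T_nu] | ->].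
  have le_T (c : 'I_(sumn nu)) : cell_row nu ((1 : 'S__)%g c) <= val (T c).
    by rewrite perm1; apply: tableau_ge_row T_ss c.
  have TE := sum_row_eq le_T (eq_leq (content_sum (fun c => ltn_ord (T c)) T_nu)).
  by apply/ffunP => c; apply: val_inj; rewrite /= TE perm1 ffunE.
rewrite T0E; split; last by apply/forallP => i; rewrite card_row.
apply/tableauP; split=> c c' e lt //=; by rewrite e.
Qed.

Lemma cell_row_consS a lam c : cell_row (a.+1 :: lam) c.+1 = cell_row (a :: lam) c.
Proof. by rewrite /cell_row /reshape_index /= ?subSS. Qed.

Lemma cell_row_cons0 a lam : cell_row (a.+1 :: lam) 0 = 0.
Proof. by rewrite /cell_row /reshape_index /=. Qed.

Lemma cell_col_cons0 a lam : cell_col (a.+1 :: lam) 0 = 0.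
Proof. by rewrite /cell_col /reshape_offset. Qed.

Lemma cell_col_consS a lam c :
  cell_col (a.+1 :: lam) c.+1 = cell_col (a :: lam) c + (cell_row (a :: lam) c == 0).
Proof.
have := cell_row_consS a lam c; rewrite /cell_col /cell_row /reshape_offset => ->.
case E : (reshape_index (a :: lam) c) => [|r] /=; first by rewrite !subn0 addn1.
by rewrite addn0 subSS.
Qed.

Lemma card_ordS n (P : pred 'I_n.+1) :
  #|P| = P ord0 + #|[pred c | P (lift ord0 c)]|.
Proof.
by rewrite -!sum1_card big_mkcond big_ord_recl [in RHS]big_mkcond /=.
Qed.

Section KostkaStable.
Variables (a b : nat) (lam mu : seq nat).
Hypotheses (part_lam : is_part (a :: lam)) (part_lamS : is_part (a.+1 :: lam))
  (le_b : head 0 lam <= b).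
Local Notation N := (a + sumn lam).
Local Notation l := (size mu).+1.

(* The cells being numbered along the rows, adding a cell to the first row
   amounts to adding a cell 0 and shifting the others.  The first [b] cells of
   the first row are filled with 0, hence the columns of the shape [lam] impose
   no condition on the first row beyond that. *)
Definition extend_tableau (T : {ffun 'I_N -> 'I_l}) : {ffun 'I_N.+1 -> 'I_l} :=
  [ffun c => oapp T ord0 (unlift ord0 c)].

Lemma extend_tableau0 T : extend_tableau T ord0 = ord0.
Proof. by rewrite ffunE unlift_none. Qed.

Lemma extend_tableauS T c : extend_tableau T (lift ord0 c) = T c.
Proof. by rewrite ffunE liftK. Qed.

Lemma has_content_extend (T : {ffun 'I_N -> 'I_l}) :
  has_content l (fun c => val (extend_tableau T c)) (nth 0 (b.+1 :: mu)) =
  has_content l (fun c => val (T c)) (nth 0 (b :: mu)).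
Proof.
apply: eq_forallb => i; rewrite card_ordS /= extend_tableau0 /=.
rewrite (_ : #|_| = #|[pred c | val (T c) == i]|); last first.
  by apply: eq_card => c; rewrite !inE extend_tableauS.
by case: i => -[|i] lt_i; rewrite ?add0n.
Qed.

Lemma col_lt_below (c' : 'I_(sumn (a :: lam))) :
  0 < cell_row (a :: lam) c' ->
  cell_col (a :: lam) c' < b.
Proof.
move=> r'0; apply: leq_trans le_b; apply: leq_trans (cell_col_lt (ltn_ord c')) _.
have -> : head 0 lam = nth 0 (a :: lam) 1 by rewrite -nth0.
exact: part_nth_le.
Qed.

(** A zero can only lie in row 0, since an entry is at least its row index, and the zeros are an
    initial segment of that row; their number is therefore the length of this segment. *)
Lemma tableau_zero a' (T : 'I_(sumn (a' :: lam)) -> nat) k (c : 'I_(sumn (a' :: lam))) :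
    is_part (a' :: lam) -> tableau T -> #|[pred c | T c == 0]| = k ->
  cell_row (a' :: lam) c = 0 -> cell_col (a' :: lam) c < k -> T c = 0.
Proof.
move=> part_al T_ss <- r0 lt_c; apply/eqP; rewrite -leqn0 -ltnS.
rewrite (row_belowP T_ss) r0; congr (_ < _): lt_c; apply: eq_card => d.
rewrite !inE ltnS leqn0 andbC; case: eqP => //= T0.
by have := tableau_ge_row part_al T_ss d; rewrite T0 leqn0 => ->.
Qed.

Lemma tableau_extend (T : {ffun 'I_N -> 'I_l}) :
    has_content l (fun c => val (T c)) (nth 0 (b :: mu)) ->
  @tableau (a.+1 :: lam) (fun c => val (extend_tableau T c)) =
  @tableau (a :: lam) (fun c => val (T c)).
Proof.
move=> T_mu; have T0 : #|[pred c | val (T c) == 0]| = b.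
  by have /forallP/(_ ord0)/eqP := T_mu.
pose T' := extend_tableau T.
have T'0 : #|[pred c | val (T' c) == 0]| = b.+1.
  have := T_mu; rewrite -has_content_extend => /forallP/(_ ord0)/eqP //.
have rS (c : 'I_N) : cell_row (a.+1 :: lam) (lift ord0 c) = cell_row (a :: lam) c.
  by rewrite lift0 cell_row_consS.
have cS (c : 'I_N) : cell_col (a.+1 :: lam) (lift ord0 c) =
    cell_col (a :: lam) c + (cell_row (a :: lam) c == 0).
  by rewrite lift0 cell_col_consS.
apply/idP/idP => [T'_ss | T_ss].
  have [row_le col_lt] := tableauP _ T'_ss.
  apply/tableauP; split=> c c' e lt.
    have := row_le (lift ord0 c) (lift ord0 c').
    by rewrite !extend_tableauS !rS !cS e ltn_add2r; apply.
  (* The extension shifts the first row by one column against the others, so a column condition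
     carries over directly only between lower rows. If [c] is in the first row, its column meets
     [lam] and is thus among the first [b]: the entry there is 0, less than the entry of [c'], which
     is at least its positive row index. *)
  have [r0|r0] := eqVneq (cell_row (a :: lam) c) 0; last first.
    have := col_lt (lift ord0 c) (lift ord0 c').
    rewrite !extend_tableauS !rS !cS e (negbTE r0).
    have -> : (cell_row (a :: lam) c' == 0) = false by move: lt; case: eqP => // ->.
    exact.
  have T'c : val (T' (lift ord0 c)) = 0.
    apply: (tableau_zero part_lamS T'_ss T'0); rewrite ?rS // cS r0 eqxx addn1 ltnS.
    by rewrite e; apply: col_lt_below; rewrite -r0.
  move: T'c; rewrite /T' extend_tableauS => ->.
  have := tableau_ge_row part_lamS T'_ss (lift ord0 c'); rewrite rS extend_tableauS.
  exact: leq_trans (leq_ltn_trans (leq0n _) lt).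
have [row_le col_lt] := tableauP _ T_ss.
have ge_row := tableau_ge_row part_lam T_ss.
apply/tableauP; split=> c c' e lt.
  case: (unliftP ord0 c) e lt => [d|] ->; last by rewrite extend_tableau0.
  case: (unliftP ord0 c') => [d'|] ->; last by rewrite cell_col_cons0.
  by rewrite !rS !cS !extend_tableauS => e; rewrite e ltn_add2r; apply: row_le.
case: (unliftP ord0 c') e lt => [d'|] ->; last by rewrite cell_row_cons0.
rewrite rS cS; case: (unliftP ord0 c) => [d|] ->; last first.
  rewrite cell_row_cons0 extend_tableau0 extend_tableauS => _ lt.
  exact: leq_trans lt (ge_row d').
rewrite rS cS !extend_tableauS => e lt.
have nr' : (cell_row (a :: lam) d' == 0) = false by move: lt; case: eqP => // ->.
rewrite nr' addn0 in e.
have [r0|r0] := eqVneq (cell_row (a :: lam) d) 0; last first.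
  by apply: col_lt lt; rewrite -e (negbTE r0) addn0.
rewrite (@tableau_zero a (fun c => val (T c)) b d) //.
  by apply: leq_trans (ge_row d'); rewrite lt0n nr'.
rewrite r0 addn1 in e; have := @col_lt_below d'.
by rewrite -e lt0n nr' => /(_ isT); apply: ltn_trans.
Qed.

Lemma kostka_consS : kostka (a.+1 :: lam) (b.+1 :: mu) = kostka (a :: lam) (b :: mu).
Proof.
have ext_inj : injective extend_tableau.
  move=> T U eqTU; apply/ffunP => c.
  by rewrite -[LHS]extend_tableauS eqTU extend_tableauS.
rewrite /kostka /kostka_fun -[RHS](card_image ext_inj); apply/esym/eq_card => T'.
rewrite !inE; apply/imageP/andP => [[T /andP[T_ss T_mu] ->]|[T'_ss T'_mu]].
  by rewrite has_content_extend tableau_extend // T_ss T_mu.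
(* Surjectivity of the extension: the content prescribes [b.+1] zeros, so there is one; it lies in
   the first row, and the corner entry is at most as large. *)
have T'0 : T' ord0 = ord0.
  have /forallP/(_ ord0)/eqP T'0 := T'_mu.
  have /card_gt0P[c] : 0 < #|[pred c | val (T' c) == 0]| by rewrite T'0.
  rewrite inE => /eqP Tc0; apply/val_inj/eqP => /=.
  have := tableau_ge_row part_lamS T'_ss c; rewrite Tc0 leqn0 => /eqP rc.
  have [-> //|ne] := eqVneq (ord0 : 'I_N.+1) c; first exact/eqP.
  rewrite -leqn0 -[X in _ <= X]Tc0; have [row_le _] := tableauP _ T'_ss.
  apply: row_le; rewrite ?cell_row_cons0 ?rc //= cell_col_cons0 lt0n.
  apply: contra_neqN ne => /eqP c0; apply: val_inj => /=.
  by apply: (@cell_inj (a.+1 :: lam)); rewrite ?cell_row_cons0 ?rc ?cell_col_cons0.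
pose T : {ffun 'I_N -> 'I_l} := [ffun c => T' (lift ord0 c)].
have T'E : T' = extend_tableau T.
  apply/ffunP => c; case: (unliftP ord0 c) => [d|] ->.
    by rewrite extend_tableauS ffunE.
  by rewrite extend_tableau0.
move: T'_ss T'_mu; rewrite T'E has_content_extend => T_ss T_mu.
by exists T => //; rewrite inE T_mu andbT -tableau_extend.
Qed.
End KostkaStable.

(** * Padded partitions *)

Lemma leastP (P : nat -> Prop) :
  if least P is Some n then P n /\ (forall m, P m -> n <= m) else ~ exists n, P n.
Proof.
rewrite /least; case: pselect => [exP|nexP].
  case: ex_minnP => n /asboolP Pn min_n; split=> // m Pm.
  by apply: min_n; apply/asboolP.
by move=> [n Pn]; apply: nexP; exists n; apply/asboolP.
Qed.

Lemma least_neqNone (P : nat -> Prop) : least P <> None <-> exists n, P n.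
Proof.
have := leastP P; case: (least P) => [n [Pn _]|nP]; first by split=> // _; exists n.
by split=> // /nP.
Qed.

Lemma big_xmaxP (I : eqType) (s : seq I) (f : I -> xnat) :
    (forall i, i \in s -> f i <> None) ->
  exists N, \big[xmax/Some 0]_(i <- s) f i = Some N /\
    forall i a, i \in s -> f i = Some a -> a <= N.
Proof.
elim: s => [|j s IHs] f_fin; first by exists 0; rewrite big_nil.
have [|N [bigN le_N]] := IHs; first by move=> i si; apply: f_fin; rewrite inE si orbT.
case fj : (f j) (f_fin j (mem_head _ _)) => [m|] // _.
exists (maxn m N); rewrite big_cons fj bigN; split=> // i a.
rewrite inE => /predU1P[->|si] fi; last first.
  by rewrite leq_max (le_N i) ?orbT.
by move: fi; rewrite fj => -[<-]; rewrite leq_maxl.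
Qed.

Lemma xmax_partsP k c (f : seq nat -> xnat) :
    (forall mu, is_part mu -> sumn mu <= k -> f mu <> None) ->
  exists N, [/\ xmax (Some c) (xmax_parts k f) = Some N, c <= N
    & forall mu a, is_part mu -> sumn mu <= k -> f mu = Some a -> a <= N].
Proof.
move=> f_fin.
have fin_i i : i < k.+1 -> forall mu, mu \in partitions i -> f mu <> None.
  move=> lt_i mu; rewrite mem_partitions => /andP[part_mu /eqP mu_i].
  by apply: f_fin part_mu _; rewrite mu_i.
have [|N [bigN le_N]] := @big_xmaxP _ (index_enum 'I_k.+1)
    (fun i => \big[xmax/Some 0]_(mu <- partitions i) f mu).
  by move=> i _; have [N [-> _]] := big_xmaxP (fin_i i (ltn_ord i)).
exists (maxn c N); rewrite /xmax_parts bigN leq_maxl; split=> // mu a part_mu le_k fmu.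
have lt_mu : sumn mu < k.+1 by [].
have [N' [bigN' le_N']] := big_xmaxP (fin_i _ lt_mu).
have le1 : a <= N' by apply: le_N' fmu; rewrite mem_partitions part_mu /=.
have le2 : N' <= N by apply: (le_N (Ordinal lt_mu)) => //; rewrite mem_index_enum.
by rewrite leq_max (leq_trans le1 le2) orbT.
Qed.

Lemma pad_cons lam n : is_part lam -> sumn lam < n -> pad lam n = n - sumn lam :: lam.
Proof.
move=> /andP[_ lam0] lt_n; rewrite /pad /= subn_gt0 lt_n; congr (_ :: _).
apply/all_filterP/allP => i lam_i; rewrite lt0n.
by apply: contraNneq lam0 => <-.
Qed.

Lemma pad_consS lam n : is_part lam -> sumn lam < n ->
  pad lam n.+1 = (n - sumn lam).+1 :: lam.
Proof. by move=> part_lam lt_n; rewrite pad_cons ?subSn 1?ltnW. Qed.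

Lemma is_part_cons a lam : is_part lam -> 0 < a -> head 0 lam <= a -> is_part (a :: lam).
Proof.
rewrite /is_part inE negb_or => /andP[sorted_lam ->] a_gt0 le_a.
rewrite eq_sym -lt0n a_gt0 !andbT /=.
by case: lam sorted_lam le_a => //= b lam -> ->.
Qed.

Lemma is_part_behead a lam : is_part (a :: lam) -> is_part lam.
Proof.
rewrite /is_part inE negb_or => /andP[sorted_lam /andP[_ ->]]; rewrite andbT.
exact: path_sorted sorted_lam.
Qed.

Lemma part_sumn0 lam : is_part lam -> sumn lam = 0 -> lam = [::].
Proof.
case: lam => // a lam /andP[_ +] /= /eqP; rewrite inE addn_eq0 => + /andP[/eqP a0].
by rewrite a0.
Qed.

Lemma part_head_le lam : head 0 lam <= sumn lam.
Proof. by case: lam => //= a lam; apply: leq_addr. Qed.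

Lemma pad_partition lam n : is_part lam -> padded lam n -> pad lam n \in partitions n.
Proof.
rewrite /padded mem_partitions => part_lam le_n.
case: (ltngtP (sumn lam) n) => [lt_n|lt_n|eq_n]; last 1 first.
- have lam0 : lam = [::].
    case: lam le_n eq_n part_lam => //= a lam le_n eq_n /andP[_].
    by rewrite inE negb_or; lia.
  by move: eq_n; rewrite lam0 /= => <-.
- rewrite pad_cons // is_part_cons //=; lia.
- by have := leq_ltn_trans (leq_trans (leq_addr _ _) le_n) lt_n; rewrite ltnn.
Qed.

Definition parts_upto k : seq (seq nat) := flatten [seq partitions i | i <- iota 0 k.+1].

Lemma mem_parts_upto k lam : (lam \in parts_upto k) = is_part lam && (sumn lam <= k).
Proof.
apply/flatten_mapP/andP => [[i si +]|[part_lam le_k]].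
  by move: si; rewrite mem_iota mem_partitions add0n ltnS => /= le_i /andP[-> /eqP ->].
by exists (sumn lam); rewrite ?mem_iota ?mem_partitions ?part_lam /=.
Qed.

Lemma parts_upto_uniq k : uniq (parts_upto k).
Proof.
rewrite /parts_upto; elim: (iota 0 k.+1) (iota_uniq 0 k.+1) => //= i s IHs /andP[i_s us].
rewrite cat_uniq partitions_uniq IHs // andbT; apply/hasPn => lam.
case/flatten_mapP=> j sj; rewrite !mem_partitions => /andP[-> /eqP ->] /=.
by apply: contraNneq i_s => <-.
Qed.

Lemma padded_upto k n lam : 2 * k <= n -> lam \in parts_upto k -> padded lam n.
Proof.
rewrite mem_parts_upto /padded => le_n /andP[_ le_k].
by have := part_head_le lam; lia.
Qed.

Lemma pad_inj n lam mu : is_part lam -> is_part mu -> padded lam n -> padded mu n ->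
  pad lam n = pad mu n -> lam = mu.
Proof.
move=> part_lam part_mu; rewrite /padded => pl pm.
case: (posnP n) => [n0|n_gt0].
  have [lam0 mu0] : sumn lam = 0 /\ sumn mu = 0 by lia.
  by rewrite (part_sumn0 part_lam lam0) (part_sumn0 part_mu mu0).
have lt_n nu : is_part nu -> sumn nu + head 0 nu <= n -> sumn nu < n.
  move=> part_nu le_n; case: (posnP (sumn nu)) => [->//|].
  case: nu part_nu le_n => //= a nu /andP[_]; rewrite inE negb_or; lia.
by rewrite !pad_cons ?lt_n // => -[].
Qed.

(** A partition of n is determined by what is left after removing its first part, and a first part
    at least [n - k] leaves a partition of size at most [k]. Sums over partitions of n thereby get
    an index set that does not vary with n. *)
Lemma big_partitions_pad (Z : nmodType) k n (G : seq nat -> Z) : 2 * k <= n ->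
    (forall nu, nu \in partitions n -> G nu <> 0%R -> n - k <= nth 0 nu 0) ->
  (\sum_(nu <- partitions n) G nu = \sum_(lam <- parts_upto k) G (pad lam n))%R.
Proof.
move=> le_n G0; rewrite -(big_map (pad^~ n) xpredT G).
set s := map _ _.
rewrite (bigID (mem s)) /= [X in (_ + X)%R]big_seq_cond [X in (_ + X)%R]big1 ?addr0.
  rewrite -big_filter; apply: perm_big; apply: uniq_perm.
  - exact: filter_uniq (partitions_uniq n).
  - rewrite map_inj_in_uniq ?parts_upto_uniq // => lam mu lam_k mu_k.
    have [pl pm] := (padded_upto le_n lam_k, padded_upto le_n mu_k).
    move: lam_k mu_k; rewrite !mem_parts_upto => /andP[? _] /andP[? _].
    exact: pad_inj.
  - move=> nu; rewrite mem_filter; apply: andb_idr => /mapP[lam lam_k ->].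
    have pl := padded_upto le_n lam_k.
    by move: lam_k; rewrite mem_parts_upto => /andP[part_lam _]; apply: pad_partition.
move=> nu /andP[nu_n]; apply: contraNeq => /eqP /(G0 _ nu_n) le_nu.
move: nu_n; rewrite mem_partitions => /andP[part_nu /eqP nu_n].
case: nu part_nu nu_n le_nu => [_|a lam part_al] /= sum_al le_a.
  have k0 : k = 0 by lia.
  apply/mapP; exists [::]; first by rewrite mem_parts_upto.
  by rewrite -sum_al.
have part_lam := is_part_behead part_al.
have a_gt0 : 0 < a := @part_nth_gt0 (a :: lam) 0 part_al isT.
apply/mapP; exists lam; first by rewrite mem_parts_upto part_lam /=; lia.
by rewrite pad_cons //; [congr (_ :: _); lia | lia].
Qed.

Lemma row_sum_consS a lam : row_sum (a.+1 :: lam) = row_sum (a :: lam).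
Proof.
rewrite /row_sum /= big_ord_recl cell_row_cons0 add0n.
by apply: eq_bigr => c _; rewrite lift0 cell_row_consS.
Qed.

Lemma upto_lt k n lam : 2 * k <= n -> 0 < n -> lam \in parts_upto k -> sumn lam < n.
Proof. by rewrite mem_parts_upto => le_n n_gt0 /andP[_ le_k]; lia. Qed.

Lemma row_sum_padS k n lam : 2 * k <= n -> lam \in parts_upto k ->
  row_sum (pad lam n.+1) = row_sum (pad lam n).
Proof.
move=> le_n lam_k; have := lam_k; rewrite mem_parts_upto => /andP[part_lam le_k].
have [n0|n_gt0] := posnP n.
  have lam0 : sumn lam = 0 by lia.
  by rewrite (part_sumn0 part_lam lam0) n0 /pad /= /row_sum /= big_ord_recl !big_ord0.
have lt_n := upto_lt le_n n_gt0 lam_k.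
by rewrite pad_consS // pad_cons // row_sum_consS.
Qed.

Lemma kostka_padS k n lam mu : 2 * k <= n ->
    lam \in parts_upto k -> mu \in parts_upto k ->
  kostka (pad lam n.+1) (pad mu n.+1) = kostka (pad lam n) (pad mu n).
Proof.
move=> le_n lam_k mu_k.
have [pl pm] := (padded_upto le_n lam_k, padded_upto le_n mu_k).
move: (lam_k) (mu_k); rewrite !mem_parts_upto => /andP[part_lam le_lam] /andP[part_mu le_mu].
(* At n = 0 padding drops the empty first row, so there is no row to lengthen; both sides are then
   diagonal Kostka numbers. *)
have [n0|n_gt0] := posnP n.
  have [lam0 mu0] : sumn lam = 0 /\ sumn mu = 0 by lia.
  by rewrite (part_sumn0 part_lam lam0) (part_sumn0 part_mu mu0) n0 !kostka_diag.
have [lt_lam lt_mu] := (upto_lt le_n n_gt0 lam_k, upto_lt le_n n_gt0 mu_k).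
have hd := part_head_le lam.
rewrite (pad_consS part_lam lt_lam) (pad_consS part_mu lt_mu).
rewrite (pad_cons part_lam lt_lam) (pad_cons part_mu lt_mu).
(* Here [2 * k <= n] is used in the form [head 0 lam <= n - sumn mu]: the zeros of mu[n] cover all
   columns of [lam]. This is the origin of the constants [2 * sumn lam] and [2 * w]. *)
by apply: kostka_consS; [apply: is_part_cons | apply: is_part_cons |]; lia.
Qed.

(** * Matrices triangular for a numerical height *)

Section Triangular.
Variables (F : fieldType) (I : eqType) (s : seq I) (M : I -> nat).
Local Open Scope ring_scope.

(** Distinct indices of equal height have entry 0, so a numerical height does the work of a partial
    order on the indices. *)
Definition triangular (K : I -> I -> F) : Prop :=
  {in s &, forall i j, K i j <> 0 -> (M i < M j)%N \/ i = j}.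

Variable K : I -> I -> F.
Hypotheses (us : uniq s) (K_tri : triangular K) (K_diag : {in s, forall i, K i i != 0}).

Lemma triangular_sum (h : I -> F) j : j \in s ->
  \sum_(i <- s) h i * K i j =
    h j * K j j + \sum_(i <- s | (M i < M j)%N) h i * K i j.
Proof.
move=> sj; rewrite (bigD1_seq j) //=; congr (_ + _).
rewrite big_mkcond [RHS]big_mkcond big_seq [RHS]big_seq; apply: eq_bigr => i si.
have [->|ne] := eqVneq i j; first by rewrite ltnn.
case: ltnP => //= le_M; apply/eqP; rewrite mulf_eq0 orbC.
case: (eqVneq (K i j) 0) => //= /eqP /(K_tri si sj)[|/eqP]; last by rewrite (negbTE ne).
by rewrite ltnNge le_M.
Qed.

Lemma triangular_ker (h : I -> F) :
  {in s, forall j, \sum_(i <- s) h i * K i j = 0} -> {in s, forall i, h i = 0}.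
Proof.
move=> hK0 i; have [m le_m] := ubnP (M i); elim: m => // m IHm in i le_m *.
move=> si; have := hK0 i si; rewrite triangular_sum // big_seq_cond big1 ?addr0.
  by move/eqP; rewrite mulf_eq0 (negbTE (K_diag si)) orbF => /eqP.
move=> j /andP[sj lt_j]; rewrite IHm ?mul0r //.
exact: leq_trans lt_j _.
Qed.
End Triangular.

(** * Multiplicities and monomial coordinates *)

Section SchurKostka.
Variable R : realType.
Local Open Scope complex_scope.

Definition content (a : monom) : seq nat := [seq a i | i <- finsupp a].

(** The increasing enumeration [phi] of the support relabels tableaux with entries in the support by
    those with entries in an ordinal. Monotonicity forces the support to be sorted first, whereas
    [content] follows the order of [finsupp]; [kostka_perm] reconciles the two. *)
Lemma schur_kostka nu a : is_part nu ->
  schur R nu a = ((kostka nu (content a))%:R)%R.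
Proof.
move=> part_nu; pose s := sort leq (finsupp a : seq nat).
have s_mem i : (i \in s) = (i \in finsupp a) by rewrite mem_sort.
have us : uniq s by rewrite sort_uniq fset_uniq.
have -> : kostka nu (content a) = kostka nu [seq a i | i <- s].
  by apply: kostka_perm => //; rewrite perm_map // perm_sym; apply/permPl/perm_sort.
congr (_%:R)%R; rewrite /kostka; set m := size _.
have sz_m : m = size s by rewrite /m size_map.
have phi_proof (i : 'I_m) : nth 0 s i \in finsupp a.
  by rewrite -s_mem mem_nth // -sz_m.
pose phi i : finsupp a := FSetSub (phi_proof i).
have s_sorted : sorted ltn s.
  by rewrite ltn_sorted_uniq_leq us sort_sorted //; apply: leq_total.
have phi_lt (i j : 'I_m) : i < j -> val (phi i) < val (phi j).
  move=> lt_ij; apply: (sorted_ltn_nth ltn_trans 0 s_sorted) => //.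
    by rewrite inE -sz_m.
  by rewrite inE -sz_m.
have phi_mono (i j : 'I_m) : (val (phi i) < val (phi j)) = (i < j).
  apply/idP/idP; last exact: phi_lt.
  case: (ltngtP i j) => // [/phi_lt lt_ji /ltnW|/val_inj ->]; last by rewrite ltnn.
  by rewrite leqNgt lt_ji.
have phi_inj : injective phi.
  move=> i j eq_ij; have := phi_mono i j; have := phi_mono j i.
  rewrite eq_ij ltnn; case: (ltngtP i j) => // /val_inj //.
have phi_onto (x : finsupp a) : exists i, phi i = x.
  have lt_x : index (val x) s < m by rewrite sz_m index_mem s_mem; apply: valP.
  by exists (Ordinal lt_x); apply: val_inj; rewrite /= nth_index // s_mem; apply: valP.
have aE (i : 'I_m) : a (val (phi i)) = nth 0 [seq a i | i <- s] i.
  by rewrite (nth_map 0) // -sz_m.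
pose Phi (T : {ffun 'I_(sumn nu) -> 'I_m}) : {ffun 'I_(sumn nu) -> finsupp a} :=
  [ffun c => phi (T c)].
have Phi_inj : injective Phi.
  move=> T U /ffunP eqTU; apply/ffunP => c; apply: phi_inj.
  by have := eqTU c; rewrite !ffunE.
rewrite /kostka_fun -(card_image Phi_inj); apply: eq_card => U; rewrite !inE.
have [T ->] : exists T, U = Phi T.
  have [h hP] := fin_all_exists (fun c => phi_onto (U c)).
  by exists [ffun c => h c]; apply/ffunP => c; rewrite !ffunE hP.
rewrite (fintype.mem_image Phi_inj) inE; congr (_ && _).
  apply: eq_forallb => c; apply: eq_forallb => c'; rewrite !ffunE.
  have phi_le i j : (val (phi i) <= val (phi j)) = (i <= j) by rewrite leqNgt phi_mono -leqNgt.
  by rewrite phi_le phi_mono.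
have fiberE (i : 'I_m) :
    #|[set c | Phi T c == phi i]| = #|[pred c | val (T c) == i]|.
  by apply: eq_card => c; rewrite !inE ffunE (inj_eq phi_inj).
apply/forallP/forallP => [h i | h x].
  by have := h (phi i); rewrite fiberE aE.
by have [i <-] := phi_onto x; rewrite fiberE aE; apply: h.
Qed.

Lemma kostka_size nu alpha : kostka nu alpha <> 0 -> sumn nu = sumn alpha.
Proof.
move=> /eqP; rewrite -lt0n => /card_gt0P[T]; rewrite inE => /andP[_ T_al].
by apply: content_size T_al => c; apply: ltn_ord.
Qed.

Definition standard_monom (mu : seq nat) : monom :=
  [fsfun i in [fset j | j in iota 0 (size mu)]%fset => nth 0 mu i | 0].

Lemma content_standard mu : is_part mu -> perm_eq (content (standard_monom mu)) mu.
Proof.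
move=> part_mu.
have aE i : standard_monom mu i = nth 0 mu i.
  rewrite fsfunE; case: ifP => //; rewrite !inE /= mem_iota add0n /= => /negbT.
  by rewrite -leqNgt => le_i; rewrite nth_default.
have supp : perm_eq (finsupp (standard_monom mu)) (iota 0 (size mu)).
  apply: uniq_perm; rewrite ?fset_uniq ?iota_uniq // => i.
  rewrite mem_finsupp aE mem_iota add0n /=; apply/idP/idP.
    by apply: contraNT; rewrite -leqNgt => le_i; rewrite nth_default.
  by move/(part_nth_gt0 part_mu); rewrite lt0n.
rewrite /content (perm_trans (perm_map _ supp)) //.
rewrite (eq_map aE) map_nth_iota0 // take_size //.
Qed.

Variable V : forall n, representation R[i] [set: 'S_n]%G.
Let F n := frobenius (V n).

(** The coordinate on the monomial symmetric function of [mu], since a Schur function has Kostka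
    numbers as coordinates. It makes sense for compositions too and can thus be evaluated at the
    content of a monomial. *)
Definition frobenius_coord n mu : nat :=
  \sum_(nu <- partitions n) specht_mult (V n) nu * kostka nu mu.

Lemma frobenius_kostka n a :
  F n a = ((frobenius_coord n (content a))%:R)%R.
Proof.
rewrite /F /frobenius natr_sum big_seq [RHS]big_seq; apply: eq_bigr => nu.
by rewrite mem_partitions => /andP[part_nu _]; rewrite schur_kostka // natrM.
Qed.

Lemma frobenius_coord_perm n alpha beta : perm_eq alpha beta ->
  frobenius_coord n alpha = frobenius_coord n beta.
Proof.
move=> eq_ab; rewrite /frobenius_coord big_seq [RHS]big_seq; apply: eq_bigr => nu.
by rewrite mem_partitions => /andP[part_nu _]; rewrite (kostka_perm part_nu eq_ab).
Qed.

Lemma content_part (a : monom) n : sumn (content a) = n ->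
  exists2 mu, mu \in partitions n & perm_eq (content a) mu.
Proof.
move=> sum_a; exists (sort geq (content a)); last by rewrite perm_sym perm_sort.
rewrite mem_partitions /is_part sort_sorted /=; last by move=> x y; apply: leq_total.
have /perm_sumn -> : perm_eq (sort geq (content a)) (content a) by rewrite perm_sort perm_refl.
rewrite mem_sort sum_a eqxx andbT.
apply/mapP => -[j]; rewrite mem_finsupp => /eqP aj /esym; exact: aj.
Qed.

(** [monomial_coord] is a chosen witness. Any witness is determined at [mu] by evaluation at
    [standard_monom mu], where only the monomial symmetric function of [mu] survives; that the
    default value is not returned follows as [frobenius_coord] itself is a witness. *)
Lemma monomial_coord_frobenius n mu : mu \in partitions n ->
  monomial_coord n (F n) mu = ((frobenius_coord n mu)%:R)%R.
Proof.
rewrite /monomial_coord => mu_n.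
have symfE la (a : monom) : monomial_symf R la a = ((perm_eq (content a) la)%:R)%R by [].
have coordE (d : seq nat -> R[i]) (a : monom) nu : nu \in partitions n ->
    perm_eq (content a) nu ->
    (\sum_(la <- partitions n) d la * monomial_symf R la a = d nu)%R.
  move=> nu_n eq_a; rewrite (bigD1_seq nu) ?partitions_uniq //= symfE.
  rewrite eq_a mulr1 big_seq_cond big1 ?addr0 // => la /andP[la_n ne].
  rewrite symfE; case: (boolP (perm_eq _ la)) => [eq_la|_]; last by rewrite mulr0.
  case/eqP: ne; move: la_n nu_n; rewrite !mem_partitions.
  case/andP=> [/andP[s1 _] _] /andP[/andP[s2 _] _].
  apply: sorted_eq s1 s2 _ => [x y z h1 h2|x y h|]; first exact: leq_trans h2 h1.
    by apply/eqP; rewrite eqn_leq andbC.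
  by rewrite perm_sym in eq_la; apply: perm_trans eq_la eq_a.
case: classical_sets.xgetP => [d _ dP|noP].
  have part_mu : is_part mu by move: mu_n; rewrite mem_partitions => /andP[].
  have eq_mu := content_standard part_mu.
  rewrite -(coordE d _ _ mu_n eq_mu) -dP frobenius_kostka.
  by rewrite (frobenius_coord_perm _ eq_mu).
case: (noP (fun nu => ((frobenius_coord n nu)%:R)%R)) => a /=.
rewrite frobenius_kostka; have [sum_a|ne] := eqVneq (sumn (content a)) n.
  have [nu nu_n eq_a] := content_part sum_a.
  by rewrite (coordE _ _ _ nu_n eq_a) (frobenius_coord_perm _ eq_a).
rewrite [RHS]big_seq big1 => [|la]; last first.
  rewrite mem_partitions symfE => /andP[_ /eqP la_n].
  case: (boolP (perm_eq _ la)) => [eq_la|_]; last by rewrite mulr0.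
  by case/eqP: ne; rewrite (perm_sumn eq_la).
rewrite /frobenius_coord big_seq big1 // => nu; rewrite mem_partitions => /andP[_ /eqP nu_n].
have [->|/eqP /kostka_size e] := eqVneq (kostka nu (content a)) 0; first by rewrite muln0.
by rewrite -e nu_n eqxx in ne.
Qed.

(** A shape with nonzero Kostka number has first part at least that of mu[n], hence at least
    [n - k]; only the shapes lambda[n] with [|lambda| <= k] contribute. *)
Lemma mcoef_upto k n mu : 2 * k <= n -> mu \in parts_upto k ->
  mcoef F mu n = (\sum_(lam <- parts_upto k)
     (mult V lam n)%:R * (kostka (pad lam n) (pad mu n))%:R)%R.
Proof.
move=> le_n mu_k; have pm := padded_upto le_n mu_k.
have := mu_k; rewrite mem_parts_upto => /andP[part_mu le_mu].
have pad_n := pad_partition part_mu pm.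
rewrite /mcoef pm monomial_coord_frobenius // /frobenius_coord natr_sum.
rewrite (big_partitions_pad le_n) => [|nu nu_n /eqP].
  rewrite big_seq [RHS]big_seq; apply: eq_bigr => lam lam_k.
  by rewrite natrM /mult (padded_upto le_n lam_k).
rewrite pnatr_eq0 muln_eq0 negb_or => /andP[_ /eqP] K0.
move: nu_n pad_n; rewrite !mem_partitions => /andP[part_nu /eqP nu_n] /andP[part_p _].
have [_ le_nu _] := kostka_neq0 part_nu part_p K0; apply: leq_trans le_nu.
have [n0|n_gt0] := posnP n; first by lia.
by rewrite pad_cons ?(upto_lt le_n n_gt0 mu_k) //=; lia.
Qed.

Lemma kostka_triangular k n : 2 * k <= n ->
  triangular (parts_upto k) (fun lam => row_sum (pad lam n))
    (fun lam mu => (kostka (pad lam n) (pad mu n))%:R%R : R[i]).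
Proof.
move=> le_n lam mu lam_k mu_k /eqP; rewrite pnatr_eq0 => /eqP K0.
have [pl pm] := (padded_upto le_n lam_k, padded_upto le_n mu_k).
move: lam_k mu_k; rewrite !mem_parts_upto => /andP[part_lam _] /andP[part_mu _].
have := pad_partition part_lam pl; have := pad_partition part_mu pm.
rewrite !mem_partitions => /andP[pp _] /andP[pp' _].
have [_ _ []] := kostka_neq0 pp' pp K0; first by left.
by move/pad_inj => eq_lm; right; apply: eq_lm.
Qed.

Lemma mcoef_stable_iff k n : 2 * k <= n ->
  {in parts_upto k, forall mu, mcoef F mu n = mcoef F mu n.+1} <->
  {in parts_upto k, forall lam, mult V lam n = mult V lam n.+1}.
Proof.
move=> le_n; have le_n' := leq_trans le_n (leqnSn n); split=> [eq_m | eq_c]; last first.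
  move=> mu mu_k; rewrite (mcoef_upto le_n mu_k) (mcoef_upto le_n' mu_k).
  rewrite big_seq [RHS]big_seq; apply: eq_bigr => lam lam_k.
  by rewrite eq_c // (kostka_padS le_n).
move=> lam lam_k; apply/eqP; rewrite -(eqr_nat R[i]) -subr_eq0; apply/eqP.
pose K lam mu := ((kostka (pad lam n) (pad mu n))%:R : R[i])%R.
pose h lam := ((mult V lam n)%:R - (mult V lam n.+1)%:R : R[i])%R.
apply: (@triangular_ker _ _ _ _ K (parts_upto_uniq k) (kostka_triangular le_n) _ h) => //.
  move=> mu mu_k; have pm := padded_upto le_n mu_k.
  move: mu_k; rewrite mem_parts_upto => /andP[part_mu _].
  have := pad_partition part_mu pm; rewrite mem_partitions => /andP[pp _].
  by rewrite /K kostka_diag // oner_neq0.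
move=> mu mu_k; have := eq_m mu mu_k.
rewrite (mcoef_upto le_n mu_k) (mcoef_upto le_n' mu_k) => /eqP.
rewrite -subr_eq0 -sumrB => /eqP sub0; rewrite -[RHS]sub0 big_seq [RHS]big_seq.
by apply: eq_bigr => la la_k; rewrite /h mulrBl (kostka_padS le_n).
Qed.

Lemma mult_weight w lam n : weight V = Some w -> is_part lam ->
  mult V lam n <> 0 -> sumn lam <= w.
Proof.
rewrite /weight => w_eq part_lam m0; have := leastP (fun w => forall lam n,
  is_part lam -> sumn lam + head 0 lam <= n -> mult V lam n <> 0 -> sumn lam <= w).
rewrite w_eq => -[+ _]; move/(_ lam n part_lam); apply=> //.
by move: m0; rewrite /mult /padded; case: ifP.
Qed.

(** The stable range [N] bounds the weight: a multiplicity that is nonzero at some [n >= N] is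
    nonzero at [N] already, where lambda[N] must be defined. *)
Lemma urms_weight : urms V -> weight V <> None.
Proof.
case=> N stab; apply/least_neqNone; exists N => lam n part_lam le_n m0.
have [le_N|/ltnW le_N] := leqP N n; last by apply: leq_trans (leq_addr _ _) (leq_trans le_n le_N).
have eqN j : mult V lam (N + j) = mult V lam N.
  by elim: j => [|j IHj]; rewrite ?addn0 // addnS -stab ?leq_addr.
move: m0; rewrite -(subnKC le_N) eqN /mult /padded; case: ifP => // le _.
exact: leq_trans (leq_addr _ _) le.
Qed.

Lemma urms_range_upto w N : weight V = Some w ->
    (forall n, N <= n -> {in parts_upto w, forall lam, mult V lam n = mult V lam n.+1}) ->
  urms_range V N.
Proof.
move=> w_eq stab n le_N lam part_lam.
have [le_w|lt_w] := leqP (sumn lam) w; first by apply: stab; rewrite ?mem_parts_upto ?part_lam.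
have mult0 m : mult V lam m = 0.
  by apply: contrapT => ne; have := mult_weight w_eq part_lam ne; rewrite leqNgt lt_w.
by rewrite !mult0.
Qed.

Lemma rg_mP mu N0 : rg_m F mu = Some N0 ->
  forall n, N0 <= n -> mcoef F mu n = mcoef F mu n.+1.
Proof.
move=> rg_mu; have := leastP (fun n => forall k, mcoef F mu n = mcoef F mu (n + k)).
rewrite -/(rg_m F mu) rg_mu => -[stab _] n le_n.
by rewrite -(subnKC le_n) -addnS -!stab.
Qed.

Lemma m_stable_range k : m_stable F -> exists N,
  [/\ xmax (Some (2 * k)) (xmax_parts k (rg_m F)) = Some N, 2 * k <= N
    & forall n, N <= n -> {in parts_upto k, forall lam, mult V lam n = mult V lam n.+1}].
Proof.
move=> stab; have [|N [eqN le_N rgN]] := @xmax_partsP k (2 * k) (rg_m F).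
  by move=> mu part_mu _; apply: stab.
exists N; split=> // n le_n; apply/mcoef_stable_iff; first exact: leq_trans le_n.
move=> mu; rewrite mem_parts_upto => /andP[part_mu le_k].
case rg_mu : (rg_m F mu) (stab _ part_mu) => [N0|] // _.
by apply: (rg_mP rg_mu); apply: leq_trans le_n; apply: (rgN mu).
Qed.

Lemma urms_m_stable : urms V -> m_stable F.
Proof.
case=> N stab mu part_mu; apply/least_neqNone; exists (maxn N (2 * sumn mu)) => k.
elim: k => [|k IHk]; rewrite ?addn0 // addnS IHk.
set n := _ + k; have le_n : maxn N (2 * sumn mu) <= n := leq_addr _ _.
move: le_n; rewrite geq_max => /andP[le_N le_mu].
apply: (iffRL (mcoef_stable_iff le_mu)); last by rewrite mem_parts_upto part_mu /=.
by move=> lam; rewrite mem_parts_upto => /andP[part_lam _]; apply: stab.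
Qed.

Lemma urms_iff_m_stable : urms V <-> weight V <> None /\ m_stable F.
Proof.
split=> [u_V | []]; first by split; [apply: urms_weight | apply: urms_m_stable].
case w_eq : (weight V) => [w|] // _ stab; have [N [_ _ stabN]] := m_stable_range w stab.
by exists N; apply: urms_range_upto w_eq stabN.
Qed.

Lemma urms_mult_range : urms V -> forall lam, is_part lam ->
  exists2 N, xmax (Some (2 * sumn lam)) (xmax_parts (sumn lam) (rg_m F)) = Some N
    & forall n, N <= n -> mult V lam n = mult V lam N.
Proof.
move=> u_V lam part_lam; have [N [eqN _ stabN]] := m_stable_range (sumn lam) (urms_m_stable u_V).
exists N => // n /subnKC <-; elim: (n - N) => [|j IHj]; first by rewrite addn0.
by rewrite addnS -stabN ?leq_addr // mem_parts_upto part_lam /=.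
Qed.

Lemma urms_range_m : urms V -> exists w, weight V = Some w /\
  exists2 N, xmax (Some (2 * w)) (xmax_parts w (rg_m F)) = Some N & urms_range V N.
Proof.
move=> u_V; case w_eq : (weight V) (urms_weight u_V) => [w|] // _; exists w; split=> //.
have [N [eqN _ stabN]] := m_stable_range w (urms_m_stable u_V).
by exists N => //; apply: urms_range_upto w_eq stabN.
Qed.
End SchurKostka.

Local Open Scope ring_scope.
Local Open Scope complex_scope.

(** * Young symmetrizers *)

Section PermMatrices.
Variables (F : numFieldType) (n : nat).
Local Notation G := [set: 'S_n]%G.
Implicit Types (nu lam mu : seq nat).

Lemma row_stab_mul nu p x : p \in row_stab n nu ->
  ((p * x)%g \in row_stab n nu) = (x \in row_stab n nu).
Proof.
rewrite !inE => /forallP p_nu; apply/forallP/forallP => x_nu c.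
  have := x_nu ((p^-1)%g c); rewrite permM permKV => /eqP ->.
  by rewrite eq_sym; have := p_nu ((p^-1)%g c); rewrite permKV.
by rewrite permM (eqP (x_nu _)) p_nu.
Qed.

Lemma col_stab_mul nu q x : q \in col_stab n nu ->
  ((q * x)%g \in col_stab n nu) = (x \in col_stab n nu).
Proof.
rewrite !inE => /forallP q_nu; apply/forallP/forallP => x_nu c.
  have := x_nu ((q^-1)%g c); rewrite permM permKV => /eqP ->.
  by rewrite eq_sym; have := q_nu ((q^-1)%g c); rewrite permKV.
by rewrite permM (eqP (x_nu _)) q_nu.
Qed.

Lemma row_stab1 nu : 1%g \in row_stab n nu.
Proof. by rewrite inE; apply/forallP => c; rewrite perm1. Qed.

Lemma col_stab1 nu : 1%g \in col_stab n nu.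
Proof. by rewrite inE; apply/forallP => c; rewrite perm1. Qed.

Lemma row_stabV nu p : p \in row_stab n nu -> (p^-1)%g \in row_stab n nu.
Proof. by move=> p_nu; rewrite -(row_stab_mul _ p_nu) mulgV row_stab1. Qed.

Lemma col_stabV nu q : q \in col_stab n nu -> (q^-1)%g \in col_stab n nu.
Proof. by move=> q_nu; rewrite -(col_stab_mul _ q_nu) mulgV col_stab1. Qed.

Lemma row_stab_mulr nu p x : p \in row_stab n nu ->
  ((x * p)%g \in row_stab n nu) = (x \in row_stab n nu).
Proof.
move=> p_nu; apply/idP/idP => x_nu; last by rewrite row_stab_mul.
by rewrite -[x](mulgK p) row_stab_mul // row_stabV.
Qed.

Lemma col_stab_mulr nu q x : q \in col_stab n nu ->
  ((x * q)%g \in col_stab n nu) = (x \in col_stab n nu).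
Proof.
move=> q_nu; apply/idP/idP => x_nu; last by rewrite col_stab_mul.
by rewrite -[x](mulgK q) col_stab_mul // col_stabV.
Qed.

Section Rep.
Variables (m : nat) (rG : mx_representation F G m).

Definition rowsum nu : 'M[F]_m := \sum_(p in row_stab n nu) rG p.
Definition colsum nu : 'M[F]_m :=
  \sum_(q in col_stab n nu) (-1) ^+ odd_perm q *: rG q.
Definition symmetrizer nu := rowsum nu *m colsum nu.

Lemma rG_mul x y : rG (x * y)%g = rG x *m rG y.
Proof. by rewrite repr_mxM ?inE. Qed.

Lemma rowsum_mull nu p : p \in row_stab n nu -> rG p *m rowsum nu = rowsum nu.
Proof.
move=> p_nu; rewrite /rowsum mulmx_sumr [RHS](reindex_inj (mulgI p)) /=.
by apply: eq_big => [x|x _]; rewrite ?row_stab_mul ?rG_mul.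
Qed.

Lemma rowsum_mulr nu p : p \in row_stab n nu -> rowsum nu *m rG p = rowsum nu.
Proof.
move=> p_nu; rewrite /rowsum mulmx_suml [RHS](reindex_inj (mulIg p)) /=.
by apply: eq_big => [x|x _]; rewrite ?row_stab_mulr ?rG_mul.
Qed.

Lemma colsum_mull nu q : q \in col_stab n nu ->
  rG q *m colsum nu = (-1) ^+ odd_perm q *: colsum nu.
Proof.
move=> q_nu; rewrite /colsum mulmx_sumr [in RHS](reindex_inj (mulgI q)) /= scaler_sumr.
apply: eq_big => [x|x _]; rewrite ?col_stab_mul // rG_mul -scalemxAr scalerA.
by rewrite odd_permM signr_addb mulrA -signr_addb addbb mul1r.
Qed.

Lemma colsum_mulr nu q : q \in col_stab n nu ->
  colsum nu *m rG q = (-1) ^+ odd_perm q *: colsum nu.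
Proof.
move=> q_nu; rewrite /colsum mulmx_suml [in RHS](reindex_inj (mulIg q)) /= scaler_sumr.
apply: eq_big => [x|x _]; rewrite ?col_stab_mulr // rG_mul -scalemxAl scalerA.
by rewrite odd_permM signr_addb mulrC -mulrA -signr_addb addbb mulr1.
Qed.

Lemma rowsum_sqr nu : rowsum nu *m rowsum nu = #|row_stab n nu|%:R *: rowsum nu.
Proof.
rewrite {1}/rowsum mulmx_suml (eq_bigr (fun _ => rowsum nu)) => [|p p_nu].
  by rewrite sumr_const scaler_nat.
exact: rowsum_mull.
Qed.

Lemma mulmx_eq_oppr (A : 'M[F]_m) : A = - A -> A = 0.
Proof.
move=> /eqP; rewrite -addr_eq0 -mulr2n -scaler_nat scaler_eq0 pnatr_eq0 /=.
by move/eqP.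
Qed.

Lemma tperm_row_stab nu (x y : 'I_n) : cell_row nu x = cell_row nu y ->
  tperm x y \in row_stab n nu.
Proof.
by move=> e; rewrite inE; apply/forallP => c; case: tpermP => // ->; rewrite e.
Qed.

Lemma tperm_col_stab nu (x y : 'I_n) : cell_col nu x = cell_col nu y ->
  tperm x y \in col_stab n nu.
Proof.
by move=> e; rewrite inE; apply/forallP => c; case: tpermP => // ->; rewrite e.
Qed.

(** Sign cancellation: if two cells in one column of [lam] come under [g^-1] from one row of [mu],
    the transposition of the latter is absorbed by the row sum and, moved across [g], changes the
    sign of the column sum, so the product is its own opposite. Otherwise the row function of [mu],
    carried along by [g], is injective on the columns of [lam]. *)
Lemma row_col_neq0 mu lam g : is_part lam -> sumn lam = n ->
    rowsum mu *m rG g *m colsum lam <> 0 ->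
  exists2 q : 'S_n, q \in col_stab n lam &
    forall x : 'I_n, (cell_row lam (q x) <= cell_row mu ((g^-1)%g x))%N.
Proof.
move=> part_lam lam_n nz.
apply: (column_injective_dominates (f := fun x => cell_row mu ((g^-1)%g x))) => //.
move=> x y ec er; apply/eqP; apply: contrapT => /negP ne; apply: nz.
apply: mulmx_eq_oppr.
have tc := tperm_col_stab ec.
have tr := tperm_row_stab er.
rewrite -{1}(rowsum_mulr tr) -!mulmxA -mulmxN; congr (_ *m _); rewrite mulmxA -rG_mul.
have -> : (tperm ((g^-1)%g x) ((g^-1)%g y) * g = g * tperm x y)%g.
  by rewrite conjgC tpermJ !permKV.
by rewrite rG_mul -mulmxA colsum_mull // odd_tperm ne expr1 scaleN1r mulmxN.
Qed.

Lemma col_row_neq0 mu lam g : is_part lam -> sumn lam = n ->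
    colsum lam *m rG g *m rowsum mu <> 0 ->
  exists2 q : 'S_n, q \in col_stab n lam &
    forall x : 'I_n, (cell_row lam (q x) <= cell_row mu (g x))%N.
Proof.
move=> part_lam lam_n nz.
apply: (column_injective_dominates (f := fun x => cell_row mu (g x))) => //.
move=> x y ec er; apply/eqP; apply: contrapT => /negP ne; apply: nz.
apply: mulmx_eq_oppr.
have tc := tperm_col_stab ec.
have tr := tperm_row_stab er.
rewrite -{1}(rowsum_mull tr) mulmxA -(mulmxA (colsum lam)) -rG_mul.
have <- : (tperm x y * g = g * tperm (g x) (g y))%g by rewrite conjgC tpermJ.
by rewrite rG_mul mulmxA colsum_mulr // odd_tperm ne expr1 scaleN1r !mulNmx.
Qed.

(** If the product is nonzero, a column permutation [q] turns an inequality of row functions with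
    equal sums into an equality, so [g * q] preserves rows. Thus [g] is a row permutation times a
    column permutation, and both are absorbed up to sign. *)
Lemma row_col_diag nu g : is_part nu -> sumn nu = n ->
  exists k, rowsum nu *m rG g *m colsum nu = k *: symmetrizer nu.
Proof.
move=> part_nu nu_n; have [z|/eqP nz] := eqVneq (rowsum nu *m rG g *m colsum nu) 0.
  by exists 0; rewrite z scale0r.
have [q q_nu le_q] := row_col_neq0 part_nu nu_n nz.
have eq_q : forall x : 'I_n, cell_row nu ((g^-1)%g x) = cell_row nu (q x).
  apply: (sum_row_eq (f := fun x => cell_row nu ((g^-1)%g x)) le_q).
  by rewrite [leqRHS](reindex_inj (@perm_inj _ g^-1%g)).
have p_nu : (g * q)%g \in row_stab n nu.
  by rewrite inE; apply/forallP => c; rewrite permM -eq_q permK.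
exists ((-1) ^+ odd_perm (q^-1)%g).
rewrite -[in LHS](mulgK q g) rG_mul mulmxA rowsum_mulr // -mulmxA.
by rewrite (colsum_mull (col_stabV q_nu)) -scalemxAr.
Qed.

Lemma col_row_diag nu g : is_part nu -> sumn nu = n ->
  exists k, colsum nu *m rG g *m rowsum nu = k *: (colsum nu *m rowsum nu).
Proof.
move=> part_nu nu_n; have [z|/eqP nz] := eqVneq (colsum nu *m rG g *m rowsum nu) 0.
  by exists 0; rewrite z scale0r.
have [q q_nu le_q] := col_row_neq0 part_nu nu_n nz.
have eq_q : forall x : 'I_n, cell_row nu (g x) = cell_row nu (q x).
  apply: (sum_row_eq (f := fun x => cell_row nu (g x)) le_q).
  by rewrite [leqRHS](reindex_inj (@perm_inj _ g)).
have p_nu : (q^-1 * g)%g \in row_stab n nu.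
  by rewrite inE; apply/forallP => c; rewrite permM eq_q permKV.
exists ((-1) ^+ odd_perm q).
rewrite -[in LHS](mulKVg q g) rG_mul mulmxA colsum_mulr // -!scalemxAl -mulmxA.
by rewrite rowsum_mull.
Qed.

Local Notation E_G := (enveloping_algebra_mx rG).

Lemma envelop_sandwich (A B C X : 'M[F]_m) : (X \in E_G)%MS ->
    (forall g, exists k, A *m rG g *m B = k *: C) ->
  exists k, A *m X *m B = k *: C.
Proof.
case/envelop_mxP=> a -> /fin_all_exists[k kP].
exists (\sum_(g in G) a g * k g); rewrite mulmx_sumr mulmx_suml scaler_suml.
by apply: eq_bigr => g _; rewrite -scalemxAr -scalemxAl kP scalerA.
Qed.

Lemma envelop_sandwich_neq0 (A B X : 'M[F]_m) : (X \in E_G)%MS ->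
  A *m X *m B <> 0 -> exists g, A *m rG g *m B <> 0.
Proof.
case/envelop_mxP=> a -> nz; apply: contrapT => /forallNP z; apply: nz.
rewrite mulmx_sumr mulmx_suml big1 // => g _; rewrite -scalemxAr -scalemxAl.
by rewrite (contrapT (z g)) scaler0.
Qed.

Lemma rowsum_envelop nu : (rowsum nu \in E_G)%MS.
Proof. by rewrite linear_sum summx_sub // => p _; rewrite envelop_mx_id ?inE. Qed.

Lemma colsum_envelop nu : (colsum nu \in E_G)%MS.
Proof.
rewrite linear_sum summx_sub // => p _.
by rewrite linearZ scalemx_sub ?envelop_mx_id ?inE.
Qed.

Lemma symmetrizer_envelop nu : (symmetrizer nu \in E_G)%MS.
Proof. by rewrite envelop_mxM ?rowsum_envelop ?colsum_envelop. Qed.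
End Rep.
End PermMatrices.

(** In a rank factorisation A = CB, the factor C is left invertible and B right invertible, so A^2 =
    kA becomes BC = k times the identity of size the rank. Traces of row sums and symmetrizers thus
    measure ranks. *)
Lemma quasi_idempotent_trace (F : fieldType) n (A : 'M[F]_n) (k : F) :
  A *m A = k *: A -> \tr A = k * (\rank A)%:R.
Proof.
move=> AA; have [L LK] := row_fullP (col_base_full A).
have [K KK] := row_freeP (row_base_free A).
have split_sqr r (C : 'M_(n, r)) (B : 'M_(r, n)) L' K' : L' *m C = 1%:M -> B *m K' = 1%:M ->
    C *m B *m (C *m B) = k *: (C *m B) -> B *m C = k%:M.
  move=> LC BK /(congr1 (fun X => L' *m X *m K')).
  rewrite -scalemxAr -scalemxAl !mulmxA LC mul1mx -!mulmxA BK mulmx1 => ->.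
  by rewrite scalemx1.
have RC : row_base A *m col_base A = k%:M by apply: split_sqr LK KK _; rewrite !mulmx_base.
by rewrite -[X in \tr X](mulmx_base A) mxtrace_mulC RC mxtrace_scalar mulr_natr.
Qed.

(** * A weak form of the dominance order *)

Section Dominance.
Variables (n : nat).
Implicit Types lam mu : seq nat.

(** Only two consequences of dominance are retained: the first parts locate the constituents among
    the lambda[n] with small lambda, and the row sums provide triangularity and antisymmetry. *)
Definition dominates lam mu : Prop :=
  (nth 0 mu 0 <= nth 0 lam 0)%N /\ ((row_sum lam < row_sum mu)%N \/ lam = mu).

Lemma dominates_anti lam mu : dominates lam mu -> dominates mu lam -> lam = mu.
Proof. by move=> [_ [lt1|//]] [_ [lt2|//]]; have := ltn_trans lt1 lt2; rewrite ltnn. Qed.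

Lemma content_dominates lam mu (q : 'S_n) (f : 'I_n -> nat) :
    is_part lam -> is_part mu -> sumn lam = n -> sumn mu = n ->
    (forall x : 'I_n, (cell_row lam (q x) <= f x)%N) ->
    (forall r, #|[pred x | f x == r]| = nth 0%N mu r) ->
  dominates lam mu.
Proof.
move=> part_lam part_mu lam_n mu_n le_qf fiber.
split; first by rewrite -fiber; apply: row0_le le_qf lam_n.
have sum_f : (\sum_(c < n) f c = \sum_(c < n) cell_row mu c)%N.
  by apply: sum_eq_fibers => r; rewrite fiber card_row.
rewrite /row_sum lam_n mu_n -sum_f; have := sum_row_le le_qf.
rewrite leq_eqVlt => /predU1P[eq_s|]; [right | by left].
have fE := sum_row_eq le_qf (eq_leq (esym eq_s)).
apply: part_eq_nth => // r; rewrite -fiber -(card_row r lam_n).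
rewrite -!sum1_card [LHS](reindex_inj (@perm_inj _ q)).
by apply: eq_bigl => x; rewrite !inE fE.
Qed.

Lemma rows_dominate lam mu (q h : 'S_n) :
    is_part lam -> is_part mu -> sumn lam = n -> sumn mu = n ->
    (forall x : 'I_n, (cell_row lam (q x) <= cell_row mu (h x))%N) ->
  dominates lam mu.
Proof.
move=> part_lam part_mu lam_n mu_n le_qh; apply: content_dominates le_qh _ => // r.
by rewrite -(card_row r mu_n) -!sum1_card [RHS](reindex_inj (@perm_inj _ h)).
Qed.
End Dominance.

Section Specht.
Variables (R : realType) (n : nat).
Local Notation F := R[i].
Local Notation G := [set: 'S_n]%G.
Implicit Types nu lam mu : seq nat.
Local Notation aG := (regular_repr F G).

Lemma pchar_perm : ([pchar F]^'.-group G)%g.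
Proof. by rewrite pgroupE; apply/pnatP => // p _ _; rewrite inE /= (pchar_num F). Qed.

Lemma splitting_perm : group_splitting_field F G.
Proof. exact: group_closure_closed_field. Qed.

Lemma polytabloidE nu : polytabloid R n nu = gring_row (symmetrizer aG nu).
Proof.
rewrite /polytabloid /gring_row /symmetrizer rowE mulmx_suml mulmx_sumr.
apply: eq_bigr => p _; rewrite /colsum mulmx_sumr mulmx_sumr.
apply: eq_bigr => q _; rewrite -scalemxAr -scalemxAr -rG_mul -rowE rowK.
by rewrite gring_indexK ?group1 // mul1g.
Qed.

Lemma mxtrace_regular_perm (g : 'S_n) : \tr (aG g) = (#|G|)%:R *+ (g == 1%g).
Proof.
case: eqVneq => [->|ne]; first by rewrite repr_mx1 mxtrace1.
rewrite /mxtrace big1 // => i _; rewrite !mxE eqxx /=.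
case: eqP => // /(congr1 enum_val); rewrite gring_indexK ?inE // => e.
by case/eqP: ne; apply: (mulgI (enum_val i)); rewrite mulg1.
Qed.

Variable nu : seq nat.
Hypotheses (part_nu : is_part nu) (nu_n : sumn nu = n).

Lemma row_col_stab (p q : 'S_n) : p \in row_stab n nu -> q \in col_stab n nu ->
  ((p * q)%g == 1%g) = (p == 1%g) && (q == 1%g).
Proof.
move=> p_nu q_nu; apply/eqP/andP => [pq1|[/eqP -> /eqP ->]]; last by rewrite mulg1.
have qE : q = (p^-1)%g by apply: (mulgI p); rewrite pq1 mulgV.
have : (p^-1)%g = 1%g.
  apply/permP => c; rewrite perm1; apply/val_inj/(@cell_inj nu).
    by move: (row_stabV p_nu); rewrite inE => /forallP/(_ c)/eqP.
  by move: q_nu; rewrite qE inE => /forallP/(_ c)/eqP.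
by move=> p1; rewrite qE p1 -[p]invgK p1 invg1.
Qed.

(** The regular character is concentrated at the identity, and a row permutation inverse to a column
    permutation is trivial because a cell is determined by its row and column. *)
Lemma mxtrace_symmetrizer : \tr (symmetrizer aG nu) = #|G|%:R.
Proof.
have trE (p q : 'S_n) : \tr (aG p *m ((-1) ^+ odd_perm q *: aG q)) =
    (-1) ^+ odd_perm q * (#|G|%:R *+ ((p * q)%g == 1%g)).
  by rewrite -scalemxAr mxtraceZ -rG_mul mxtrace_regular_perm.
transitivity (\sum_(p in row_stab n nu) \sum_(q in col_stab n nu)
    (-1) ^+ odd_perm q * (#|G|%:R *+ ((p * q)%g == 1%g)) : F).
  rewrite /symmetrizer /rowsum mulmx_suml raddf_sum; apply: eq_bigr => p _.
  by rewrite mulmx_sumr raddf_sum; apply: eq_bigr => q _; apply: trE.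
rewrite (bigD1 1%g) ?row_stab1 //= [X in _ + X]big1 ?addr0 => [|p /andP[p_nu ne]].
  rewrite (bigD1 1%g) ?col_stab1 //= big1 => [|q /andP[q_nu ne]].
    by rewrite odd_perm1 expr0 mul1r mulg1 eqxx addr0.
  by rewrite mul1g (negbTE ne) mulr0n mulr0.
rewrite big1 // => q q_nu.
by rewrite row_col_stab // (negbTE ne) mulr0n mulr0.
Qed.

(* The scalar is nonzero since the symmetrizer has trace n! on the regular
   module. *)
Lemma symmetrizer_sqr : exists2 k : F, k != 0 &
  forall m (rG : mx_representation F G m),
    symmetrizer rG nu *m symmetrizer rG nu = k *: symmetrizer rG nu.
Proof.
have [||k kP] := @envelop_sandwich _ _ _ aG (rowsum aG nu) (colsum aG nu)
  (symmetrizer aG nu) (colsum aG nu *m rowsum aG nu).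
- by rewrite envelop_mxM ?rowsum_envelop ?colsum_envelop.
- by move=> g; apply: row_col_diag.
have sqr_aG : symmetrizer aG nu *m symmetrizer aG nu = k *: symmetrizer aG nu.
  by rewrite -kP /symmetrizer !mulmxA.
exists k => [|m rG].
  apply/eqP => k0; have := quasi_idempotent_trace sqr_aG.
  rewrite mxtrace_symmetrizer k0 mul0r => /eqP; rewrite pnatr_eq0.
  by rewrite eqn0Ngt cardG_gt0.
(* The quadratic relation holds in the group algebra, here the enveloping algebra of the regular
   representation; [gring_op] carries it to any representation with the same scalar. *)
have opR mu : gring_op rG (rowsum aG mu) = rowsum rG mu.
  rewrite /rowsum linear_sum; apply: eq_bigr => p _.
  by rewrite -[LHS]/(gring_op rG (aG p)) gring_opG ?inE.
have opC mu : gring_op rG (colsum aG mu) = colsum rG mu.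
  rewrite /colsum linear_sum; apply: eq_bigr => p _; rewrite linearZ.
  by rewrite -[X in _ *: X = _]/(gring_op rG (aG p)) gring_opG ?inE.
have opS : gring_op rG (symmetrizer aG nu) = symmetrizer rG nu.
  by rewrite gring_opM ?colsum_envelop // opR opC.
by rewrite -!opS -gring_opM ?symmetrizer_envelop // sqr_aG linearZ.
Qed.

Local Notation u := (polytabloid R n nu).
Local Notation U := (cyclic_mx aG u).
Local Notation sG := (specht R n nu).

Lemma symmetrizer_neq0 : symmetrizer aG nu != 0.
Proof.
apply/eqP => z; have := mxtrace_symmetrizer; rewrite z mxtrace0 => /esym/eqP.
by rewrite pnatr_eq0 eqn0Ngt cardG_gt0.
Qed.

Lemma polytabloid_neq0 : u != 0.
Proof.
apply: contra symmetrizer_neq0; rewrite polytabloidE => /eqP z.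
by rewrite -(gring_rowK (symmetrizer_envelop aG nu)) z linear0.
Qed.

Lemma specht_rowP (v : 'rV[F]_(#|G|)) : (v <= U)%MS ->
  exists2 X, (X \in enveloping_algebra_mx aG)%MS &
    v = gring_row (rowsum aG nu *m (colsum aG nu *m X)).
Proof.
case/cyclic_mxP => X X_G ->; exists X => //.
by rewrite polytabloidE -gring_row_mul /symmetrizer -mulmxA.
Qed.

(** An element of the module is the symmetrizer times some X, and the part of the product that lies
    between the outer row sum and the outer column sum is in the group algebra; [row_col_diag]
    collapses it to a scalar. *)
Lemma specht_mul_symmetrizer (v : 'rV[F]_(#|G|)) : (v <= U)%MS ->
  exists k, v *m symmetrizer aG nu = k *: u.
Proof.
case/specht_rowP=> X X_G ->; rewrite -gring_row_mul.
have [||k kP] := @envelop_sandwich _ _ _ aG (rowsum aG nu) (colsum aG nu)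
  (symmetrizer aG nu) (colsum aG nu *m X *m rowsum aG nu).
- by rewrite !envelop_mxM ?rowsum_envelop ?colsum_envelop.
- by move=> g; apply: row_col_diag.
by exists k; rewrite polytabloidE -linearZ -kP /= /symmetrizer !mulmxA.
Qed.

(** Split the generator [u] along a submodule [V] and a Maschke complement [W]. The symmetrizer maps
    both components to multiples of [u], and these multiples add up to the nonzero scalar [k]. So
    one of [V] and [W] contains [u], hence all of [U]; if it were [W], then [V] would vanish. *)
Lemma specht_simple : mxsimple aG U.
Proof.
split; [exact: cyclic_mx_module | by rewrite cyclic_mx_eq0 polytabloid_neq0 |].
move=> V modV sVU nzV.
have redU : mx_completely_reducible aG U.
  exact: mx_reducibleS (cyclic_mx_module aG u) (submx1 _) (mx_Maschke_pchar aG pchar_perm).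
have [W modW defU dxVW] := redU V modV sVU.
have [k k_neq0 /(_ _ aG) sqrE] := symmetrizer_sqr.
have mul_mod (M : 'M_#|G|) v : mxmodule aG M -> (v <= M)%MS ->
    (v *m symmetrizer aG nu <= M)%MS.
  move=> modM le_v; rewrite (mxmodule_envelop modM) ?symmetrizer_envelop //.
have uV : (u <= V + W)%MS by rewrite defU cyclic_mx_id.
have [[x y] /= defu] := sub_addsmxP uV; set v := x *m V in defu; set w := y *m W in defu.
have vV : (v <= V)%MS := submxMl _ _; have wW : (w <= W)%MS := submxMl _ _.
have vU : (v <= U)%MS := submx_trans vV sVU.
have wU : (w <= U)%MS by rewrite -defU (submx_trans wW) ?addsmxSr.
have [c1 v_eq] := specht_mul_symmetrizer vU; have [c2 w_eq] := specht_mul_symmetrizer wU.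
have sumc : (c1 + c2) *: u = k *: u.
  rewrite scalerDl -v_eq -w_eq -mulmxDl -defu polytabloidE -gring_row_mul sqrE.
  by rewrite linearZ.
have [c10|c1_neq0] := eqVneq c1 0; last first.
  apply: (cyclic_mx_sub modV).
  by rewrite -(eqmx_scale _ c1_neq0) -v_eq mul_mod.
have c2_neq0 : c2 != 0.
  apply: contraNneq k_neq0 => c20; move: sumc; rewrite c10 c20 addr0 scale0r.
  by move=> /esym/eqP; rewrite scaler_eq0 (negbTE polytabloid_neq0) orbF.
have sUW : (U <= W)%MS.
  by apply: (cyclic_mx_sub modW); rewrite -(eqmx_scale _ c2_neq0) -w_eq mul_mod.
case/eqP: nzV; apply/eqP; rewrite -submx0 -(mxdirect_addsP dxVW) sub_capmx submx_refl.
exact: submx_trans sVU sUW.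
Qed.

Lemma specht_irreducible : mx_irreducible sG.
Proof. by apply/submod_mx_irr; apply: specht_simple. Qed.

End Specht.

(** * Conjugacy classes of permutations *)

Lemma map_eq_reorder (A B : eqType) (f : A -> nat) (g : B -> nat) (s : seq A) (t : seq B) :
    perm_eq [seq f x | x <- s] [seq g y | y <- t] ->
  exists s' t', [/\ perm_eq s' s, perm_eq t' t & [seq f x | x <- s'] = [seq g y | y <- t']].
Proof.
move=> eq_fg; exists (sort (relpre f leq) s), (sort (relpre g leq) t).
rewrite !perm_sort -!sort_map; split=> //.
by apply/(perm_sortP leq_total leq_trans anti_leq).
Qed.

Section CycleType.
Variable T : finType.
Implicit Types s t : {perm T}.

Section Conj.
Variables (s t : {perm T}) (Ps Qs : seq {set T}).
Hypotheses (Ps_s : perm_eq Ps (enum (porbits s))) (Qs_t : perm_eq Qs (enum (porbits t)))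
  (eq_card : [seq #|A| | A : {set T} <- Ps] = [seq #|A| | A : {set T} <- Qs]).

Let rep (x0 : T) (A : {set T}) : T := odflt x0 [pick x in A].

Let block x : {set T} := nth set0 Qs (index (porbit s x) Ps).
Let start x := rep x (porbit s x).
Let position x := index x (traject s (start x) #|porbit s x|).
(** Cycles of [s] and [t] are matched by their places in [Ps] and [Qs], and a point goes to the
    point at the same distance from the base point of the matched cycle. Base points are picked from
    the cycle as a set, so all its points share one. *)
Definition conj_fun x := iter (position x) t (rep x (block x)).

Let startP x : start x \in porbit s x.
Proof. by rewrite /start /rep; case: pickP => //= /(_ x); rewrite porbit_id. Qed.

Let porbit_start x : porbit s (start x) = porbit s x.
Proof. by apply/eqP; rewrite eq_porbit_mem startP. Qed.

Let mem_Ps x : porbit s x \in Ps.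
Proof. by rewrite (perm_mem Ps_s) mem_enum imset_f. Qed.

Let position_lt x : (position x < #|porbit s x|)%N.
Proof.
rewrite /position -{2}(size_traject s (start x) #|porbit s x|) index_mem.
by rewrite -{1}porbit_start -porbit_traject porbit_start porbit_id.
Qed.

Let positionE x : iter (position x) s (start x) = x.
Proof.
rewrite -(nth_traject s (position_lt x)) nth_index //.
by rewrite -{1}porbit_start -porbit_traject porbit_start porbit_id.
Qed.

Let size_PQ : size Ps = size Qs.
Proof. by rewrite -(size_map (fun A : {set T} => #|A|)) eq_card size_map. Qed.

Let block_Qs x : block x \in porbits t.
Proof.
rewrite -mem_enum -(perm_mem Qs_t) mem_nth // -size_PQ index_mem; exact: mem_Ps.
Qed.

Let card_block x : #|block x| = #|porbit s x|.
Proof.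
have lt_P : (index (porbit s x) Ps < size Ps)%N by rewrite index_mem mem_Ps.
have := congr1 (fun l => nth 0%N l (index (porbit s x) Ps)) eq_card.
by rewrite !(nth_map set0) -?size_PQ // nth_index ?mem_Ps // => ->.
Qed.

Let rep_block x : porbit t (rep x (block x)) = block x.
Proof.
have /imsetP[y _ yE] := block_Qs x.
rewrite /rep; case: pickP => /= [z|/(_ y)]; last by rewrite yE porbit_id.
by rewrite yE -eq_porbit_mem => /eqP.
Qed.

Let start_indep x y : porbit s x = porbit s y -> start x = start y.
Proof.
move=> e; rewrite /start /rep e; case: pickP => //= /(_ y).
by rewrite porbit_id.
Qed.

Let rep_indep x y : porbit s x = porbit s y -> rep x (block x) = rep y (block y).
Proof.
move=> e; rewrite /block e /rep; case: pickP => //= noz.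
by have /imsetP[z _ zE] := block_Qs y; have := noz z; rewrite -/(block y) zE porbit_id.
Qed.

Lemma conj_fun_comm x : conj_fun (s x) = t (conj_fun x).
Proof.
have e : porbit s (s x) = porbit s x by have := porbit_perm s 1 x; rewrite expg1.
rewrite /conj_fun (rep_indep e) -iterS.
have := position_lt x; rewrite leq_eqVlt => /predU1P[eq_k|lt_k].
  (* At the last point of its cycle [s] returns to the base point; [t] does likewise because the
     matched cycle has the same length. *)
  have sx : s x = start x by rewrite -{1}(positionE x) -iterS eq_k -porbit_start iter_porbit.
  have -> : position (s x) = 0%N.
    rewrite /position (start_indep e) e; case: #|porbit s x| eq_k => //= k _.
    by rewrite sx eqxx.
  by rewrite eq_k -card_block -{2}(rep_block x) iter_porbit.
suff -> : position (s x) = (position x).+1 by [].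
have sxE : s x = iter (position x).+1 s (start x) by rewrite iterS positionE.
rewrite {1}/position (start_indep e) e sxE -(nth_traject s lt_k) index_uniq ?size_traject //.
by rewrite -porbit_start uniq_traject_porbit.
Qed.

Lemma conj_fun_inj : injective conj_fun.
Proof.
move=> x y eq_xy.
have orbE z : porbit t (conj_fun z) = block z.
  by rewrite /conj_fun -permX porbit_perm rep_block.
have eB : block x = block y by rewrite -!orbE eq_xy.
have uQ : uniq Qs by rewrite (perm_uniq Qs_t) enum_uniq.
have lt_P z : (index (porbit s z) Ps < size Qs)%N by rewrite -size_PQ index_mem mem_Ps.
have e : porbit s x = porbit s y.
  apply: (index_inj set0); rewrite ?mem_Ps //.
  by apply/eqP; rewrite -(nth_uniq set0 (lt_P x) (lt_P y) uQ); apply/eqP.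
move: eq_xy; rewrite /conj_fun (rep_indep e) => eq_iter.
rewrite -(positionE x) -(positionE y) (start_indep e).
suff -> : position x = position y by [].
apply/eqP; move/eqP: eq_iter.
have u : uniq (traject t (rep y (block y)) #|porbit s y|).
  by rewrite -card_block -{2}(rep_block y) uniq_traject_porbit.
have [lx ly] := (position_lt x, position_lt y); rewrite e in lx.
have := @nth_uniq _ (rep y (block y)) _ (position x) (position y) _ _ u.
by rewrite !size_traject => /(_ lx ly) <-; rewrite !nth_traject.
Qed.
End Conj.

Lemma perm_eq_porbits_conj s t :
    perm_eq [seq #|A| | A : {set T} <- enum (porbits s)]
            [seq #|A| | A : {set T} <- enum (porbits t)] ->
  exists x, t = (s ^ x)%g.
Proof.
case/map_eq_reorder=> Ps [Qs [Ps_s Qs_t eq_card]].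
have x_inj := conj_fun_inj Ps_s Qs_t eq_card.
exists (perm x_inj); apply: (mulgI (perm x_inj)); rewrite -conjgC.
by apply/permP => c; rewrite !permM !permE conj_fun_comm.
Qed.

Lemma sumn_card_porbits s : sumn [seq #|A| | A : {set T} <- enum (porbits s)] = #|T|.
Proof.
rewrite sumnE big_map big_enum /=.
have part_T : partition (porbits s) [set: T].
  have -> : porbits s = orbit (perm_action T) <[s]>%g @: [set: T].
    by apply/setP => A; apply/imsetP/imsetP => -[x _ ->]; exists x; rewrite ?porbitE ?inE.
  by apply: orbit_partition; apply/actsP => a _ x; rewrite !inE.
by rewrite -(card_partition part_T) cardsT.
Qed.
End CycleType.

Section PartitionOfPerm.
Variable n : nat.

Definition porbit_type (s : 'S_n) : seq nat :=
  sort geq [seq #|A| | A : {set 'I_n} <- enum (porbits s)].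

Lemma porbit_type_partition s : porbit_type s \in partitions n.
Proof.
rewrite mem_partitions /is_part sort_sorted /=; last by move=> x y; apply: leq_total.
have /perm_sumn -> : perm_eq (porbit_type s) [seq #|A| | A : {set 'I_n} <- enum (porbits s)].
  by rewrite /porbit_type perm_sort.
rewrite mem_sort sumn_card_porbits card_ord eqxx andbT.
apply/mapP => -[A]; rewrite mem_enum => /imsetP[x _ ->] /esym/eqP.
by rewrite (negbTE (card_porbit_neq0 s x)).
Qed.

Lemma cycle_type_porbit_type s : cycle_type s (porbit_type s).
Proof.
have := porbit_type_partition s; rewrite mem_partitions => /andP[part_s _].
by rewrite /cycle_type part_s /porbit_type perm_sort perm_refl.
Qed.

(** Permutations of the same cycle type are conjugate. This bounds the number of irreducibles by the
    number of partitions, and so makes the Specht modules exhaust them. *)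
Lemma card_classes_perm : (#|classes [set: 'S_n]| <= size (partitions n))%N.
Proof.
pose f (C : {set 'S_n}) := porbit_type (repr C).
rewrite cardE -(size_map f) uniq_leq_size //.
  rewrite map_inj_in_uniq ?enum_uniq // => C D; rewrite !mem_enum.
  case/imsetP=> x _ -> /imsetP[y _ ->] eq_f.
  have [x1 _ x1E] := repr_class [set: 'S_n] x; have [y1 _ y1E] := repr_class [set: 'S_n] y.
  have [z zE] : exists z, repr (y ^: [set: 'S_n])%g = (repr (x ^: [set: 'S_n]) ^ z)%g.
    apply: perm_eq_porbits_conj.
    apply: (perm_trans (y := f (x ^: [set: 'S_n])%g)).
      by rewrite /f /porbit_type perm_sym perm_sort perm_refl.
    by rewrite eq_f /f /porbit_type perm_sort perm_refl.
  apply/class_eqP; apply/imsetP; exists (y1 * z^-1 * x1^-1)%g; rewrite ?inE //.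
  by rewrite !conjgM -y1E zE conjgK x1E conjgK.
by move=> _ /mapP[C _ ->]; apply: porbit_type_partition.
Qed.
End PartitionOfPerm.

(** * Specht modules *)

Section Intertwine.
Variables (F : numFieldType) (n m1 m2 : nat).
Variables (rG1 : mx_representation F [set: 'S_n]%G m1)
  (rG2 : mx_representation F [set: 'S_n]%G m2).

Variable phi : 'M[F]_(m1, m2).
Hypothesis comm : forall x, rG1 x *m phi = phi *m rG2 x.

Lemma rowsum_comm mu : rowsum rG1 mu *m phi = phi *m rowsum rG2 mu.
Proof. by rewrite mulmx_suml mulmx_sumr; apply: eq_bigr. Qed.

Lemma colsum_comm mu : colsum rG1 mu *m phi = phi *m colsum rG2 mu.
Proof.
rewrite mulmx_suml mulmx_sumr; apply: eq_bigr => q _.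
by rewrite -scalemxAl -scalemxAr comm.
Qed.

Lemma symmetrizer_comm mu : symmetrizer rG1 mu *m phi = phi *m symmetrizer rG2 mu.
Proof. by rewrite -mulmxA colsum_comm mulmxA rowsum_comm mulmxA. Qed.
End Intertwine.

Section SpechtOps.
Variables (R : realType) (n : nat).
Local Notation F := R[i].
Local Notation G := [set: 'S_n]%G.
Local Notation aG := (regular_repr F G).
Implicit Types (lam mu nu : seq nat).
Local Notation U nu := (cyclic_mx aG (polytabloid R n nu)).

Lemma nz_row_mul (K : fieldType) a b (M : 'M[K]_(a, b)) : M != 0 ->
  exists v : 'rV[K]_a, v *m M <> 0.
Proof.
move=> nzM; apply: contrapT => /forallNP z; case/eqP: nzM.
by apply/row_matrixP => i; rewrite rowE row0; apply: contrapT; apply: z.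
Qed.

Lemma val_submod_comm nu (x : 'S_n) :
  specht R n nu x *m val_submod 1%:M = val_submod 1%:M *m aG x.
Proof.
by rewrite -val_submodE -[X in val_submod X = _]mul1mx val_submodJ ?inE.
Qed.

Lemma val_submod_mul nu (X : 'M_(rdegree (specht R n nu))) (Y : 'M_#|G|)
    (v : 'rV_(rdegree (specht R n nu))) :
    X *m (val_submod 1%:M : 'M_(_, #|G|)) = val_submod 1%:M *m Y ->
  val_submod (v *m X) = (val_submod v : 'rV_#|G|) *m Y.
Proof. by move=> XY; rewrite val_submodE -mulmxA XY mulmxA -val_submodE. Qed.

Lemma val_submod_neq0 nu (v : 'rV_(rdegree (specht R n nu))) :
  v <> 0 -> (val_submod v : 'rV_#|G|) <> 0.
Proof. by move=> nz /eqP; rewrite val_submod_eq0 => /eqP. Qed.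

Lemma gring_row_neq0 (A : 'M[F]_#|G|) : gring_row A <> 0 -> A <> 0.
Proof. by move=> nz A0; apply: nz; rewrite A0 linear0. Qed.

(** A vector of the module of [mu] begins with the row sum of [mu], and applying the symmetrizer of
    [lam] makes it end with the column sum of [lam]. If the result is nonzero, so is the product
    with some single permutation in the middle. *)
Lemma specht_symmetrizer_neq0 lam mu : lam \in partitions n -> mu \in partitions n ->
  symmetrizer (specht R n mu) lam != 0 -> dominates lam mu.
Proof.
rewrite !mem_partitions => /andP[part_lam /eqP lam_n] /andP[part_mu /eqP mu_n].
case/nz_row_mul => v /val_submod_neq0.
rewrite (val_submod_mul v (symmetrizer_comm (val_submod_comm mu) lam)).
have [X X_G ->] := specht_rowP (val_submodP v).
rewrite -gring_row_mul => /gring_row_neq0 nz.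
have {}nz : rowsum aG mu *m (colsum aG mu *m X *m rowsum aG lam) *m colsum aG lam <> 0.
  by move: nz; rewrite /symmetrizer !mulmxA.
have X_G' : (colsum aG mu *m X *m rowsum aG lam \in enveloping_algebra_mx aG)%MS.
  by rewrite !envelop_mxM ?rowsum_envelop ?colsum_envelop.
have [g] := envelop_sandwich_neq0 X_G' nz.
case/row_col_neq0 => // q _ le_q.
exact: rows_dominate part_lam part_mu lam_n mu_n le_q.
Qed.

Lemma specht_rowsum_neq0 lam mu : lam \in partitions n -> mu \in partitions n ->
  rowsum (specht R n lam) mu != 0 -> dominates lam mu.
Proof.
rewrite !mem_partitions => /andP[part_lam /eqP lam_n] /andP[part_mu /eqP mu_n].
case/nz_row_mul => v /val_submod_neq0.
rewrite (val_submod_mul v (rowsum_comm (val_submod_comm lam) mu)).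
have [X X_G ->] := specht_rowP (val_submodP v).
rewrite -gring_row_mul -mulmxA => /gring_row_neq0 nz.
have {}nz : colsum aG lam *m X *m rowsum aG mu <> 0.
  by move=> z; apply: nz; rewrite z mulmx0.
case: (envelop_sandwich_neq0 X_G nz) => g /col_row_neq0[] // q _ le_q.
exact: rows_dominate part_lam part_mu lam_n mu_n le_q.
Qed.

Variable nu : seq nat.
Hypothesis nu_n : nu \in partitions n.
Local Notation sG := (specht R n nu).

Let part_nu : is_part nu.
Proof. by move: nu_n; rewrite mem_partitions => /andP[]. Qed.
Let sum_nu : sumn nu = n.
Proof. by move: nu_n; rewrite mem_partitions => /andP[_ /eqP]. Qed.

Let w : 'rV_(rdegree sG) := in_submod (U nu) (polytabloid R n nu).

Let val_w : (val_submod w : 'rV_#|G|) = polytabloid R n nu.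
Proof. by rewrite in_submodK ?cyclic_mx_id. Qed.

Lemma specht_symmetrizer_diag : symmetrizer sG nu != 0.
Proof.
have [k k_neq0 /(_ _ aG) sqrE] := symmetrizer_sqr R part_nu sum_nu.
apply/eqP => z.
have := val_submod_mul w (symmetrizer_comm (val_submod_comm nu) nu).
have -> : val_submod w *m symmetrizer aG nu = k *: polytabloid R n nu.
  by rewrite val_w polytabloidE -gring_row_mul sqrE linearZ.
rewrite z mulmx0 linear0 => /esym/eqP; rewrite scaler_eq0 (negbTE k_neq0) /=.
by rewrite (negbTE (polytabloid_neq0 R n nu)).
Qed.

(** By [col_row_diag] every image of the row sum is a multiple of the image of the generator, and
    the row sum is nonzero because the symmetrizer factors through it. So the invariants of the
    Young subgroup of [nu] form a line, which makes the diagonal of B equal to 1. *)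
Lemma specht_rowsum_diag : \rank (rowsum sG nu) = 1%N.
Proof.
have mulE (v : 'rV_(rdegree sG)) : exists k, v *m rowsum sG nu = k *: (w *m rowsum sG nu).
  have [X X_G vE] := specht_rowP (val_submodP v).
  have [|k kP] := @envelop_sandwich _ _ _ aG (colsum aG nu) (rowsum aG nu)
    (colsum aG nu *m rowsum aG nu) X X_G; first by move=> g; apply: col_row_diag.
  exists k; apply: (@val_submod_inj _ _ (U nu)); rewrite linearZ /=.
  rewrite !(val_submod_mul _ (rowsum_comm (val_submod_comm nu) nu)) val_w vE.
  rewrite polytabloidE -!gring_row_mul -linearZ /=; congr gring_row.
  by rewrite /symmetrizer -!mulmxA scalemxAr -kP !mulmxA.
apply/eqP; rewrite eqn_leq; apply/andP; split.
  apply: leq_trans (rank_leq_row (w *m rowsum sG nu)); apply: mxrankS.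
  by apply/row_subP => i; rewrite rowE; have [k ->] := mulE (delta_mx 0 i); apply: scalemx_sub.
rewrite lt0n mxrank_eq0; apply: contraNneq specht_symmetrizer_diag => z.
by rewrite /symmetrizer z mul0mx.
Qed.
End SpechtOps.

(** * The Specht modules are the irreducible modules *)

Section Complete.
Variables (R : realType) (n : nat).
Local Notation F := R[i].
Local Notation G := [set: 'S_n]%G.
Implicit Types (lam mu nu : seq nat).

Lemma symmetrizer_rsim m1 m2 (rG1 : mx_representation F G m1) (rG2 : mx_representation F G m2)
    lam : mx_rsim rG1 rG2 -> symmetrizer rG1 lam != 0 -> symmetrizer rG2 lam != 0.
Proof.
case=> B _ freeB homB; apply: contraNneq => z.
apply/eqP/(row_free_inj freeB); rewrite mul0mx.
have comm x : rG1 x *m B = B *m rG2 x by apply: homB; rewrite inE.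
by rewrite (symmetrizer_comm comm) z mulmx0.
Qed.

(** Whether a symmetrizer vanishes is invariant under isomorphism, which gives dominance in both
    directions. *)
Lemma specht_rsim_inj lam mu : lam \in partitions n -> mu \in partitions n ->
  mx_rsim (specht R n lam) (specht R n mu) -> lam = mu.
Proof.
move=> lam_n mu_n rsim_lm; apply: dominates_anti.
  apply: (specht_symmetrizer_neq0 lam_n mu_n).
  exact: symmetrizer_rsim rsim_lm (specht_symmetrizer_diag R lam_n).
apply: (specht_symmetrizer_neq0 mu_n lam_n).
exact: symmetrizer_rsim (mx_rsim_sym rsim_lm) (specht_symmetrizer_diag R mu_n).
Qed.

Lemma specht_irr nu : nu \in partitions n -> mx_irreducible (specht R n nu).
Proof.
by rewrite mem_partitions => /andP[part_nu /eqP nu_n]; apply: specht_irreducible.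
Qed.

(** There are at least as many partitions as conjugacy classes, hence as irreducibles, so the
    injective map from partitions to irreducibles is onto. *)
Lemma specht_complete m (rG : mx_representation F G m) : mx_irreducible rG ->
  exists2 nu, nu \in partitions n & mx_rsim rG (specht R n nu).
Proof.
move=> irrG; pose iG : irrType F G := DecSocleType (regular_repr F G).
have [f f_rsim] : exists f : seq nat -> iG, forall nu, nu \in partitions n ->
    mx_rsim (specht R n nu) (irr_repr (f nu)).
  exists (fun nu => irr_comp iG (specht R n nu)) => nu nu_n.
  by apply: (rsim_irr_comp_pchar iG (pchar_perm R n)); apply: specht_irr.
have f_inj : {in partitions n &, injective f}.
  move=> lam mu lam_n mu_n eq_f; apply: (specht_rsim_inj lam_n mu_n).
  have := f_rsim lam lam_n; rewrite eq_f => rsim_lam.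
  exact: mx_rsim_trans rsim_lam (mx_rsim_sym (f_rsim mu mu_n)).
have /mapP[nu nu_n eq_nu] : irr_comp iG rG \in map f (partitions n).
  have [|||_ ->] := @uniq_min_size _ (map f (partitions n)) (enum iG).
  - by rewrite map_inj_in_uniq ?partitions_uniq.
  - by move=> i _; rewrite mem_enum.
  - rewrite [leqRHS]size_map -cardE (card_irr_pchar iG (pchar_perm R n) (@splitting_perm R n)).
    exact: card_classes_perm.
  by rewrite mem_enum.
exists nu => //; apply: mx_rsim_trans (rsim_irr_comp_pchar iG (pchar_perm R n) irrG) _.
by rewrite eq_nu; apply/mx_rsim_sym/f_rsim.
Qed.

End Complete.

Lemma big_pick_reindex (Z : Type) (idx : Z) (op : Monoid.com_law idx) (A B : finType)
    (j : A -> B) (h : A -> Z) : injective j ->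
  \big[op/idx]_(b : B) oapp h idx [pick a | j a == b] = \big[op/idx]_(a : A) h a.
Proof.
move=> j_inj; rewrite [RHS](partition_big j xpredT) //=; apply: eq_bigr => b _.
case: pickP => [a /eqP <-|none] /=; last by rewrite big_pred0.
by rewrite (eq_bigl (pred1 a)) ?big_pred1_eq // => x; rewrite /= (inj_eq j_inj).
Qed.

Section Decomposition.
Variables (R : realType) (n : nat).
Local Notation F := R[i].
Local Notation G := [set: 'S_n]%G.
Local Notation ps := (partitions n).

Definition specht_sum (c : seq nat -> nat) : representation F G :=
  \big[@dadd_grepr _ _ _/@grepr0 _ _ _]_(nu <- ps) muln_grepr (specht R n nu) (c nu).

Lemma specht_decomposition (V : representation F G) : exists c, mx_rsim V (specht_sum c).
Proof.
case: V => m rG /=; pose sG := DecSocleType rG.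
have /fin_all_exists[j jP] (W : sG) : exists j : 'I_(size ps),
    mx_rsim (socle_repr W) (specht R n (nth [::] ps j)).
  have [nu nu_n rsimW] := specht_complete (socle_irr W).
  have lt_nu : (index nu ps < size ps)%N by rewrite index_mem.
  by exists (Ordinal lt_nu); rewrite /= nth_index.
have j_inj : injective j.
  move=> W W' eq_j; apply/eqP/socle_rsimP; apply: mx_rsim_trans (jP W) _.
  by rewrite eq_j; apply/mx_rsim_sym/jP.
pose c nu := oapp (fun W : sG => socle_mult W) 0%N [pick W | nth [::] ps (j W) == nu].
(* The isotypic components are reindexed by the positions of all partitions of [n], the zero module
   standing for those that do not occur. *)
exists c; pose U (i : 'I_(size ps)) : 'M_m :=
  oapp (fun W : sG => W : 'M_m) 0 [pick W | j W == i].
have modU i : mxmodule rG (U i).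
  by rewrite /U; case: pickP => [W _|_] /=; [apply: component_mx_module | apply: mxmodule0].
have cE (i : 'I_(size ps)) : c (nth [::] ps i) =
    oapp (fun W : sG => socle_mult W) 0%N [pick W | j W == i].
  rewrite /c; congr (oapp _ _ _); apply: eq_pick => W /=.
  by rewrite nth_uniq ?partitions_uniq.
have rsimU i : mx_rsim (submod_repr (modU i))
    (muln_grepr (specht R n (nth [::] ps i)) (c (nth [::] ps i))).
  rewrite cE; move: (modU i); rewrite /U; case: pickP => [W /eqP <-|_] /= modW.
    have := mx_rsim_socle (jP W).
    by rewrite (eq_irrelevance modW (component_mx_module rG (socle_base W))).
  rewrite /muln_grepr big_ord0; exists 0 => [||x _]; rewrite ?mxrank0 ?mul0mx ?mulmx0 //.
  by rewrite /row_free !mxrank0.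
have sumU : (\sum_i U i)%MS = Socle sG.
  by rewrite /U (big_pick_reindex _ _ j_inj).
have S1 : Socle sG = 1%:M by apply/reducible_Socle1/mx_Maschke_pchar/pchar_perm.
have dxU : mxdirect (\sum_i U i).
  rewrite mxdirectE /= sumU; apply/eqP.
  have rankU i : \rank (U i) = oapp (fun W : sG => \rank (W : 'M_m)) 0%N [pick W | j W == i].
    by rewrite /U; case: pickP => //= _; rewrite mxrank0.
  rewrite (eq_bigr _ (fun i _ => rankU i)) (big_pick_reindex _ _ j_inj).
  by have := Socle_direct sG; rewrite mxdirectE => /eqP.
have defS : (\sum_i U i :=: 1%:M)%MS by rewrite sumU S1.
have := mx_rsim_dsum (mxmodule1 rG) defS dxU rsimU.
move/(mx_rsim_trans (mx_rsim_sym (rsim_submod1 (mxmodule1 rG) (eqmx_refl _)))).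
by rewrite /specht_sum (big_nth [::]) big_mkord.
Qed.

Lemma specht_multP (V : representation F G) : mx_rsim V (specht_sum (specht_mult V)).
Proof.
rewrite /specht_mult; case: classical_sets.xgetP => [c _ //|none].
by have [c cP] := specht_decomposition V; case: (none c).
Qed.

Lemma mxtrace_dadd_grepr (V W : representation F G) x :
  \tr (dadd_grepr V W x) = \tr (V x) + \tr (W x).
Proof. by rewrite /= mxtrace_block. Qed.

Lemma mxtrace_muln_grepr (V : representation F G) k x :
  \tr (muln_grepr V k x) = k%:R * \tr (V x).
Proof.
rewrite /muln_grepr -[in RHS](card_ord k) mulr_natl -sumr_const.
elim/big_rec2: _ => [|i u W _ <-]; first by rewrite /= mxtrace1.
by rewrite mxtrace_dadd_grepr.
Qed.

Lemma mxtrace_specht_sum c x :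
  \tr (specht_sum c x) = \sum_(nu <- ps) (c nu)%:R * \tr (specht R n nu x).
Proof.
rewrite /specht_sum; elim: ps => [|nu s IHs]; first by rewrite !big_nil /= mxtrace1.
by rewrite !big_cons mxtrace_dadd_grepr IHs mxtrace_muln_grepr.
Qed.

Lemma mxtrace_specht_mult (V : representation F G) x :
  \tr (V x) = \sum_(nu <- ps) (specht_mult V nu)%:R * \tr (specht R n nu x).
Proof.
by rewrite -mxtrace_specht_sum; apply: mxtrace_rsim (specht_multP V) _ _; rewrite inE.
Qed.

End Decomposition.

(** * Colourings *)

Section PermutationModule.
Variables (R : realType) (n : nat) (X : finType) (to : {action 'S_n &-> X}).
Local Notation F := R[i].
Local Notation G := [set: 'S_n]%G.

Definition action_mx (g : 'S_n) : 'M[F]_#|X| :=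
  \matrix_(i, j) (to (enum_val i) g == enum_val j)%:R.

Definition point_mx (x : X) : 'rV[F]_#|X| := delta_mx 0 (enum_rank x).

Lemma point_mxE x g : point_mx x *m action_mx g = point_mx (to x g).
Proof.
rewrite -rowE; apply/rowP => j; rewrite !mxE eqxx /= enum_rankK.
by rewrite -(can2_eq enum_rankK enum_valK) eq_sym.
Qed.

Lemma point_mx_ext (A B : 'M[F]_#|X|) :
  (forall x, point_mx x *m A = point_mx x *m B) -> A = B.
Proof.
by move=> eqAB; apply/row_matrixP => i; rewrite !rowE -(enum_valK i) eqAB.
Qed.

Lemma action_mx_repr : mx_repr G action_mx.
Proof.
split=> [|g h _ _]; apply: point_mx_ext => x; rewrite ?mulmxA !point_mxE.
  by rewrite act1 mulmx1.
by rewrite actM.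
Qed.

Definition action_repr : representation F G := Representation (MxRepresentation action_mx_repr).

Lemma mxtrace_action g : \tr (action_repr g) = #|[pred x | to x g == x]|%:R.
Proof.
rewrite /mxtrace (reindex enum_rank) /=; last by apply: onW_bij; exact: enum_rank_bij.
transitivity (\sum_(x : X) (to x g == x)%:R : F).
  by apply: eq_bigr => x _; rewrite mxE !enum_rankK.
rewrite -sum1_card natr_sum [RHS]big_mkcond /=.
by apply: eq_bigr => x _; rewrite inE; case: eqP.
Qed.

Lemma action_mxJ x g : point_mx x *m action_repr g = point_mx (to x g).
Proof. exact: point_mxE. Qed.

(** The row part of the symmetrizer only moves points around, so its column part does not kill some
    point [to x p]. It would kill a point fixed by an odd column permutation, the image being its
    own opposite. *)
Lemma action_symmetrizer_neq0 nu : symmetrizer action_repr nu != 0 ->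
  exists x, forall t, t \in col_stab n nu -> odd_perm t -> to x t <> x.
Proof.
move=> nz; have [x] : exists x, point_mx x *m symmetrizer action_repr nu <> 0.
  apply: contrapT => /forallNP z; case/eqP: nz; apply: point_mx_ext => x.
  by rewrite mulmx0; apply: contrapT.
rewrite /symmetrizer /rowsum mulmxA [point_mx x *m _]mulmx_sumr mulmx_suml => nz'.
have [p] : exists p, point_mx (to x p) *m colsum action_repr nu <> 0.
  apply: contrapT => /forallNP z; apply: nz'; apply: big1 => p _.
  by rewrite action_mxJ; apply: contrapT.
move=> nz2; exists (to x p) => t t_nu odd_t fix_t; apply: nz2.
set M := _ *m _; have : M = - M.
  rewrite {1}/M -{1}fix_t -action_mxJ -mulmxA colsum_mull // odd_t expr1 scaleN1r.
  by rewrite mulmxN.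
by move/eqP; rewrite -addr_eq0 -mulr2n -scaler_nat scaler_eq0 pnatr_eq0 => /eqP.
Qed.

(** The coefficient of [x] in its own image is the number of row permutations: these all fix [x],
    and the identity is the only column permutation that does. *)
Lemma action_symmetrizer_diag nu x :
    (forall p, p \in row_stab n nu -> to x p = x) ->
    (forall q, q \in col_stab n nu -> to x q = x -> q = 1%g) ->
  symmetrizer action_repr nu != 0.
Proof.
move=> fix_row fix_col; apply/eqP => z.
have : (point_mx x *m symmetrizer action_repr nu) 0 (enum_rank x) = 0.
  by rewrite z mulmx0 mxE.
rewrite mulmxA /rowsum [point_mx x *m _]mulmx_sumr.
rewrite (eq_bigr (fun=> point_mx x)) => [|p /fix_row fix_p]; last by rewrite action_mxJ fix_p.
rewrite sumr_const -scaler_nat -scalemxAl mxE.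
have -> : (point_mx x *m colsum action_repr nu) 0 (enum_rank x) = 1.
  rewrite mulmx_sumr summxE (bigD1 1%g) ?col_stab1 //= big1 => [|q /andP[q_nu ne]].
    by rewrite odd_perm1 expr0 scale1r action_mxJ act1 !mxE !eqxx addr0.
  rewrite -scalemxAr action_mxJ !mxE eqxx /= (inj_eq enum_rank_inj) eq_sym.
  by case: eqP => [/(fix_col q q_nu)/eqP|]; rewrite ?(negbTE ne) ?mulr0.
rewrite mulr1 => /eqP; rewrite pnatr_eq0 -leqn0 leqNgt => /negP; apply.
by apply/card_gt0P; exists 1%g; apply: row_stab1.
Qed.
End PermutationModule.

Section Colourings.
Variables (mu : seq nat) (n : nat).
Local Open Scope nat_scope.

(* Part i of [mu] prescribes the number of points of colour i.+1, and colour 0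
   is used for all other points: for n large enough the colourings are the
   tabloids of shape mu[n]. *)
Definition is_colouring (f : {ffun 'I_n -> 'I_(size mu).+1}) : bool :=
  [forall i : 'I_(size mu), #|[pred x | f x == lift ord0 i]| == nth 0 mu i].

Definition colouring : finType := {f : {ffun 'I_n -> 'I_(size mu).+1} | is_colouring f}.

Lemma is_colouring_act (f : {ffun 'I_n -> 'I_(size mu).+1}) (g : 'S_n) :
  is_colouring [ffun x => f ((g^-1)%g x)] = is_colouring f.
Proof.
apply: eq_forallb => i; congr (_ == _).
rewrite -!sum1_card [RHS](reindex_inj (@perm_inj _ (g^-1)%g)).
by apply: eq_bigl => x; rewrite !inE ffunE.
Qed.

Definition colouring_act_fun (f : colouring) (g : 'S_n) : colouring :=
  Sub [ffun x => val f ((g^-1)%g x)] (etrans (is_colouring_act _ g) (valP f)).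

Lemma colouring_act1 f : colouring_act_fun f 1%g = f.
Proof. by apply/val_inj/ffunP => x; rewrite ffunE invg1 perm1. Qed.

Lemma colouring_actM f g h :
  colouring_act_fun f (g * h)%g = colouring_act_fun (colouring_act_fun f g) h.
Proof. by apply/val_inj/ffunP => x; rewrite !ffunE invMg permM. Qed.

Definition colouring_act := TotalAction colouring_act1 colouring_actM.

Lemma colouring_actP (f : colouring) (g : 'S_n) :
  reflect (forall x, val f (g x) = val f x) (colouring_act f g == f).
Proof.
apply: (iffP eqP) => [/(congr1 val)/ffunP e x|e].
  by have := e (g x); rewrite ffunE permK.
by apply/val_inj/ffunP => x; rewrite ffunE -e permKV.
Qed.

Definition fixed_colourings (g : 'S_n) : nat :=
  #|[pred f : {ffun 'I_n -> 'I_(size mu).+1} |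
      is_colouring f && [forall x, f (g x) == f x]]|.

Lemma card_fixed_colouring (g : 'S_n) :
  #|[pred f : colouring | colouring_act f g == f]| = fixed_colourings g.
Proof.
rewrite -(card_image val_inj); apply: eq_card => f; rewrite !inE.
apply/imageP/andP => [[h + ->]|[f_col /forallP f_fix]].
  by rewrite inE => /colouring_actP h_fix; split; [apply: valP | apply/forallP => x; apply/eqP].
exists (Sub f f_col) => //; rewrite inE; apply/colouring_actP => x.
by rewrite SubK; apply/eqP.
Qed.

Lemma colouring_fiber (f : colouring) i : #|[pred x | val (val f x) == i.+1]| = nth 0 mu i.
Proof.
have [lt_i|le_i] := ltnP i (size mu).
  by have /forallP/(_ (Ordinal lt_i))/eqP <- := valP f; apply: eq_card => x; rewrite !inE.
rewrite nth_default // eq_card0 // => x; rewrite inE; apply/negbTE.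
by rewrite neq_ltn (leq_trans (ltn_ord (val f x))).
Qed.

Lemma colouring_fiber0 (f : colouring) :
  #|[pred x | val (val f x) == 0]| + sumn mu = n.
Proof.
have fE x : \sum_(i < (size mu).+1) (val (val f x) == i) = 1.
  by rewrite (bigD1 (val f x)) //= eqxx big1 // => i /negbTE; rewrite -val_eqE /= eq_sym => ->.
apply/esym; transitivity (\sum_(x < n) \sum_(i < (size mu).+1) (val (val f x) == i)).
  by rewrite (eq_bigr _ (fun x _ => fE x)) sum1_card card_ord.
rewrite exchange_big big_ord_recl /=; congr (_ + _).
  by rewrite -sum1_card [RHS]big_mkcond; apply: eq_bigr => x _; rewrite inE; case: eqP.
rewrite sumnE (big_nth 0) big_mkord; apply: eq_bigr => i _.
rewrite -(colouring_fiber f) -sum1_card [RHS]big_mkcond; apply: eq_bigr => x _.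
by rewrite inE /bump /= add1n; case: eqP.
Qed.

Definition colouring_of (f : 'I_n -> nat) : {ffun 'I_n -> 'I_(size mu).+1} :=
  [ffun x => inord (f x)].

Lemma colouring_ofE (f : 'I_n -> nat) x :
  f x <= size mu -> val (colouring_of f x) = f x.
Proof. by move=> le_f; rewrite ffunE /= inordK. Qed.

Lemma is_colouring_of (f : 'I_n -> nat) : (forall x, f x <= size mu) ->
    (forall i, #|[pred x | f x == i.+1]| = nth 0 mu i) ->
  is_colouring (colouring_of f).
Proof.
move=> le_f fiber; apply/forallP => i; rewrite -fiber; apply/eqP/eq_card => x.
by rewrite !inE -val_eqE /= -/(val (colouring_of f x)) colouring_ofE // lift0.
Qed.
End Colourings.

Section FixedColouringsStable.
Variables (mu : seq nat) (k m : nat) (s : 'S_k).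
Hypothesis lt_m : (sumn mu < m)%N.
Local Notation g := (perm_sum s (full_cycle m)).
Local Notation l := (size mu).+1.
Local Open Scope nat_scope.

Lemma perm_sum_lshift i : g (lshift m i) = lshift m (s i).
Proof. by rewrite permE /perm_sum_fun (unsplitK (inl i)). Qed.

Lemma perm_sum_rshift j : g (rshift k j) = rshift k (full_cycle m j).
Proof. by rewrite permE /perm_sum_fun (unsplitK (inr j)). Qed.

Definition extend_colouring (f : {ffun 'I_k -> 'I_l}) : {ffun 'I_(k + m) -> 'I_l} :=
  [ffun x => match split x with inl i => f i | inr _ => ord0 end].

Lemma extend_colouringl f i : extend_colouring f (lshift m i) = f i.
Proof. by rewrite ffunE (unsplitK (inl i)). Qed.

Lemma extend_colouringr f j : extend_colouring f (rshift k j) = ord0.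
Proof. by rewrite ffunE (unsplitK (inr j)). Qed.

Lemma card_split_ord (P : pred 'I_(k + m)) :
  #|P| = #|[pred i | P (lshift m i)]| + #|[pred j | P (rshift k j)]|.
Proof.
by rewrite -!sum1_card big_mkcond big_split_ord /= -!big_mkcond.
Qed.

Lemma full_cycle_const (f : 'I_m -> 'I_l) :
  (forall j, f (full_cycle m j) = f j) -> forall i j, f i = f j.
Proof.
case: m f => [|m'] f f_cyc; first by case.
suff f0 i : f i = f ord0 by move=> i j; rewrite !f0.
case: i => i; elim: i => [|i IHi] lt_i; first by congr f; apply: val_inj.
rewrite -(IHi (ltnW lt_i)) -[RHS]f_cyc; congr f; apply: val_inj.
by rewrite permE /= modn_small.
Qed.

(** A fixed colouring is constant on the long cycle, which is too long for any colour but 0, so only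
    the first [k] points matter. On [k] points there is no colouring at all when [sumn mu > k]: this
    is the source of the block triangularity in [|mu|] and [k]. *)
Lemma fixed_colourings_perm_sum : fixed_colourings mu g = fixed_colourings mu s.
Proof.
have ext_inj : injective extend_colouring.
  move=> f f' /ffunP e; apply/ffunP => i.
  by rewrite -!extend_colouringl e.
have col_ext f : is_colouring (extend_colouring f) = is_colouring f.
  apply: eq_forallb => i; congr (_ == _); rewrite card_split_ord /=.
  rewrite [X in _ + X]eq_card0 => [|j]; last by rewrite !inE extend_colouringr.
  by rewrite addn0; apply: eq_card => j; rewrite !inE extend_colouringl.
rewrite /fixed_colourings -[RHS](card_image ext_inj); apply: eq_card => f; rewrite !inE.
apply/andP/imageP => [[f_col /forallP f_fix]|[h /andP[h_col /forallP h_fix] ->]]; last first.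
  rewrite col_ext h_col; split=> //; apply/forallP => x; apply/eqP.
  case: (split_ordP x) => j ->; last by rewrite perm_sum_rshift !extend_colouringr.
  by rewrite perm_sum_lshift !extend_colouringl; apply/eqP.
have f_const : forall i j : 'I_m, f (rshift k i) = f (rshift k j).
  apply: (full_cycle_const (f := fun j => f (rshift k j))) => j.
  by rewrite -perm_sum_rshift; apply/eqP.
have f0 j : f (rshift k j) = ord0.
  apply/eqP; apply: contraTT lt_m; rewrite eq_sym => /unlift_some[i fj _].
  rewrite -leqNgt -[leqLHS]card_ord.
  have /forallP/(_ i)/eqP fiber := f_col.
  have : m <= #|[pred x | f x == lift ord0 i]|.
    rewrite card_split_ord [X in _ + X](eq_card (B := predT)) ?card_ord ?leq_addl //.
    by move=> j'; rewrite !inE (f_const j' j) fj eqxx.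
  rewrite fiber card_ord => le_m; apply: leq_trans le_m _.
  by rewrite sumnE (big_nth 0) big_mkord (bigD1 i) //= leq_addr.
have fE : f = extend_colouring [ffun i => f (lshift m i)].
  apply/ffunP => x; case: (split_ordP x) => j ->.
    by rewrite extend_colouringl ffunE.
  by rewrite extend_colouringr f0.
exists [ffun i => f (lshift m i)] => //; rewrite inE -col_ext -fE f_col /=.
apply/forallP => i; rewrite !ffunE -perm_sum_lshift; exact: f_fix.
Qed.
End FixedColouringsStable.

(** * Ranks of row sums and symmetrizers as additive invariants *)

Section TraceDecomposition.
Variables (R : realType) (n : nat).
Local Notation F := R[i].
Local Notation G := [set: 'S_n]%G.
Local Notation ps := (partitions n).
Implicit Types (V : representation F G) (lam mu nu : seq nat).

Lemma mxtrace_rowsum V nu : \tr (rowsum V nu) = \sum_(p in row_stab n nu) \tr (V p).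
Proof. by rewrite /rowsum raddf_sum. Qed.

Lemma mxtrace_symmetrizerE V nu : \tr (symmetrizer V nu) =
  \sum_(p in row_stab n nu) \sum_(q in col_stab n nu)
    (-1) ^+ odd_perm q * \tr (V (p * q)%g).
Proof.
rewrite /symmetrizer mulmx_suml raddf_sum; apply: eq_bigr => p _.
rewrite mulmx_sumr raddf_sum; apply: eq_bigr => q _.
by rewrite /= -scalemxAr mxtraceZ -rG_mul.
Qed.

Lemma mxtrace_rowsum_specht V mu : \tr (rowsum V mu) =
  \sum_(nu <- ps) (specht_mult V nu)%:R * \tr (rowsum (specht R n nu) mu).
Proof.
rewrite mxtrace_rowsum (eq_bigr _ (fun p _ => mxtrace_specht_mult V p)) exchange_big.
by apply: eq_bigr => nu _; rewrite -mulr_sumr mxtrace_rowsum.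
Qed.

Lemma mxtrace_symmetrizer_specht V mu : \tr (symmetrizer V mu) =
  \sum_(nu <- ps) (specht_mult V nu)%:R * \tr (symmetrizer (specht R n nu) mu).
Proof.
transitivity (\sum_(nu <- ps) \sum_(p in row_stab n mu) \sum_(q in col_stab n mu)
    (specht_mult V nu)%:R * ((-1) ^+ odd_perm q * \tr (specht R n nu (p * q)%g))).
  rewrite mxtrace_symmetrizerE [RHS]exchange_big; apply: eq_bigr => p _.
  rewrite [RHS]exchange_big; apply: eq_bigr => q _.
  by rewrite mxtrace_specht_mult mulr_sumr; apply: eq_bigr => nu _; rewrite mulrCA.
apply: eq_bigr => nu _; rewrite mxtrace_symmetrizerE mulr_sumr; apply: eq_bigr => p _.
by rewrite mulr_sumr.
Qed.

Lemma mxtrace_rowsum_rank V mu :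
  \tr (rowsum V mu) = #|row_stab n mu|%:R * (\rank (rowsum V mu))%:R.
Proof. exact/quasi_idempotent_trace/rowsum_sqr. Qed.

Lemma card_row_stab_neq0 mu : #|row_stab n mu|%:R != 0 :> F.
Proof.
rewrite pnatr_eq0 -lt0n; apply/card_gt0P.
by exists 1%g; apply: row_stab1.
Qed.

(** Traces are additive over the decomposition into Specht modules, and the scalar that relates
    trace and rank is the same for all constituents, so it cancels. *)
Lemma rank_rowsum_specht V mu : \rank (rowsum V mu) =
  (\sum_(nu <- ps) specht_mult V nu * \rank (rowsum (specht R n nu) mu))%N.
Proof.
apply/eqP; rewrite -(eqr_nat F) natr_sum; apply/eqP/(mulfI (card_row_stab_neq0 mu)).
rewrite -mxtrace_rowsum_rank mxtrace_rowsum_specht mulr_sumr.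
by apply: eq_bigr => nu _; rewrite mxtrace_rowsum_rank natrM mulrCA.
Qed.

Lemma rank_symmetrizer_specht V mu : mu \in ps -> \rank (symmetrizer V mu) =
  (\sum_(nu <- ps) specht_mult V nu * \rank (symmetrizer (specht R n nu) mu))%N.
Proof.
rewrite mem_partitions => /andP[part_mu /eqP mu_n].
have [k k_neq0 sqr] := symmetrizer_sqr R part_mu mu_n.
have trE (W : representation F G) :
    \tr (symmetrizer W mu) = k * (\rank (symmetrizer W mu))%:R.
  exact: quasi_idempotent_trace (sqr _ W).
apply/eqP; rewrite -(eqr_nat F) natr_sum; apply/eqP/(mulfI k_neq0).
rewrite -trE mxtrace_symmetrizer_specht mulr_sumr.
by apply: eq_bigr => nu _; rewrite trE natrM mulrCA.
Qed.

Lemma specht_mult_symmetrizer V nu : nu \in ps ->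
  specht_mult V nu <> 0%N -> symmetrizer V nu != 0.
Proof.
move=> nu_n /eqP; rewrite -lt0n => c_gt0; rewrite -mxrank_eq0 -lt0n rank_symmetrizer_specht //.
rewrite (bigD1_seq nu) ?partitions_uniq //= addn_gt0 muln_gt0 c_gt0 /= lt0n mxrank_eq0.
by rewrite specht_symmetrizer_diag.
Qed.

Lemma symmetrizer_specht_mult V nu : nu \in ps -> symmetrizer V nu != 0 ->
  exists lam, [/\ lam \in ps, specht_mult V lam <> 0%N & dominates nu lam].
Proof.
move=> nu_n; rewrite -mxrank_eq0 rank_symmetrizer_specht // => nz.
have /hasP[lam lam_n] : has (fun lam =>
    specht_mult V lam * \rank (symmetrizer (specht R n lam) nu) != 0)%N ps.
  apply: contraNT nz => /hasPn z; rewrite big_seq big1 // => lam /z.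
  by rewrite negbK => /eqP.
rewrite muln_eq0 negb_or mxrank_eq0 => /andP[/eqP c_neq0 nz'].
by exists lam; split=> //; apply: specht_symmetrizer_neq0 nz'.
Qed.
End TraceDecomposition.

Section ColouringModule.
Variables (R : realType).
Local Notation F := R[i].

Definition colouring_repr mu n : representation F [set: 'S_n]%G :=
  action_repr R (colouring_act mu n).

Lemma mxtrace_colouring mu n g :
  \tr (colouring_repr mu n g) = (fixed_colourings mu g)%:R.
Proof. by rewrite mxtrace_action card_fixed_colouring. Qed.

Variable n : nat.
Implicit Types (mu nu : seq nat).

Lemma colouring_symmetrizer mu nu : symmetrizer (colouring_repr mu n) nu != 0 ->
  exists f : colouring mu n, forall x y : 'I_n, cell_col nu x = cell_col nu y ->
    val f x = val f y -> x = y.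
Proof.
case/action_symmetrizer_neq0=> f fP; exists f => x y ec ef.
apply/eqP; apply: contrapT => /negP ne; apply: (fP (tperm x y)).
- exact: tperm_col_stab.
- by rewrite odd_tperm ne.
- by apply/eqP/colouring_actP => z; case: tpermP => [->|->|//].
Qed.

Lemma colouring_symmetrizer_diag mu nu (f : 'I_n -> nat) : is_part nu -> sumn nu = n ->
    (forall x, f x <= size mu)%N -> (forall i, #|[pred x | f x == i.+1]| = nth 0%N mu i) ->
    (forall x y : 'I_n, f x = f y <-> cell_row nu x = cell_row nu y) ->
  symmetrizer (colouring_repr mu n) nu != 0.
Proof.
move=> part_nu nu_n le_f fiber fE; pose f0 : colouring mu n := Sub _ (is_colouring_of le_f fiber).
have f0E x y : val f0 x = val f0 y <-> cell_row nu x = cell_row nu y.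
  rewrite -fE -!(colouring_ofE (le_f _)); split=> [-> //|e].
  exact: val_inj.
apply: (@action_symmetrizer_diag _ _ _ _ nu f0) => [p p_nu|q q_nu q_fix].
  apply/eqP/colouring_actP => x; apply/f0E.
  by move: p_nu; rewrite inE => /forallP/(_ x)/eqP.
apply/permP => x; rewrite perm1; apply/val_inj/(@cell_inj nu).
  by apply/f0E; move/eqP/colouring_actP: q_fix; apply.
by move: q_nu; rewrite inE => /forallP/(_ x)/eqP.
Qed.

Section Padded.
Variable mu : seq nat.
Hypotheses (part_mu : is_part mu) (pad_mu : padded mu n) (lt_n : (sumn mu < n)%N).
Local Open Scope nat_scope.

Let pad_mu_n : pad mu n \in partitions n.
Proof. exact: pad_partition. Qed.

Lemma colouring_fiber_pad (f : colouring mu n) r :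
  #|[pred x | val (val f x) == r]| = nth 0 (pad mu n) r.
Proof.
rewrite pad_cons //; case: r => [|r]; last exact: colouring_fiber.
by have /= := colouring_fiber0 f; lia.
Qed.

Lemma colouring_dominates nu : nu \in partitions n ->
  symmetrizer (colouring_repr mu n) nu != 0%R -> dominates nu (pad mu n).
Proof.
rewrite mem_partitions => /andP[part_nu /eqP nu_n] /colouring_symmetrizer[f f_inj].
have [|q _ le_q] := column_injective_dominates (f := fun x => val (val f x)) part_nu nu_n.
  by move=> x y ec /val_inj; apply: f_inj.
have := pad_mu_n; rewrite mem_partitions => /andP[part_p /eqP p_n].
exact: content_dominates part_nu part_p nu_n p_n le_q (colouring_fiber_pad f).
Qed.

Lemma colouring_pad_symmetrizer : symmetrizer (colouring_repr mu n) (pad mu n) != 0%R.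
Proof.
have := pad_mu_n; rewrite mem_partitions => /andP[part_p /eqP p_n].
apply: (colouring_symmetrizer_diag (f := fun x => cell_row (pad mu n) x)) => // [x|i].
  have := @cell_row_lt (pad mu n) x; rewrite p_n => /(_ (ltn_ord x)).
  by rewrite pad_cons.
by rewrite (card_row i.+1 p_n) pad_cons.
Qed.

Lemma colouring_mult_dominates nu : nu \in partitions n ->
  specht_mult (colouring_repr mu n) nu <> 0 -> dominates nu (pad mu n).
Proof.
by move=> nu_n /(specht_mult_symmetrizer nu_n); apply: colouring_dominates.
Qed.

(** As the symmetrizer of mu[n] does not vanish on the module, mu[n] dominates some constituent;
    every constituent dominates mu[n], so this one is mu[n] itself. *)
Lemma colouring_mult_diag : specht_mult (colouring_repr mu n) (pad mu n) <> 0.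
Proof.
have [lam [lam_n c_lam dom]] := symmetrizer_specht_mult pad_mu_n colouring_pad_symmetrizer.
by rewrite (dominates_anti dom (colouring_mult_dominates lam_n c_lam)).
Qed.
End Padded.

Section Exact.
Variable mu : seq nat.
Hypothesis mu_n : mu \in partitions n.
Local Open Scope nat_scope.

Let part_mu : is_part mu.
Proof. by move: mu_n; rewrite mem_partitions => /andP[]. Qed.
Let sum_mu : sumn mu = n.
Proof. by move: mu_n; rewrite mem_partitions => /andP[_ /eqP]. Qed.

Lemma colouring_exact_gt0 (f : colouring mu n) x : 0 < val (val f x).
Proof.
have f0 : #|[pred x | val (val f x) == 0]| = 0.
  by have := colouring_fiber0 f; rewrite sum_mu; lia.
rewrite lt0n; apply/negP => fx0.
by have := card0_eq f0 x; rewrite inE fx0.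
Qed.

(** When [sumn mu = n] no point is left for colour 0, so colours diminished by one play the part of
    row indices. *)
Lemma colouring_exact_dominates nu : nu \in partitions n ->
  symmetrizer (colouring_repr mu n) nu != 0%R -> dominates nu mu.
Proof.
rewrite mem_partitions => /andP[part_nu /eqP nu_n] /colouring_symmetrizer[f f_inj].
have [|q _ le_q] := column_injective_dominates (f := fun x => (val (val f x)).-1) part_nu nu_n.
  move=> x y ec ef; apply: f_inj ec _; apply: val_inj.
  by rewrite -[LHS]prednK ?colouring_exact_gt0 // ef prednK ?colouring_exact_gt0.
apply: content_dominates part_nu part_mu nu_n sum_mu le_q _ => r.
rewrite -(colouring_fiber f r); apply: eq_card => x; rewrite !inE.
by rewrite -eqSS prednK ?colouring_exact_gt0.
Qed.

Lemma colouring_exact_symmetrizer : symmetrizer (colouring_repr mu n) mu != 0%R.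
Proof.
apply: (colouring_symmetrizer_diag (f := fun x => (cell_row mu x).+1)) => // [x|i|x y].
- by apply: cell_row_lt; rewrite sum_mu.
- by rewrite -(card_row i sum_mu); apply: eq_card => x; rewrite !inE eqSS.
- by split=> [[]|->].
Qed.
End Exact.

(** The trace of a symmetrizer is a fixed combination of character values, so a linear relation
    between the characters passes to the matrix [P] of these traces, which is triangular with
    nonzero diagonal. *)
Lemma fixed_colourings_free (d : seq nat -> F) :
    (forall s : 'S_n, \sum_(mu <- partitions n) d mu * (fixed_colourings mu s)%:R = 0) ->
  {in partitions n, forall mu, d mu = 0}.
Proof.
(* A nonzero [P mu nu] means that [nu] dominates [mu], so the height has to decrease as [row_sum]
   grows; [B] bounds all row sums, which keeps the truncated subtraction strictly decreasing. *)
move=> d0; pose B := (\sum_(mu <- partitions n) row_sum mu)%N.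
pose P mu nu := \tr (symmetrizer (colouring_repr mu n) nu).
have le_B mu : mu \in partitions n -> (row_sum mu <= B)%N.
  by move=> mu_n; rewrite /B (bigD1_seq mu) ?partitions_uniq //= leq_addr.
apply: (@triangular_ker _ _ _ (fun mu => B - row_sum mu)%N P (partitions_uniq n)).
- move=> mu nu mu_n nu_n P0; have nz : symmetrizer (colouring_repr mu n) nu != 0.
    by apply/eqP => z; apply: P0; rewrite /P z mxtrace0.
  have [_ [lt_r|->]] := colouring_exact_dominates mu_n nu_n nz; last by right.
  by left; have := le_B mu mu_n; lia.
- move=> mu mu_n; have := colouring_exact_symmetrizer mu_n.
  rewrite -mxrank_eq0 /P; move: (mu_n); rewrite mem_partitions => /andP[part_mu /eqP sum_mu].
  have [k k_neq0 /(_ _ (colouring_repr mu n)) sqr] := symmetrizer_sqr R part_mu sum_mu.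
  by rewrite (quasi_idempotent_trace sqr) mulf_eq0 negb_or k_neq0 pnatr_eq0.
move=> nu nu_n; rewrite /P.
under eq_bigr => mu _ do rewrite mxtrace_symmetrizerE mulr_sumr.
rewrite exchange_big big1 //= => p _.
under eq_bigr => mu _ do rewrite mulr_sumr.
rewrite exchange_big big1 //= => q _.
under eq_bigr => mu _ do rewrite mxtrace_colouring mulrCA.
by rewrite -mulr_sumr d0 mulr0.
Qed.
End ColouringModule.

(** * Orbits of Young subgroups on colourings *)

Lemma perm_of_fibers (T : finType) (Y : eqType) (f g : T -> Y) :
    (forall y, #|[pred x | f x == y]| = #|[pred x | g x == y]|) ->
  exists s : {perm T}, forall x, g (s x) = f x.
Proof.
move=> eq_fg; pose Ef y := enum [pred x | f x == y]; pose Eg y := enum [pred x | g x == y].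
have lt_i x : (index x (Ef (f x)) < size (Eg (f x)))%N.
  by rewrite -cardE -eq_fg cardE index_mem mem_enum inE eqxx.
pose s x := nth x (Eg (f x)) (index x (Ef (f x))).
have gs x : g (s x) = f x.
  have : s x \in Eg (f x) by apply: mem_nth.
  by rewrite mem_enum => /eqP.
have s_inj : injective s.
  move=> x y eq_s; have e : f x = f y by rewrite -!gs eq_s.
  have := eq_s; rewrite /s e => eq_nth.
  have lt_x := lt_i x; rewrite e in lt_x.
  have : index x (Ef (f y)) == index y (Ef (f y)).
    rewrite -(nth_uniq x lt_x (lt_i y) (enum_uniq _)) eq_nth.
    by rewrite (set_nth_default x) ?lt_i.
  by move/eqP; apply: (index_inj x); rewrite /Ef mem_enum inE ?e.
by exists (perm s_inj) => x; rewrite permE gs.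
Qed.

Lemma size_undup_map (T : Type) (A B : eqType) (f : T -> A) (g : T -> B) (s : seq T) :
    (forall x y, (f x == f y) = (g x == g y)) ->
  size (undup [seq f x | x <- s]) = size (undup [seq g x | x <- s]).
Proof.
move=> fg; elim: s => //= x s IHs.
have -> : (f x \in [seq f y | y <- s]) = (g x \in [seq g y | y <- s]).
  by elim: s {IHs} => //= y s IHs; rewrite !inE fg IHs.
by case: ifP => //= _; rewrite IHs.
Qed.

Lemma card_imset_undup (T A : finType) (f : T -> A) :
  #|f @: [set: T]| = size (undup [seq f x | x : T]).
Proof.
rewrite -(card_uniqP (undup_uniq _)); apply: eq_card => a; rewrite mem_undup.
by apply/imsetP/mapP => -[x _ ->]; exists x; rewrite ?mem_enum ?inE.
Qed.

Section RowOrbits.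
Variables (R : realType) (n : nat) (mu nu : seq nat).
Local Notation F := R[i].
Local Open Scope nat_scope.

Lemma row_stab_group_set : group_set (row_stab n mu).
Proof.
by apply/group_setP; split=> [|x y x_mu y_mu]; rewrite ?row_stab1 ?row_stab_mul.
Qed.
Definition row_group : {group 'S_n} := Group row_stab_group_set.

(** The contingency table of rows of [mu] against colours, a complete invariant of the orbits of the
    Young subgroup. The number [a] of rows is a parameter so that the tables for n and n+1 have the
    same type. *)
Definition row_colour_count (a : nat) (f : colouring nu n) :
    {ffun 'I_a * 'I_(size nu).+1 -> nat} :=
  [ffun ij : 'I_a * 'I_(size nu).+1 =>
    #|[pred x : 'I_n | (cell_row mu x == val ij.1) && (val f x == ij.2)]|].

Definition row_colour_counts (a : nat) : seq {ffun 'I_a * 'I_(size nu).+1 -> nat} :=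
  undup [seq row_colour_count a f | f : colouring nu n].

Lemma row_orbitP a (f g : colouring nu n) : (forall x : 'I_n, cell_row mu x < a) ->
  (row_colour_count a f == row_colour_count a g) =
  (orbit (colouring_act nu n) row_group f == orbit (colouring_act nu n) row_group g).
Proof.
move=> lt_a; rewrite eq_sym; apply/eqP/eqP => [/ffunP e|/orbit_eqP/orbitP[p p_mu <-]].
  pose h (f : colouring nu n) (x : 'I_n) := (Ordinal (lt_a x), val f x).
  have [[y1 y2]|s hs] := @perm_of_fibers _ _ (h g) (h f).
    have := e (y1, y2); rewrite !ffunE /= => {}e; apply: etrans (etrans _ e) _.
      by apply: eq_card => x; rewrite !inE.
    by apply: eq_card => x; rewrite !inE.
  apply/orbit_eqP/orbitP; exists s.
    rewrite inE; apply/forallP => x.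
    by have /(congr1 (fun u => val u.1)) /= -> := hs x.
  apply/val_inj/ffunP => x; rewrite ffunE.
  by have /(congr1 snd) /= := hs ((s^-1)%g x); rewrite permKV.
apply/ffunP => ij; rewrite !ffunE -!sum1_card [RHS](reindex_inj (@perm_inj _ p)).
apply: eq_bigl => x; rewrite !inE ffunE permK; congr ((_ == _) && _).
by move: p_mu; rewrite inE => /forallP/(_ x)/eqP ->.
Qed.

(** The trace of the row sum adds up numbers of fixed colourings, so by the Cauchy-Frobenius formula
    it is the number of orbits times the order of the group; it is also the rank times that
    order. *)
Lemma rank_rowsum_colouring a : (forall x : 'I_n, cell_row mu x < a) ->
  \rank (rowsum (colouring_repr R nu n) mu) = size (row_colour_counts a).
Proof.
move=> lt_a; rewrite (size_undup_map _ (fun f g => row_orbitP f g lt_a)) -card_imset_undup.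
have tr_orb : (\tr (rowsum (colouring_repr R nu n) mu) =
    (#|orbit (colouring_act nu n) row_group @: [set: colouring nu n]| * #|row_group|)%:R :> F)%R.
  rewrite mxtrace_rowsum -Frobenius_Cauchy ?natr_sum; last by apply/actsP => g _ x; rewrite !inE.
  apply: eq_bigr => g _; rewrite mxtrace_action; congr (_%:R)%R.
  by apply: eq_card => f; rewrite !inE sub1set inE.
move: tr_orb; rewrite mxtrace_rowsum_rank natrM mulrC.
by move/(mulIf (card_row_stab_neq0 R n mu))/eqP; rewrite eqr_nat => /eqP ->.
Qed.
End RowOrbits.

(** * Stability of the decomposition of colouring modules *)

Section CountsStable.
Variables (n a0 a : nat) (lam nu : seq nat).
Hypotheses (lam_n : (a0 + sumn lam = n)%N) (le_n : (sumn lam + sumn nu <= n)%N).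
Local Open Scope nat_scope.
Local Notation row0 := (cell_row (a0 :: lam)).
Local Notation row1 := (cell_row (a0.+1 :: lam)).
Local Notation l := (size nu).+1.

Definition prolong (f : {ffun 'I_n -> 'I_l}) : {ffun 'I_n.+1 -> 'I_l} :=
  [ffun x => oapp f ord0 (unlift ord0 x)].

Lemma prolong0 f : prolong f ord0 = ord0.
Proof. by rewrite ffunE unlift_none. Qed.

Lemma prolongS f x : prolong f (lift ord0 x) = f x.
Proof. by rewrite ffunE liftK. Qed.

Lemma is_colouring_prolong (f : {ffun 'I_n -> 'I_l}) :
  is_colouring (prolong f) = is_colouring f.
Proof.
apply: eq_forallb => i; rewrite card_ordS /= prolong0 add0n.
by congr (_ == _); apply: eq_card => x; rewrite !inE prolongS.
Qed.

Definition prolong_colouring (f : colouring nu n) : colouring nu n.+1 :=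
  Sub (prolong (val f)) (etrans (is_colouring_prolong _) (valP f)).

Definition bump_count (M : {ffun 'I_a.+1 * 'I_l -> nat}) : {ffun 'I_a.+1 * 'I_l -> nat} :=
  [ffun ij => M ij + (ij == (ord0, ord0))].

Lemma bump_count_inj : injective bump_count.
Proof.
move=> M M' /ffunP e; apply/ffunP => ij.
by have := e ij; rewrite !ffunE => /addIn.
Qed.

Lemma row_colour_count_prolong f :
  row_colour_count (a0.+1 :: lam) a.+1 (prolong_colouring f) =
  bump_count (row_colour_count (a0 :: lam) a.+1 f).
Proof.
apply/ffunP => -[i j]; rewrite !ffunE /= card_ordS addnC; congr (_ + _).
  by apply: eq_card => x; rewrite !inE lift0 cell_row_consS prolongS.
by rewrite /= prolong0 cell_row_cons0 xpair_eqE -!val_eqE /= eq_sym [0 == j :> nat]eq_sym.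
Qed.

(** Pigeonhole: at most [sumn lam] cells are outside the first row and at most [sumn nu] have a
    colour other than 0, which does not exhaust n+1 cells. *)
Lemma exists_corner_cell (f : colouring nu n.+1) :
  exists c : 'I_n.+1, row1 c = 0 /\ val f c = ord0.
Proof.
have row_le : #|[pred c : 'I_n.+1 | row1 c != 0]| <= sumn lam.
  have := cardC [pred c : 'I_n.+1 | row1 c == 0].
  have r0 : #|[pred c : 'I_n.+1 | row1 c == 0]| = a0.+1.
    by apply: (@card_row (a0.+1 :: lam)); rewrite /= addSn lam_n.
  rewrite r0 card_ord => e; apply: (@leq_trans (n.+1 - a0.+1)); last by lia.
  by rewrite -[X in X - _]e addKn; apply: subset_leq_card; apply/subsetP => c; rewrite !inE.
have col_le : #|[pred c | val (val f c) != 0]| <= sumn nu.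
  have := cardC [pred c : 'I_n.+1 | val (val f c) == 0]; rewrite card_ord => e.
  rewrite -(leq_add2l #|[pred c | val (val f c) == 0]|) (colouring_fiber0 f) -[leqRHS]e.
  by rewrite leq_add2l; apply: subset_leq_card; apply/subsetP => c; rewrite !inE.
apply: contrapT => /forallNP none.
have : n.+1 <= #|[pred c : 'I_n.+1 | row1 c != 0]| + #|[pred c | val (val f c) != 0]|.
  rewrite -[leqLHS]card_ord -cardUI; apply: leq_trans (leq_addr _ _).
  apply: subset_leq_card; apply/subsetP => c _; rewrite !inE -negb_and.
  by apply/negP => /andP[/eqP rc /eqP fc]; apply: (none c); split=> //; apply: val_inj.
by move=> /leq_trans/(_ (leq_add row_le col_le))/leq_trans/(_ le_n); rewrite ltnn.
Qed.

(** Exchanging a cell of the first row and of colour 0 with the corner does not alter the table, and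
    the result is a prolongation. Hence every table for n+1 is a table for n with its corner raised
    by one. *)
Lemma corner_colouring (f : colouring nu n.+1) : exists g : colouring nu n,
  row_colour_count (a0.+1 :: lam) a.+1 (prolong_colouring g) =
  row_colour_count (a0.+1 :: lam) a.+1 f.
Proof.
have [c [rc fc]] := exists_corner_cell f; pose t := tperm c ord0.
pose h := colouring_act nu n.+1 f t.
have h0 : val h ord0 = ord0 by rewrite ffunE tpermV tpermR.
pose g := [ffun x => val h (lift ord0 x)] : {ffun 'I_n -> 'I_l}.
have hE : val h = prolong g.
  apply/ffunP => x; case: (unliftP ord0 x) => [y|] ->; last by rewrite prolong0.
  by rewrite prolongS [RHS]ffunE.
have g_col : is_colouring g by rewrite -is_colouring_prolong -hE; apply: valP.
exists (Sub g g_col); have -> : prolong_colouring (Sub g g_col) = h by apply: val_inj.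
apply/ffunP => -[i j]; rewrite !ffunE -!sum1_card [RHS](reindex_inj (@perm_inj _ t)).
apply: eq_bigl => x; rewrite !inE ffunE tpermV; congr ((_ == _) && _).
by rewrite /t; case: tpermP => // ->; rewrite rc cell_row_cons0.
Qed.

Lemma size_row_colour_counts :
  size (row_colour_counts n.+1 (a0.+1 :: lam) nu a.+1) =
  size (row_colour_counts n (a0 :: lam) nu a.+1).
Proof.
rewrite -[RHS](size_map bump_count); apply/perm_size/uniq_perm.
- exact: undup_uniq.
- by rewrite map_inj_uniq ?undup_uniq //; apply: bump_count_inj.
move=> M; rewrite mem_undup; apply/mapP/mapP => [[f _ ->]|[M']].
  have [g <-] := corner_colouring f; rewrite row_colour_count_prolong.
  by exists (row_colour_count (a0 :: lam) a.+1 g); rewrite // mem_undup map_f ?mem_enum.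
rewrite mem_undup => /mapP[f _ ->] ->; exists (prolong_colouring f); first by rewrite mem_enum.
by rewrite row_colour_count_prolong.
Qed.
End CountsStable.

(** * Triangular factorisation of the orbit counts *)

Section CharacterValues.
Variable R : realType.
Local Notation F := R[i].
Variable w : nat.
Local Notation P := (parts_upto w).

(** The matrix A of the overview, and next its matrix B: the row sum is a multiple of the projection
    onto the invariants of the Young subgroup, so its rank is their dimension. *)
Definition colour_mult n lam mu : F := (specht_mult (colouring_repr R mu n) (pad lam n))%:R.
Definition row_rank n lam mu : F := (\rank (rowsum (specht R n (pad lam n)) (pad mu n)))%:R.

Lemma upto_facts n mu : (2 * w < n)%N -> mu \in P ->
  [/\ is_part mu, (sumn mu <= w)%N, padded mu n, (sumn mu < n)%N & pad mu n \in partitions n].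
Proof.
move=> lt_n mu_w; have pm := padded_upto (ltnW lt_n) mu_w.
have n_gt0 : (0 < n)%N by apply: leq_ltn_trans lt_n.
have := upto_lt (ltnW lt_n) n_gt0 mu_w.
by move: mu_w; rewrite mem_parts_upto => /andP[part_mu le_w] lt; split=> //; apply: pad_partition.
Qed.

Lemma pad_dominates_triangular n lam mu : (2 * w < n)%N -> lam \in P -> mu \in P ->
  dominates (pad lam n) (pad mu n) ->
  (row_sum (pad lam n) < row_sum (pad mu n))%N \/ lam = mu.
Proof.
move=> lt_n /(upto_facts lt_n)[pl _ padl _ _] /(upto_facts lt_n)[pm _ padm _ _].
by case=> _ [|/(pad_inj pl pm padl padm)]; [left | right].
Qed.

Lemma colour_mult_triangular n : (2 * w < n)%N ->
  triangular P (fun lam => row_sum (pad lam n)) (colour_mult n).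
Proof.
move=> lt_n lam mu lam_w mu_w /eqP; rewrite pnatr_eq0 => /eqP c_neq0.
apply: pad_dominates_triangular => //.
have [_ _ _ _ pad_lam] := upto_facts lt_n lam_w.
have [part_mu _ pad_mu lt_mu _] := upto_facts lt_n mu_w.
exact: colouring_mult_dominates pad_lam c_neq0.
Qed.

Lemma colour_mult_diag n : (2 * w < n)%N -> {in P, forall lam, colour_mult n lam lam != 0}.
Proof.
move=> lt_n lam /(upto_facts lt_n)[part_lam _ pad_lam lt_lam _].
by rewrite pnatr_eq0; apply/eqP; apply: colouring_mult_diag.
Qed.

Lemma row_rank_triangular n : (2 * w < n)%N ->
  triangular P (fun lam => row_sum (pad lam n)) (row_rank n).
Proof.
move=> lt_n lam mu lam_w mu_w /eqP; rewrite pnatr_eq0 mxrank_eq0 => nz.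
apply: pad_dominates_triangular => //.
have [_ _ _ _ pad_lam] := upto_facts lt_n lam_w.
have [_ _ _ _ pad_mu] := upto_facts lt_n mu_w.
exact: specht_rowsum_neq0 nz.
Qed.

Lemma row_rank_diag n : (2 * w < n)%N -> {in P, forall lam, row_rank n lam lam = 1}.
Proof.
move=> lt_n lam /(upto_facts lt_n)[_ _ _ _ pad_lam].
by rewrite /row_rank specht_rowsum_diag.
Qed.

Lemma colour_mult_support n mu nu : (2 * w < n)%N -> mu \in P -> nu \in partitions n ->
  specht_mult (colouring_repr R mu n) nu <> 0%N -> (n - w <= nth 0 nu 0)%N.
Proof.
move=> lt_n /(upto_facts lt_n)[part_mu le_w pad_mu lt_mu _] nu_n c_neq0.
have [le_nu _] := colouring_mult_dominates part_mu pad_mu lt_mu nu_n c_neq0.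
by apply: leq_trans le_nu; rewrite pad_cons //= leq_sub2l.
Qed.

(** Both sides are the rank of the row sum of mu[n] on the colouring module of [nu], computed once
    from its constituents and once from orbits. *)
Lemma gram_colour_mult n mu nu : (2 * w < n)%N -> mu \in P -> nu \in P ->
  \sum_(lam <- P) colour_mult n lam nu * row_rank n lam mu =
  (size (row_colour_counts n (pad mu n) nu (size mu).+1))%:R.
Proof.
move=> lt_n mu_w nu_w; have [part_mu _ _ lt_mu pad_mu] := upto_facts lt_n mu_w.
rewrite -(@rank_rowsum_colouring R) => [|x]; last first.
  have -> : (size mu).+1 = size (pad mu n) by rewrite pad_cons.
  by apply: cell_row_lt; move: pad_mu; rewrite mem_partitions => /andP[_ /eqP ->].
rewrite rank_rowsum_specht natr_sum (big_partitions_pad (ltnW lt_n)) => [|la la_n /eqP].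
  by apply: eq_bigr => lam _; rewrite natrM.
rewrite pnatr_eq0 muln_eq0 negb_or => /andP[/eqP c_neq0 _].
exact: colour_mult_support c_neq0.
Qed.

Lemma gram_stable n mu nu : (2 * w < n)%N -> mu \in P -> nu \in P ->
  size (row_colour_counts n.+1 (pad mu n.+1) nu (size mu).+1) =
  size (row_colour_counts n (pad mu n) nu (size mu).+1).
Proof.
move=> lt_n mu_w nu_w; have [part_mu le_mu _ lt_mu _] := upto_facts lt_n mu_w.
have [_ le_nu _ _ _] := upto_facts lt_n nu_w.
rewrite (pad_consS part_mu lt_mu) (pad_cons part_mu lt_mu).
by apply: size_row_colour_counts; lia.
Qed.

(* [row_rank] is unitriangular and [colour_mult] triangular, so that both are
   determined by their product, which counts orbits of colourings. *)
Lemma LU_unique (I : eqType) (s : seq I) (M : I -> nat) (L1 U1 L2 U2 : I -> I -> F) :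
    uniq s -> triangular s M L1 -> triangular s M U1 -> triangular s M L2 -> triangular s M U2 ->
    {in s, forall i, L1 i i = 1} -> {in s, forall i, L2 i i = 1} ->
    {in s, forall i, U1 i i != 0} ->
    {in s &, forall i j, \sum_(k <- s) U1 k j * L1 k i = \sum_(k <- s) U2 k j * L2 k i} ->
  {in s &, forall i j, U1 i j = U2 i j}.
Proof.
move=> us tL1 tU1 tL2 tU2 dL1 dL2 dU1 eqN.
suff claim m i : (M i < m)%N -> i \in s ->
    {in s, forall j, U1 i j = U2 i j /\ L1 i j = L2 i j}.
  by move=> i j si sj; have [] := claim _ i (ltnSn _) si j sj.
elim: m i => // m IHm i; rewrite ltnS => le_m si.
have IH k : k \in s -> (M k < M i)%N ->
    {in s, forall j, U1 k j = U2 k j /\ L1 k j = L2 k j}.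
  by move=> sk lt_k; apply: IHm => //; apply: leq_trans lt_k le_m.
(* In equation (i, j) all terms but the one at [i] have lower height and are known, and [L i i = 1]
   isolates [U i j]. Equation (j, i) then isolates [U i i * L i j], whence the hypothesis that
   [U1 i i] is nonzero. *)
have eqU j : j \in s -> U1 i j = U2 i j.
  move=> sj; have := eqN i j si sj.
  rewrite (triangular_sum us tL1 _ si) (triangular_sum us tL2 _ si) dL1 // dL2 // !mulr1.
  rewrite big_seq_cond [in RHS]big_seq_cond.
  rewrite (eq_bigr (fun k => U2 k j * L2 k i)) => [/addIr //|k /andP[sk lt_k]].
  by have [-> _] := IH k sk lt_k j sj; have [_ ->] := IH k sk lt_k i si.
move=> j sj; split; first exact: eqU.
have := eqN j i sj si.
rewrite (eq_bigr (fun k => L1 k j * U1 k i)) => [|k _]; last exact: mulrC.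
rewrite [in RHS](eq_bigr (fun k => L2 k j * U2 k i)) => [|k _]; last exact: mulrC.
rewrite (triangular_sum us tU1 _ si) (triangular_sum us tU2 _ si) -eqU //.
rewrite big_seq_cond [in RHS]big_seq_cond.
rewrite (eq_bigr (fun k => L2 k j * U2 k i)) => [/addIr|k /andP[sk lt_k]].
  exact: (mulIf (dU1 i si)).
by have [_ ->] := IH k sk lt_k j sj; have [-> _] := IH k sk lt_k i si.
Qed.

Lemma colour_mult_stable n : (2 * w < n)%N ->
  {in P &, forall lam mu, colour_mult n.+1 lam mu = colour_mult n lam mu}.
Proof.
move=> lt_n lam mu lam_w mu_w; have lt_n' := ltnW lt_n : (2 * w < n.+1)%N.
(* Lengthening the first row does not change [row_sum], so the factors at n and n+1 are triangular
   for one and the same height. *)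
have tri_S (K : seq nat -> seq nat -> F) :
    triangular P (fun lam => row_sum (pad lam n.+1)) K ->
    triangular P (fun lam => row_sum (pad lam n)) K.
  move=> tK la mu' la_w mu_w'; have := tK la mu' la_w mu_w'.
  by rewrite !(row_sum_padS (ltnW lt_n)).
apply/esym/(LU_unique (parts_upto_uniq w) (row_rank_triangular lt_n) (colour_mult_triangular lt_n)
  (tri_S _ (row_rank_triangular lt_n')) (tri_S _ (colour_mult_triangular lt_n'))) => //.
- exact: row_rank_diag.
- exact: row_rank_diag.
- exact: colour_mult_diag.
by move=> i j i_w j_w; rewrite !gram_colour_mult // (gram_stable lt_n).
Qed.
End CharacterValues.

(** * Character values *)

Lemma triangular_solve (F : fieldType) (I : eqType) (s : seq I) (M : I -> nat) (K : I -> I -> F)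
    (d : I -> F) : uniq s -> triangular s M K -> {in s, forall i, K i i != 0} ->
  exists b : I -> F, {in s, forall i, d i = \sum_(j <- s) K i j * b j}.
Proof.
case: s => [|i0 s0]; first by exists d.
set s := i0 :: s0 => us tK dK; pose N := size s.
pose A : 'M[F]_N := \matrix_(i, j) K (nth i0 s i) (nth i0 s j).
have sumE (G : I -> F) : \sum_(i <- s) G i = \sum_(i < N) G (nth i0 s i).
  by rewrite (big_nth i0) big_mkord.
have A_unit : A \in unitmx.
  rewrite -row_free_unit -kermx_eq0; apply/eqP/row_matrixP => r; rewrite row0.
  set v := row r _; have vA : v *m A = 0 by rewrite -row_mul mulmx_ker row0.
  pose h i := oapp (v 0) 0 (insub (index i s)).
  have hE (i : 'I_N) : h (nth i0 s i) = v 0 i.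
    by rewrite /h index_uniq // valK.
  have h0 : {in s, forall i, h i = 0}.
    apply: (triangular_ker us tK dK) => j sj; have lt_j : (index j s < N)%N by rewrite index_mem.
    have := congr1 (fun B : 'rV_N => B 0 (Ordinal lt_j)) vA; rewrite !mxE => vA0.
    rewrite -[RHS]vA0 sumE; apply: eq_bigr => i _.
    by rewrite hE !mxE /= nth_index.
  by apply/rowP => i; rewrite -hE h0 ?mxE // mem_nth.
pose dv : 'cV[F]_N := \col_i d (nth i0 s i).
pose b i := oapp (fun j => (invmx A *m dv) j 0) 0 (insub (index i s)).
have bE (i : 'I_N) : b (nth i0 s i) = (invmx A *m dv) i 0 by rewrite /b index_uniq // valK.
exists b => i si; have lt_i : (index i s < N)%N by rewrite index_mem.
have := congr1 (fun B : 'cV_N => B (Ordinal lt_i) 0) (mulKVmx A_unit dv).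
rewrite !mxE /= nth_index // => <-; rewrite sumE; apply: eq_bigr => j _.
by rewrite bE !mxE /= nth_index.
Qed.

Section CycleValues.
Variable R : realType.
Local Notation F := R[i].

Definition cycle_value k m (s : 'S_k) lam : F :=
  \tr (specht R (k + m) (pad lam (k + m)) (perm_sum s (full_cycle m))).

Section Fixed.
Variable w : nat.
Local Notation P := (parts_upto w).
Variables (k m : nat) (s : 'S_k).
Hypotheses (le_k : (k <= w)%N) (lt_w : (2 * w < k + m)%N).

Lemma fixed_colourings_cycle_value mu : mu \in P ->
  (fixed_colourings mu s)%:R =
  \sum_(lam <- P) cycle_value m s lam * colour_mult R (k + m) lam mu.
Proof.
move=> mu_w; have := mu_w; rewrite mem_parts_upto => /andP[_ le_mu].
(* From [k <= w] and [2 * w < k + m] one gets [m > w >= sumn mu]; this is where [2 * w + 1] comes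
   from. *)
have lt_m : (sumn mu < m)%N by lia.
rewrite -(fixed_colourings_perm_sum s lt_m) -(mxtrace_colouring R) mxtrace_specht_mult.
rewrite (big_partitions_pad (ltnW lt_w)) => [|nu nu_n nz].
  by apply: eq_bigr => lam _; rewrite mulrC.
have c_neq0 : specht_mult (colouring_repr R mu (k + m)) nu <> 0%N.
  by move=> c0; apply: nz; rewrite c0 mul0r.
exact: colour_mult_support lt_w mu_w nu_n c_neq0.
Qed.
End Fixed.

(** The cycle values solve a linear system whose triangular matrix [colour_mult] and right-hand side
    [fixed_colourings mu s] are the same for [m] and [m.+1], and the solution is unique. *)
Lemma cycle_value_stable w k m (s : 'S_k) : (k <= w)%N -> (2 * w < k + m)%N ->
  {in parts_upto w, forall lam, cycle_value m.+1 s lam = cycle_value m s lam}.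
Proof.
move=> le_k lt_w lam lam_w; apply/eqP; rewrite -subr_eq0; apply/eqP.
have lt_w' : (2 * w < k + m.+1)%N by rewrite addnS ltnW.
pose h la : F := cycle_value m.+1 s la - cycle_value m s la.
suff h0 : {in parts_upto w, forall la, h la = 0} by apply: h0.
apply: (triangular_ker (parts_upto_uniq w) (@colour_mult_triangular R w _ lt_w)
  (colour_mult_diag R lt_w)).
move=> mu mu_w; rewrite /h.
under eq_bigr => la _ do rewrite mulrBl.
rewrite sumrB -fixed_colourings_cycle_value //; apply/eqP; rewrite subr_eq0; apply/eqP.
rewrite [RHS](fixed_colourings_cycle_value s le_k lt_w' mu_w).
rewrite big_seq [RHS]big_seq; apply: eq_bigr => la la_w; congr (_ * _).
by rewrite addnS (colour_mult_stable R lt_w).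
Qed.

Variable V : forall n, representation F [set: 'S_n]%G.

Lemma char_val_cycle_value w k m (s : 'S_k) : weight V = Some w -> (2 * w <= k + m)%N ->
  char_val V s m = \sum_(lam <- parts_upto w) (mult V lam (k + m))%:R * cycle_value m s lam.
Proof.
move=> w_eq le_w; rewrite /char_val mxtrace_specht_mult.
rewrite (big_partitions_pad le_w) => [|nu nu_n nz].
  rewrite big_seq [RHS]big_seq; apply: eq_bigr => lam lam_w.
  by rewrite /mult (padded_upto le_w lam_w).
have c_neq0 : specht_mult (V (k + m)) nu <> 0%N by move=> c0; apply: nz; rewrite c0 mul0r.
move: nu_n; rewrite mem_partitions => /andP[part_nu /eqP nu_n].
case: nu part_nu nu_n c_neq0 {nz} => [|a lam] part_al sum_al c_neq0.
  by move: sum_al => /=; lia.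
have part_lam := is_part_behead part_al.
have a_gt0 : (0 < a)%N := @part_nth_gt0 (a :: lam) 0 part_al isT.
have le_a : (head 0 lam <= a)%N.
  by have := @part_nth_le (a :: lam) 0 1 part_al isT; rewrite -nth0.
rewrite /= in sum_al *; have lt_lam : (sumn lam < k + m)%N by lia.
have padE : pad lam (k + m) = a :: lam by rewrite pad_cons //; congr (_ :: _); lia.
have le_lam : (sumn lam <= w)%N.
  apply: (mult_weight (n := (k + m)%N) w_eq part_lam); rewrite /mult /padded padE.
  by rewrite ifT //; lia.
by lia.
Qed.

Lemma char_val_stable w N k (s : 'S_k) m : weight V = Some w -> urms_range V N ->
    (k <= w)%N -> (2 * w < k + m)%N -> (N <= k + m)%N ->
  char_val V s m.+1 = char_val V s m.
Proof.
move=> w_eq stab le_k lt_w le_N; have le_w := ltnW lt_w.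
have le_w' : (2 * w <= k + m.+1)%N by rewrite addnS ltnW.
rewrite (char_val_cycle_value s w_eq le_w) (char_val_cycle_value s w_eq le_w').
rewrite big_seq [RHS]big_seq; apply: eq_bigr => lam lam_w.
rewrite (cycle_value_stable s le_k lt_w lam_w); congr (_%:R * _).
by rewrite addnS; apply/esym/stab => //; move: lam_w; rewrite mem_parts_upto => /andP[].
Qed.

Lemma urms_char_stabilizes w : urms V -> weight V = Some w ->
  forall k, (k <= w)%N -> forall s : 'S_k, char_stabilizes V s.
Proof.
case=> N stab w_eq k le_k s; exists (maxn N (2 * w).+1) => m /subnKC <-.
set M := maxn _ _; elim: (m - M)%N => [|j IHj]; first by rewrite addn0.
rewrite addnS -IHj; apply: (char_val_stable s w_eq stab le_k).
  by rewrite /M; lia.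
by rewrite /M; lia.
Qed.

Lemma cycle_value_free w n (d : seq nat -> F) : (2 * w < n)%N ->
    (forall k m (s : 'S_k), (k <= w)%N -> (k + m)%N = n ->
      \sum_(lam <- parts_upto w) d lam * cycle_value m s lam = 0) ->
  {in parts_upto w, forall lam, d lam = 0}.
Proof.
move=> lt_n d0.
(* Change of basis: the virtual character with coordinates [d] on Specht modules is rewritten with
   coordinates [b] on colouring modules, whose values are known. *)
have [b bE] := triangular_solve d (parts_upto_uniq w) (@colour_mult_triangular R w n lt_n)
  (colour_mult_diag R lt_n).
suff b0 : {in parts_upto w, forall mu, b mu = 0}.
  move=> lam lam_w; rewrite bE // big_seq big1 // => mu mu_w.
  by rewrite b0 // mulr0.
have fix0 k (s : 'S_k) : (k <= w)%N ->
    \sum_(mu <- parts_upto w) b mu * (fixed_colourings mu s)%:R = 0.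
  move=> le_k; pose m := (n - k)%N; have km : (k + m)%N = n by rewrite /m; lia.
  have lt_w : (2 * w < k + m)%N by rewrite km.
  rewrite -[RHS](d0 k m s le_k km) big_seq.
  under eq_bigr => mu mu_w do
    rewrite (fixed_colourings_cycle_value s le_k lt_w mu_w) mulr_sumr.
  rewrite -big_seq exchange_big /= big_seq [RHS]big_seq; apply: eq_bigr => lam lam_w.
  rewrite bE // mulr_suml; apply: eq_bigr => mu _; rewrite km.
  by rewrite mulrCA [RHS]mulrC [b mu * _]mulrC.
(* Induction on [sumn mu], evaluating at permutations of exactly [sumn mu] points. Larger partitions
   have no colouring of so few points, smaller ones have coefficient 0 by induction, and those of
   equal size have linearly independent characters. *)
move=> mu; have [j] := ubnP (sumn mu); elim: j mu => // j IHj mu lt_j mu_w.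
have := mu_w; rewrite mem_parts_upto => /andP[part_mu le_mu].
apply: (@fixed_colourings_free R (sumn mu) b); last by rewrite mem_partitions part_mu /=.
move=> s; rewrite -[RHS](fix0 _ s le_mu).
rewrite [RHS](bigID (fun la => sumn la == sumn mu)) /= [X in _ + X]big1_seq ?addr0.
  rewrite -[RHS]big_filter; apply: perm_big; apply: uniq_perm.
  - exact: partitions_uniq.
  - exact: filter_uniq (parts_upto_uniq w).
  move=> la; rewrite [RHS]mem_filter mem_parts_upto mem_partitions.
  by case: eqP => [->|_]; rewrite ?le_mu ?andbT ?andbF.
move=> la /andP[ne la_w]; case: (ltngtP (sumn la) (sumn mu)) ne => // lt _.
  by rewrite IHj ?mul0r //; apply: leq_trans lt _.
have -> : fixed_colourings la s = 0%N; last by rewrite mulr0.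
apply/eqP; rewrite -card_fixed_colouring -leqn0 leqNgt; apply/negP => /card_gt0P[f _].
by have := colouring_fiber0 f; lia.
Qed.

Lemma char_val_stable_upto w n : weight V = Some w -> (2 * w < n)%N ->
    (forall k m (s : 'S_k), (k <= w)%N -> (k + m)%N = n ->
      char_val V s m = char_val V s m.+1) ->
  {in parts_upto w, forall lam, mult V lam n = mult V lam n.+1}.
Proof.
move=> w_eq lt_n stab lam lam_w; apply/eqP; rewrite -(eqr_nat F) -subr_eq0; apply/eqP.
pose h la : F := (mult V la n)%:R - (mult V la n.+1)%:R.
suff h0 : {in parts_upto w, forall la, h la = 0} by apply: h0.
apply: (cycle_value_free lt_n).
move=> k m s le_k km; have le_w : (2 * w <= k + m)%N by rewrite km ltnW.
have le_w' : (2 * w <= k + m.+1)%N by rewrite addnS km; apply: leqW; apply: ltnW.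
have := stab k m s le_k km.
rewrite (char_val_cycle_value s w_eq le_w) (char_val_cycle_value s w_eq le_w') => /eqP.
rewrite -subr_eq0 -sumrB => /eqP sub0; rewrite -[RHS]sub0 big_seq [RHS]big_seq.
apply: eq_bigr => la la_w; rewrite addnS km (cycle_value_stable s le_k _ la_w) ?km //.
by rewrite mulrBl.
Qed.

Lemma rg_pz_neqNone mu : (forall s : 'S_(sumn mu), char_stabilizes V s) -> rg_pz V mu <> None.
Proof.
move=> /fin_all_exists[M MP]; apply/least_neqNone.
pose B := (\max_(s : 'S_(sumn mu)) M s)%N.
have le_B s : (M s <= B)%N by apply: (leq_bigmax (F := M)).
exists (sumn mu + B)%N; split=> [|s _ m]; first exact: leq_addr.
rewrite leq_add2l addKn => le_m.
by rewrite (MP s m) ?(MP s B) // (leq_trans (le_B s)).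
Qed.

Lemma rg_pzP mu a k (s : 'S_k) m : rg_pz V mu = Some a -> sumn mu = k -> cycle_type s mu ->
  (a <= k + m)%N -> char_val V s m = char_val V s m.+1.
Proof.
move=> rg_mu mu_k; case: k / mu_k s => s s_mu le_a.
have := leastP (fun n => (sumn mu <= n)%N /\
    forall s : 'S_(sumn mu), cycle_type s mu ->
    forall m, (n <= sumn mu + m)%N -> char_val V s m = char_val V s (n - sumn mu)).
rewrite -/(rg_pz V mu) rg_mu => -[[_ stab] _].
by rewrite (stab s s_mu m) // (stab s s_mu m.+1) // addnS leqW.
Qed.

Lemma char_stabilizes_range w : weight V = Some w ->
    (forall k, (k <= w)%N -> forall s : 'S_k, char_stabilizes V s) ->
  exists2 N, xmax (Some (2 * w + 1)%N) (xmax_parts w (rg_pz V)) = Some N & urms_range V N.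
Proof.
move=> w_eq stab; have [|N [eqN le_N rgN]] := @xmax_partsP w (2 * w + 1)%N (rg_pz V).
  by move=> mu _ le_w; apply/rg_pz_neqNone/stab.
exists N => //; apply: (urms_range_upto w_eq) => n le_n.
apply: char_val_stable_upto => //; first by lia.
(* Every [s] in S_k has as cycle type a partition of [k <= w], so its range is among those over
   which the maximum is taken. *)
move=> k m s le_k km; have := cycle_type_porbit_type s; set mu := porbit_type s => s_mu.
have := porbit_type_partition s; rewrite -/mu mem_partitions => /andP[part_mu /eqP mu_k].
have le_mu : (sumn mu <= w)%N by rewrite mu_k.
case rg_mu : (rg_pz V mu) => [a|].
  apply: (rg_pzP rg_mu mu_k s_mu); rewrite km.
  exact: leq_trans (rgN mu a part_mu le_mu rg_mu) le_n.
by case: (rg_pz_neqNone (fun s => stab _ le_mu s) rg_mu).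
Qed.

Lemma urms_iff_char_stabilizes : urms V <-> exists2 w, weight V = Some w
  & forall k, (k <= w)%N -> forall s : 'S_k, char_stabilizes V s.
Proof.
split=> [u_V|[w w_eq stab]].
  case w_eq : (weight V) (urms_weight u_V) => [w|] // _.
  by exists w => //; apply: urms_char_stabilizes.
by have [N _ stabN] := char_stabilizes_range w_eq stab; exists N.
Qed.

Lemma urms_range_pz : urms V -> exists w, weight V = Some w /\
  exists2 N, xmax (Some (2 * w + 1)%N) (xmax_parts w (rg_pz V)) = Some N & urms_range V N.
Proof.
move=> u_V; case w_eq : (weight V) (urms_weight u_V) => [w|] // _; exists w; split=> //.
exact: char_stabilizes_range w_eq (urms_char_stabilizes u_V w_eq).
Qed.
End CycleValues.

Theorem theorem3p2p1 (R : realType)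
    (V : forall n : nat, representation R[i] [set: 'S_n]%G) :
  let F := fun n : nat => frobenius (V n) in
  (* (a) *)
  [/\ urms V <-> (weight V <> None /\ m_stable F),
      urms V -> forall lam : seq nat, is_part lam ->
        exists2 N : nat,
          xmax (Some (2 * sumn lam)%N) (xmax_parts (sumn lam) (rg_m F)) = Some N
          & forall n : nat, (N <= n)%N -> mult V lam n = mult V lam N
    & urms V -> exists w : nat, weight V = Some w /\
        exists2 N : nat,
          xmax (Some (2 * w)%N) (xmax_parts w (rg_m F)) = Some N
          & urms_range V N]
  /\
  (* (b) *)
  (urms V <->
     exists2 w : nat, weight V = Some w
       & forall k : nat, (k <= w)%N -> forall s : 'S_k, char_stabilizes V s)
  /\
  (urms V -> exists w : nat, weight V = Some w /\
     exists2 N : nat,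
       xmax (Some (2 * w + 1)%N) (xmax_parts w (rg_pz V)) = Some N
       & urms_range V N).
Proof.
move=> F; split; [split | split].
- exact: urms_iff_m_stable.
- exact: urms_mult_range.
- exact: urms_range_m.
- exact: urms_iff_char_stabilizes.
- exact: urms_range_pz.
Qed.
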